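(* Let $(a_n)_{n=1}^\infty$ be a real-valued, positive, lacunary sequence. Then for almost all $\alpha\in\mathbb{R}$ (with respect to Lebesgue measure), the $k$-level correlation of the sequence $(\alpha a_n)_{n=1}^\infty$ is Poissonian for all $k\ge 2$.
   Context: A sequence $(a_n)_{n\ge1}$ of positive reals is lacunary if there exists $c>1$ with $a_{n+1}\ge c\,a_n$ for all $n\ge1$. For a real sequence $(b_n)$, $k\ge2$, $N\ge1$ and a compactly supported, real-valued, smooth $f:\mathbb{R}^{k-1}\to\mathbb{R}$, the $k$-level correlation sum is $$R_k(f,(b_n),N):=\frac1N\sum_{m\in\mathbb{Z}^{k-1}}\ \sum_{\substack{x=(x_1,\dots,x_k)\\ 1\le x_1,\dots,x_k\le N\\ x_1,\dots,x_k\ \text{distinct}}} f\big(N(\Delta_{(b_n)}(x)-m)\big),$$ where $\Delta_{(b_n)}(x):=(b_{x_1}-b_{x_2},b_{x_2}-b_{x_3},\dots,b_{x_{k-1}}-b_{x_k})\in\mathbb{R}^{k-1}$. The sequence $(b_n)$ has Poissonian $k$-level correlation if for every compactly supported, real-valued, smooth $f:\mathbb{R}^{k-1}\to\mathbb{R}$ one has $\lim_{N\to\infty}R_k(f,(b_n),N)=\int_{\mathbb{R}^{k-1}}f(x)\,dx$. *)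

(* Defs.v *)
From HB Require Import structures.
From mathcomp Require Import all_boot all_order all_algebra.
From mathcomp Require Import all_classical all_reals all_analysis.

Set Implicit Arguments.
Unset Strict Implicit.
Unset Printing Implicit Defensive.

Import Order.TTheory GRing.Theory Num.Theory.
Import numFieldNormedType.Exports.

Local Open Scope classical_set_scope.
Local Open Scope ring_scope.

Section cons_measure.
Context d (T : measurableType d) (R : realType) (n : nat).
Variable m1 : {sigma_finite_measure set T -> \bar R}.
Variable m2 : {sigma_finite_measure set (n.-tuple T) -> \bar R}.

Definition cons_pair (p : T * n.-tuple T) : n.+1.-tuple T :=
  [tuple of p.1 :: p.2].

Lemma measurable_cons_pair : measurable_fun [set: T * n.-tuple T] cons_pair.
Proof. by apply: measurable_cons. Qed.

Definition cons_measure : set (n.+1.-tuple T) -> \bar R :=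
  pushforward (m1 \x m2)%E cons_pair.

Let cons_measure0 : cons_measure set0 = 0%E.
Proof. by rewrite /cons_measure /pushforward preimage_set0 measure0. Qed.

Let cons_measure_ge0 A : (0 <= cons_measure A)%E.
Proof. by rewrite /cons_measure /pushforward measure_ge0. Qed.

Let cons_measure_semi_sigma_additive : semi_sigma_additive cons_measure.
Proof.
apply: measure_semi_sigma_additive; exact: measurable_cons_pair.
Qed.

HB.instance Definition _ := isMeasure.Build _ _ _ cons_measure
  cons_measure0 cons_measure_ge0 cons_measure_semi_sigma_additive.

Lemma cons_measure_sigma_finite : sigma_finite setT cons_measure.
Proof.
have /sigma_finiteP[F [TF ndF Foo]] := sigma_finiteT m1.
have /sigma_finiteP[G [TG ndG Goo]] := sigma_finiteT m2.
pose g (t : n.+1.-tuple T) := (thead t, [tuple of behead t]).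
have mg : measurable_fun setT g.
  by apply: measurable_fun_pair; [exact: measurable_tnth|
                                  exact: measurable_behead].
exists (fun i => g @^-1` (F i `*` G i)).
  rewrite -preimage_bigcup -(preimage_setT g); congr (g @^-1` _).
  apply/seteqP; split => // -[x y] _.
  have : [set: T] x by []. rewrite TF => -[i _ Fix].
  have : [set: n.-tuple T] y by []. rewrite TG => -[j _ Gjy].
  exists (maxn i j) => //; split => /=.
  - by move: x Fix; exact/subsetPset/ndF/leq_maxl.
  - by move: y Gjy; exact/subsetPset/ndG/leq_maxr.
move=> i; have [mF Fi] := Foo i; have [mG Gi] := Goo i; split.
  by rewrite -[X in measurable X]setTI; apply: mg => //; exact: measurableX.
rewrite /cons_measure /pushforward -comp_preimage.
have -> : g \o cons_pair = idfun.
  by apply/funext => -[x t] /=; congr pair; apply: val_inj.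
by rewrite preimage_id product_measure1E// lte_mul_pinfty// ge0_fin_numE.
Qed.

HB.instance Definition _ :=
  Measure_isSigmaFinite.Build _ _ _ cons_measure cons_measure_sigma_finite.

End cons_measure.

(* The n-fold product of the Lebesgue measure of the line, on n-tuples of
   reals with their product sigma-algebra, i.e., the Borel sigma-algebra of
   R^n. *)
Fixpoint lebesgue_tuple (R : realType) (n : nat) :
    {sigma_finite_measure set (n.-tuple (measurableTypeR R)) -> \bar R} :=
  match n with
  | 0 => \d_([tuple] : 0.-tuple (measurableTypeR R))
  | n'.+1 => cons_measure (@lebesgue_measure R) (lebesgue_tuple R n')
  end.

(* Topology and derivatives live on row vectors, measurability on tuples. *)
Definition Rn_integral (R : realType) (n : nat) (f : 'rV[R]_n -> R) : R :=
  \int[lebesgue_tuple R n]_t f (\row_i tnth t i).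

Fixpoint Cn_fun (R : realType) (n m : nat) (f : 'rV[R]_n -> R) : Prop :=
  match m with
  | 0 => continuous f
  | m'.+1 => continuous f /\
      forall i : 'I_n, (forall x, derivable f x (delta_mx 0 i)) /\
                       Cn_fun m' ('D_(delta_mx 0 i) f)
  end.

Definition smooth (R : realType) (n : nat) (f : 'rV[R]_n -> R) : Prop :=
  forall m, Cn_fun m f.

Definition compactly_supported (R : realType) (n : nat) (f : 'rV[R]_n -> R) :=
  compact (closure [set x | f x != 0]).

(* Sequences (a_n)_(n >= 1) are functions on nat whose value at 0 is never
   used. *)
Definition lacunary (R : realType) (a : nat -> R) : Prop :=
  exists2 c : R, 1 < c & forall n, (1 <= n)%N -> c * a n <= a n.+1.

Section correlation.
Context (R : realType) (k : nat).

Definition Delta (b : nat -> R) (x : seq nat) : 'rV[R]_k.-1 :=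
  \row_(i < k.-1) (b (nth 0%N x i) - b (nth 0%N x i.+1)).

(* The indices x_1, ..., x_k in {1, ..., N} are the successors of the entries
   of a tuple over 'I_N. When N > 0 and f has compact support only finitely
   many m have a nonzero inner sum, so the finitely supported sum over m is
   the sum over all of Z^(k-1). *)
Definition correlation_sum (f : 'rV[R]_k.-1 -> R) (b : nat -> R) (N : nat) : R :=
  N%:R^-1 *
  \sum_(m \in [set: 'rV[int]_k.-1])
    \sum_(x : k.-tuple 'I_N | uniq x)
      f (N%:R *: (Delta b [seq (j : 'I_N).+1 | j <- x] - map_mx intr m)).

Definition poissonian_correlation (b : nat -> R) : Prop :=
  forall f : 'rV[R]_k.-1 -> R, smooth f -> compactly_supported f ->
    correlation_sum f b N @[N --> \oo] --> Rn_integral f.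

End correlation.

Arguments Delta {R} k b x.
Arguments correlation_sum {R} k f b N.
Arguments poissonian_correlation {R} k b.

(* Main.v *)
(* Fix N = j^(2K+4), with K = k - 1, and M = N^2, and let the digit of x be the
   residue of floor(M alpha a_x) modulo M. Translating alpha by c / (M a_i)
   shifts the digit of i by c and hardly moves the digits of indices well below
   i, as the sequence is lacunary. So when the indices x are pairwise at least
   j apart, the mean over an interval of a function of their digits is, up to
   an error of order M c^(-j), its mean over independent uniform digits. Hence
   the number of spread k-tuples all of whose differences of consecutive
   digits lie in windows of length of order M / N has almost no variance,
   except for the pairs of tuples that contain indices close to each other.
   These pairs are controlled outside the set of alpha for which some arc of
   length of order 1 / N holds too many points; that set is negligible because
   a crowded arc yields at least j^m clusters of m spread points, whereas the
   mean number of clusters is O(N). The resulting bounds O(j^-2) are summable,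
   which gives almost everywhere convergence of box counts along N = j^(2K+4);
   it extends to all N by monotonicity, since consecutive scales have ratio
   tending to 1, and from boxes to test functions by step functions. *)
Require Import Defs.
From mathcomp Require Import all_boot all_order all_algebra.
From mathcomp Require Import all_classical all_reals all_analysis.
From mathcomp Require Import measurable_realfun ring lra zify.

Set Implicit Arguments.
Unset Strict Implicit.
Unset Printing Implicit Defensive.

Import Order.TTheory GRing.Theory Num.Theory.
Import numFieldNormedType.Exports.

Local Open Scope classical_set_scope.
Local Open Scope ring_scope.

(** * Means over unit intervals *)

(** The separation [j] also labels the scale: as N and M are powers of [j], the factor c^(-j)
    absorbs the number of all pairs of tuples. With M = N^2 the windows have about N residues, so
    rounding to digits costs a relative error of order 1/N. The obstacle is that indices closer than
    [j] are not independent. For two of them only the bound O(1/N) on the probability of lying near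
    each other is at hand, from |a_x - a_y| >= (c - 1) a_1. The tuples containing such a pair must
    then be counted through the number of neighbours of a point, which is what crowding bounds. But
    the absence of crowding is itself an event about all digits and would spoil the covariances, so
    it is inserted pointwise, after the jointly spread part of the second moment has been isolated.
    The close pairs leave a term of order j^(2K+1) / N, to be made O(j^(-2)); this dictates the
    exponent of the scale. Boxes have rational ends and alpha ranges over unit intervals with
    integer ends, so that countably many null sets suffice for all k and all test functions. *)

Section UnitIntervalMean.
Context {R : realType}.
Notation mu := (@lebesgue_measure R).
Implicit Types (z t B : R) (h g : R -> R).

Definition bounded_measurable h :=
  measurable_fun setT h /\ exists B, forall x, `|h x| <= B.

Lemma bounded_measurable_cst B : bounded_measurable (fun=> B).
Proof. by split; [exact: measurable_cst|exists `|B|]. Qed.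

Lemma bounded_measurableD h g : bounded_measurable h -> bounded_measurable g ->
  bounded_measurable (fun x => h x + g x).
Proof.
move=> [mh [B hB]] [mg [C gC]]; split; first exact: measurable_funD.
by exists (B + C) => x; rewrite (le_trans (ler_normD _ _))// lerD.
Qed.

Lemma bounded_measurableM h g : bounded_measurable h -> bounded_measurable g ->
  bounded_measurable (fun x => h x * g x).
Proof.
move=> [mh [B hB]] [mg [C gC]]; split; first exact: measurable_funM.
by exists (B * C) => x; rewrite normrM ler_pM.
Qed.

Lemma bounded_measurableB h g : bounded_measurable h -> bounded_measurable g ->
  bounded_measurable (fun x => h x - g x).
Proof.
move=> [mh [B hB]] [mg [C gC]]; split; first exact: measurable_funB.
by exists (B + C) => x; rewrite (le_trans (ler_normB _ _))// lerD.
Qed.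

Lemma bounded_measurable_sum (I : Type) (r : seq I) (P : pred I)
    (h : I -> R -> R) : (forall i, bounded_measurable (h i)) ->
  bounded_measurable (fun x => \sum_(i <- r | P i) h i x).
Proof.
move=> bh; elim: r => [|i r IH].
  by under eq_fun do rewrite big_nil; exact: bounded_measurable_cst.
under eq_fun do rewrite big_cons; case: (P i) => //.
exact: bounded_measurableD.
Qed.

Lemma bounded_measurable_indic (A : set R) : measurable A ->
  bounded_measurable (\1_A).
Proof.
move=> mA; split; first exact: measurable_indic.
by exists 1 => x; rewrite indicE; case: (x \in A); rewrite ?normr0 ?normr1 ?ler01.
Qed.

(** Unit intervals with integer left ends tile the line; on each of them Lebesgue measure is a
    probability and this integral an expectation over alpha. *)
Definition mean z h := \int[mu]_(x in `[z, z + 1[) h x.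

Lemma lebesgue_unit z : mu `[z, z + 1[%classic = 1%E.
Proof.
rewrite lebesgue_measure_itv/= lte_fin ltrDl ltr01 -EFinB.
by congr EFin; rewrite addrC addKr.
Qed.

Lemma lebesgue_itv_lty (a b : R) : (mu `[a, b[%classic < +oo)%E.
Proof.
by rewrite lebesgue_measure_itv/=; case: ifP; rewrite ?ltry// -EFinB ltry.
Qed.

Lemma bounded_measurable_integrable (A : set R) h : bounded_measurable h ->
  measurable A -> (mu A < +oo)%E -> mu.-integrable A (EFin \o h).
Proof.
move=> [mh [B hB]] mA Aoo; apply: measurable_bounded_integrable => //.
  exact: measurable_funTS.
exists B; split; first exact: num_real.
by move=> M BM x _; apply: le_trans (hB x) _; exact: ltW.
Qed.

Lemma mean_integrable z h : bounded_measurable h ->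
  mu.-integrable `[z, z + 1[%classic (EFin \o h).
Proof.
move=> bh; apply: bounded_measurable_integrable => //.
exact: lebesgue_itv_lty.
Qed.

Lemma mean_cst z B : mean z (fun=> B) = B.
Proof.
rewrite /mean Rintegral_cst// [X in _ * X](_ : _ = 1) ?mulr1//.
exact: (congr1 fine (lebesgue_unit z)).
Qed.

Lemma meanD z h g : bounded_measurable h -> bounded_measurable g ->
  mean z (fun x => h x + g x) = mean z h + mean z g.
Proof. by move=> bh bg; rewrite /mean RintegralD//; exact: mean_integrable. Qed.

Lemma meanB z h g : bounded_measurable h -> bounded_measurable g ->
  mean z (fun x => h x - g x) = mean z h - mean z g.
Proof. by move=> bh bg; rewrite /mean RintegralB//; exact: mean_integrable. Qed.

Lemma meanZ z B h : bounded_measurable h ->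
  mean z (fun x => B * h x) = B * mean z h.
Proof. by move=> bh; rewrite /mean RintegralZl//; exact: mean_integrable. Qed.

Lemma mean_sum z (I : Type) (r : seq I) (P : pred I) (h : I -> R -> R) :
  (forall i, bounded_measurable (h i)) ->
  mean z (fun x => \sum_(i <- r | P i) h i x) = \sum_(i <- r | P i) mean z (h i).
Proof.
move=> bh; elim: r => [|i r IH].
  by under eq_fun do rewrite big_nil; rewrite mean_cst big_nil.
rewrite big_cons; under eq_fun do rewrite big_cons.
case: (P i) => //; rewrite meanD ?IH//; exact: bounded_measurable_sum.
Qed.

Lemma le_mean z h g : bounded_measurable h -> bounded_measurable g ->
  (forall x, z <= x < z + 1 -> h x <= g x) -> mean z h <= mean z g.
Proof.
by move=> bh bg hg; apply: le_Rintegral => //; exact: mean_integrable.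
Qed.

Lemma mean_norm_le z h g : bounded_measurable h -> bounded_measurable g ->
  (forall x, z <= x < z + 1 -> `|h x| <= g x) -> `|mean z h| <= mean z g.
Proof.
move=> bh bg hg; rewrite ler_norml; apply/andP; split.
  rewrite -[X in X <= _]mulN1r -meanZ//; apply: le_mean => //.
    by apply: bounded_measurableM => //; exact: bounded_measurable_cst.
  by move=> x /hg; rewrite mulN1r ler_norml => /andP[].
by apply: le_mean => // x /hg; rewrite ler_norml => /andP[].
Qed.

Lemma mean_indic z (A : set R) : measurable A ->
  mean z (\1_A) = fine (mu (A `&` `[z, z + 1[)).
Proof. by move=> mA; rewrite /mean /Rintegral integral_indic. Qed.

(** The pushforward under the translation has the same values on the intervals []a, b]], and these
    determine the measure. *)
Lemma lebesgue_translate t (A : set R) : measurable A ->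
  mu ((fun x => x + t) @^-1` A) = mu A.
Proof.
move=> mA.
have mt : measurable_fun setT (fun x : R => x + t).
  by apply: measurable_funD => //; exact: measurable_cst.
suff -> : mu A = pushforward mu ((fun x => x + t) : _ -> measurableTypeR R) A.
  by [].
apply: lebesgue_measure_unique => //= _ [[a b] _ <-].
rewrite /pushforward; have -> : (fun x => x + t) @^-1` `]a, b]%classic
    = `]a - t, b - t]%classic.
  by apply/seteqP; split => x /=; rewrite !in_itv/= ltrBlDr lerBrDr.
rewrite !lebesgue_measure_itv/= !lte_fin ltrD2r.
by case: ifP => // _; rewrite -!EFinB; congr EFin; lra.
Qed.

Lemma Rintegral_translate t (A : set R) h : bounded_measurable h ->
  measurable A -> (mu A < +oo)%E ->
  \int[mu]_(x in (fun x => x + t) @^-1` A) h (x + t) = \int[mu]_(x in A) h x.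
Proof.
move=> bh mA Aoo.
have mt : measurable_fun setT (fun x : R => x + t).
  by apply: measurable_funD => //; exact: measurable_cst.
congr fine.
have bht : bounded_measurable (fun x => h (x + t)).
  case: bh => mh [B hB]; split; last by exists B => x; exact: hB.
  exact: measurableT_comp.
have ih : mu.-integrable ((fun x => x + t) @^-1` A)
    (fun x => (h (x + t))%:E).
  apply: (bounded_measurable_integrable bht).
  + by rewrite -[X in measurable X]setTI; apply: mt.
  + by rewrite lebesgue_translate.
have mEh : measurable_fun setT (EFin \o h).
  by apply/measurable_EFinP; exact: bh.1.
have := @integral_pushforward _ _ (measurableTypeR R) (measurableTypeR R) R
  _ mt mu A (EFin \o h) mEh ih mA.
move=> <-; apply: eq_measure_integral => B mB _; exact: lebesgue_translate.
Qed.

Lemma norm_Rintegral_le (A : set R) h B : bounded_measurable h ->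
  measurable A -> (mu A < +oo)%E -> (forall x, `|h x| <= B) ->
  `|\int[mu]_(x in A) h x| <= B * fine (mu A).
Proof.
move=> bh mA Aoo hB; rewrite -Rintegral_cst//.
apply: le_trans (le_normr_Rintegral _ _) _ => //.
  exact: bounded_measurable_integrable.
apply: le_Rintegral => //.
- apply: (@bounded_measurable_integrable A (fun x => `|h x|)) => //.
  split; first by apply: measurableT_comp => //; exact: bh.1.
  by exists B => x; rewrite normr_id.
- by apply: bounded_measurable_integrable => //; exact: bounded_measurable_cst.
Qed.

(** For t < 1 the shifted interval overlaps the original one and only two end pieces of length [t]
    survive in the difference; for t >= 1 the trivial bound 2 * B is enough. *)
Lemma mean_translate z t h B : bounded_measurable h -> 0 <= t ->
  (forall x, `|h x| <= B) ->
  `|mean z (fun x => h (x + t)) - mean z h| <= 2 * t * B.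
Proof.
move=> bh t0 hB.
have B0 : 0 <= B := le_trans (normr_ge0 _) (hB 0).
have bht : bounded_measurable (fun x => h (x + t)).
  case: bh => mh [C hC]; split; last by exists C => x; exact: hC.
  apply: measurableT_comp => //.
  by apply: measurable_funD => //; exact: measurable_cst.
have [t1|t1] := leP 1 t.
  have nB g : bounded_measurable g -> (forall x, `|g x| <= B) ->
      `|mean z g| <= B.
    move=> bg gB; rewrite -(mean_cst z B); apply: mean_norm_le => //.
    exact: bounded_measurable_cst.
  rewrite (le_trans (ler_normB _ _))//.
  have := nB _ bht (fun x => hB _); have := nB _ bh hB; nra.
have -> : mean z (fun x => h (x + t)) = \int[mu]_(x in `[z + t, z + 1 + t[) h x.
  have E : (fun x => x + t) @^-1` `[z + t, z + 1 + t[ = `[z, z + 1[%classic.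
    by apply/seteqP; split => x /=; rewrite !in_itv/= lerD2r ltrD2r.
  rewrite /mean -E (@Rintegral_translate t)//; exact: lebesgue_itv_lty.
have split_itv (a b c : R) : a <= b <= c ->
    \int[mu]_(x in `[a, c[) h x =
    \int[mu]_(x in `[a, b[) h x + \int[mu]_(x in `[b, c[) h x.
  move=> /andP[ab bc].
  have E : `[a, c[%classic = `[a, b[ `|` `[b, c[ :> set R.
    apply/seteqP; split => x /=; rewrite !in_itv/=.
      by move=> /andP[-> ->]; case: (ltP x b) => _; [left|right].
    by move=> [] /andP[]; lra.
  rewrite E Rintegral_setU//.
    rewrite -E; apply: bounded_measurable_integrable => //.
    exact: lebesgue_itv_lty.
  by apply/disj_setPS => x /=; rewrite !in_itv/=; lra.
have S1 : mean z h = _ := @split_itv z (z + t) (z + 1) _.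
have S2 := @split_itv (z + t) (z + 1) (z + 1 + t) _.
rewrite {}S1 ?{}S2; [|by apply/andP; lra|by apply/andP; lra].
have len a : fine (mu `[a, a + t[%classic) = t.
  rewrite lebesgue_measure_itv/= lte_fin ltrDl.
  have [t0'|t0'] := ltP 0 t; first by rewrite -EFinB/=; lra.
  by apply/esym/eqP; rewrite eq_le t0' t0.
have := @norm_Rintegral_le `[z + 1, z + 1 + t[%classic _ _ bh
  (measurable_itv _) (lebesgue_itv_lty _ _) hB.
have := @norm_Rintegral_le `[z, z + t[%classic _ _ bh
  (measurable_itv _) (lebesgue_itv_lty _ _) hB.
rewrite !len.
move: (\int[mu]_(x in `[z, z + t[) h x) (\int[mu]_(x in `[z + t, z + 1[) h x)
  (\int[mu]_(x in `[z + 1, z + 1 + t[) h x) => u v w uB wB.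
rewrite (_ : _ - _ = w - u); last by ring.
by rewrite (le_trans (ler_normB _ _))//; lra.
Qed.

End UnitIntervalMean.

(** * Digits and decoupling *)

Section Discretisation.
Context {R : realType}.
Implicit Types (z t B D eta alpha : R).

Lemma measurable_int_union (F : int -> set R) :
  (forall m, measurable (F m)) -> measurable [set x | exists m, F m x].
Proof.
move=> mF; rewrite (_ : [set x | _] = \bigcup_m F m); last first.
  by apply/seteqP; split => x [] m; [exists m|move=> _; exists m].
apply: countable_bigcupT_measurable => //; exact: countableP.
Qed.

Lemma measurable_floor (Y : set int) : measurable [set x : R | Y (Num.floor x)].
Proof.
rewrite (_ : [set x | _] =
  [set x | exists m, (if `[< Y m >] then `[m%:~R, (m + 1)%:~R[%classic
                      else set0) x]).
  by apply: measurable_int_union => m; case: asboolP => _;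
    [exact: measurable_itv|exact: measurable0].
apply/seteqP; split => x /=.
  move=> Yx; exists (Num.floor x); rewrite asboolT//= in_itv/=; exact: floor_itv.
by move=> [m]; case: asboolP => //= Ym; rewrite in_itv/= => /floor_def ->.
Qed.

Lemma measurable_floor_comp (Y : set int) D :
  measurable [set alpha : R | Y (Num.floor (D * alpha))].
Proof.
have mD : measurable_fun setT ( *%R D) by [].
have := mD measurableT _ (measurable_floor Y).
by rewrite setTI.
Qed.

Definition near_int D eta : set R :=
  [set alpha | exists m : int, `|D * alpha - m%:~R| <= eta].

Lemma near_intN D eta : near_int (- D) eta = near_int D eta.
Proof.
apply/seteqP; split => x [m]; rewrite -normrN => h; exists (- m);
  move: h; rewrite intrN !opprD ?mulNr ?opprK//.
Qed.

Lemma near_int_itv D eta m alpha : 0 < D ->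
  (`|D * alpha - m%:~R| <= eta) =
  (alpha \in `[(m%:~R - eta) / D, (m%:~R + eta) / D]).
Proof.
move=> D0; rewrite in_itv/= ler_pdivrMr// ler_pdivlMr// ler_norml.
by apply/andP/andP; lra.
Qed.

Lemma measurable_near_int D eta : measurable (near_int D eta).
Proof.
have pos E : 0 < E -> measurable (near_int E eta).
  move=> E0; rewrite (_ : near_int E eta = [set x | exists m : int,
    `[(m%:~R - eta) / E, (m%:~R + eta) / E]%classic x]).
    by apply: measurable_int_union => m; exact: measurable_itv.
  by apply/seteqP; split => x [m h]; exists m; move: h => /=; rewrite near_int_itv.
have [/pos//|D0|<-] := ltgtP 0 D.
  by rewrite -near_intN; apply: pos; rewrite oppr_gt0.
rewrite /near_int (_ : [set _ | _] = [set alpha : R | exists m : int,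
  `|m%:~R| <= eta]); last first.
  by apply/seteqP; split => x [m hm]; exists m; move: hm;
    rewrite mul0r add0r normrN.
have [[m hm]|h] := pselect (exists m : int, `|m%:~R : R| <= eta).
  by rewrite (_ : [set _ | _] = setT)//; apply/seteqP; split => // x _; exists m.
by rewrite (_ : [set _ | _] = set0)//; apply/seteqP; split.
Qed.

Lemma mean_itv_le z (a b : R) : a <= b ->
  mean z (\1_(`[a, b]%classic)) <= b - a.
Proof.
move=> ab; rewrite mean_indic//.
have -> : b - a = fine (@lebesgue_measure R `[a, b]%classic).
  rewrite lebesgue_measure_itv/= lte_fin.
  by case: ltP => [_|ba]; rewrite -?EFinB//=; lra.
apply: fine_le.
- rewrite ge0_fin_numE//; apply: (le_lt_trans _ (@lebesgue_itv_lty R z (z + 1))).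
  apply: le_measure; last exact: subIsetr.
    by rewrite inE; apply: measurableI; exact: measurable_itv.
  by rewrite inE; exact: measurable_itv.
- rewrite ge0_fin_numE// lebesgue_measure_itv/=.
  by case: ifP; rewrite ?ltry// -EFinB ltry.
- apply: le_measure; last exact: subIsetl.
    by rewrite inE; apply: measurableI; exact: measurable_itv.
  by rewrite inE; exact: measurable_itv.
Qed.

(** The set consists of intervals of length 2 * eta / |D| around the points m / D, and at most |D| +
    4 of them are needed to cover it inside a unit interval. *)
Lemma mean_near_int z D eta : D != 0 -> 0 <= eta <= 1 ->
  mean z (\1_(near_int D eta)) <= 2 * eta * (1 + 4 / `|D|).
Proof.
move=> D0 /andP[eta0 eta1].
wlog : D D0 / 0 < D => [wl|{}D0].
  have [?|Dlt0|/esym/eqP] := ltgtP 0 D; first exact: wl.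
    by rewrite -near_intN -normrN; apply: wl; rewrite ?oppr_eq0 ?oppr_gt0.
  by rewrite (negPf D0).
rewrite gtr0_norm//.
(* For x in the interval and eta <= 1, |D * x - m| <= eta gives D * z - 1 <= m < D * z + D + 1,
   hence m0 <= m < m0 + n. *)
set m0 := Num.floor (D * z) - 1; set n := (Num.truncn D).+4.
pose J (i : 'I_n) : set R :=
  `[((m0 + i%:Z)%:~R - eta) / D, ((m0 + i%:Z)%:~R + eta) / D]%classic.
have bJ i : bounded_measurable (\1_(J i) : R -> R).
  by apply: bounded_measurable_indic; exact: measurable_itv.
apply: (@le_trans _ _ (mean z (fun x => \sum_(i < n) \1_(J i) x))).
  apply: le_mean.
  - by apply: bounded_measurable_indic; exact: measurable_near_int.
  - exact: bounded_measurable_sum.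
  - move=> x /andP[zx xz]; rewrite indicE; case: (boolP (x \in _)); last first.
      by move=> _; apply: sumr_ge0 => i _; rewrite indicE; case: (_ \in _).
    rewrite inE => -[m hm].
    have := hm; rewrite ler_norml => /andP[hm1 hm2].
    have m0m : 0 <= m - m0.
      suff : Num.floor (D * z) <= m + 1 by rewrite /m0; lia.
      rewrite -(ler_int R) intrD; have := floor_le (D * z).
      have : D * z <= D * x by rewrite ler_pM2l.
      lra.
    have [i mi] : exists i : nat, m - m0 = i%:Z by exists `|m - m0|%N; lia.
    have iN : (i < n)%N.
      rewrite -(ltr_nat R) /n.
      have E : (i%:R : R) = m%:~R - m0%:~R by rewrite -intrB mi.
      rewrite E /m0 intrB -addn4 natrD.
      have := floorD1_gt (D * z).
      have := truncnS_gt D.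
      have : D * x < D * z + D by rewrite -[X in _ + X]mulr1 -mulrDr ltr_pM2l.
      rewrite intrD -[(Num.truncn D).+1]addn1 !natrD /=; lra.
    rewrite (bigD1 (Ordinal iN))//= (_ : \1_(J _) x = 1).
      by rewrite lerDl; apply: sumr_ge0 => k _; rewrite indicE; case: (_ \in _).
    rewrite indicE mem_set// /J /= -near_int_itv//.
    by rewrite -mi (_ : m0 + (m - m0) = m)//; lia.
rewrite mean_sum//.
apply: (@le_trans _ _ (\sum_(i < n) (2 * eta / D))).
  apply: ler_sum => i _; apply: le_trans (mean_itv_le _ _) _.
    by rewrite ler_pM2r ?invr_gt0//; lra.
  rewrite -mulrBl ler_pM2r ?invr_gt0//; lra.
rewrite sumr_const card_ord -[X in X <= _]mulr_natr.
rewrite [X in X <= _](_ : _ = 2 * eta * (n%:R / D)); last by ring.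
rewrite ler_wpM2l//; first lra.
rewrite ler_pdivrMr// mulrDl mul1r divfK ?gt_eqF//.
by rewrite /n -addn4 natrD lerD2r truncn_le ltW.
Qed.

Variables (a : nat -> R) (M : nat).

Definition digit alpha (x : nat) : 'Z_M :=
  (Num.floor (M%:R * (alpha * a x)))%:~R.

Definition update (w : nat -> 'Z_M) i c : nat -> 'Z_M :=
  fun n => if n == i then c else w n.

(** Functionals of the digits are defined on full sequences of residues, so that one digit can be
    replaced without reindexing; the finite list of relevant indices is recorded separately. *)
Definition depends (s : seq nat) (G : (nat -> 'Z_M) -> R) :=
  forall w w', {in s, w =1 w'} -> G w = G w'.

(** Conditional expectation given the other digits, when that of [i] is uniform. *)
Definition avg i (G : (nat -> 'Z_M) -> R) : (nat -> 'Z_M) -> R :=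
  fun w => M%:R^-1 * \sum_(c : 'Z_M) G (update w i c).

Lemma depends_update i s G c : depends (i :: s) G ->
  depends s (fun w => G (update w i c)).
Proof.
move=> dG w w' ww'; apply: dG => n; rewrite inE /update.
by case: eqP => //= _; exact: ww'.
Qed.

Lemma depends_avg i s G : depends (i :: s) G -> depends s (avg i G).
Proof.
move=> dG w w' ww'; congr (_ * _); apply: eq_bigr => c _.
exact: (depends_update c dG).
Qed.

Lemma digit_measurable i (c : 'Z_M) : measurable [set alpha | digit alpha i = c].
Proof.
rewrite (_ : [set _ | _] = [set alpha |
  [set m : int | m%:~R = c] (Num.floor (M%:R * a i * alpha))]).
  exact: measurable_floor_comp.
by apply/seteqP; split => x /=; rewrite /digit -mulrA [a i * x]mulrC.
Qed.

(** Induction on [s]: the values of one digit split the line into finitely many measurable pieces,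
    on each of which this digit can be frozen. *)
Lemma bounded_measurable_digit s G : depends s G ->
  bounded_measurable (fun alpha => G (digit alpha)).
Proof.
elim: s G => [|i s IH] G dG.
  rewrite (_ : (fun _ => _) = fun=> G (digit 0)).
    exact: bounded_measurable_cst.
  by apply/funext => x; apply: dG.
rewrite (_ : (fun _ => _) = fun alpha => \sum_(c : 'Z_M)
    \1_[set alpha | digit alpha i = c] alpha * G (update (digit alpha) i c)).
  apply: bounded_measurable_sum => c; apply: bounded_measurableM.
    by apply: bounded_measurable_indic; exact: digit_measurable.
  exact: (IH (fun w => G (update w i c)) (depends_update c dG)).
apply/funext => x; rewrite (bigD1 (digit x i))//= indicE mem_set// mul1r.
rewrite big1 ?addr0; last first.
  move=> c cx; rewrite indicE memNset ?mul0r//= => xc.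
  by rewrite xc eqxx in cx.
by congr G; apply/funext => n; rewrite /update; case: eqP => // ->.
Qed.

Hypothesis M1 : (1 < M)%N.

(** ['Z_M] is padded to two elements when M <= 1, whence the hypothesis [M1]. *)
Lemma card_Zp : #|{: 'Z_M}| = M.
Proof. by rewrite card_ord Zp_cast. Qed.

(** Averaging over increments of the digit instead of its values matches the effect of translating
    alpha. *)
Lemma avg_shift i G w :
  avg i G w = M%:R^-1 * \sum_(c : 'Z_M) G (update w i (w i + c)).
Proof.
congr (_ * _); rewrite (reindex_inj (h := fun c => w i + c))//; exact: addrI.
Qed.

Lemma avg_const B i w : avg i (fun=> B) w = B.
Proof.
rewrite /avg sumr_const card_Zp -[B *+ M]mulr_natl mulrA mulVf ?mul1r//.
by rewrite pnatr_eq0; case: M M1.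
Qed.

Lemma avg_bound B i G w : (forall w, `|G w| <= B) -> `|avg i G w| <= B.
Proof.
move=> GB; rewrite /avg normrM normfV normr_nat ler_pdivrMl ?ltr0n; last first.
  exact: ltnW.
rewrite (le_trans (ler_norm_sum _ _ _))//.
apply: (@le_trans _ _ (\sum_(c : 'Z_M) B)); first exact: ler_sum.
by rewrite sumr_const card_Zp mulr_natl.
Qed.

(** The translation adds the integer [c] to M * alpha * a_i, so the equality is exact. *)
Lemma digit_shift alpha i (c : 'Z_M) : a i != 0 ->
  digit (alpha + c%:R / (M%:R * a i)) i = digit alpha i + c.
Proof.
move=> ai0; have M0 : M%:R != 0 :> R by rewrite pnatr_eq0; case: M M1.
rewrite /digit (_ : _ * _ = M%:R * (alpha * a i) + (c : nat)%:~R).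
  by rewrite floorDrz ?intrKfloor ?intrD// -pmulrn natr_Zp.
by rewrite -pmulrn; field; rewrite ai0 M0.
Qed.

(** The floor can change only if the next integer lies within [eta] above M * a_i * alpha. *)
Lemma digit_shift_far alpha t i eta :
  0 <= t -> M%:R * a i * t <= eta -> 0 < a i ->
  ~ near_int (M%:R * a i) eta alpha -> digit (alpha + t) i = digit alpha i.
Proof.
move=> t0 te ai0 far; rewrite /digit.
set y := M%:R * (alpha * a i).
have -> : M%:R * ((alpha + t) * a i) = y + M%:R * a i * t by rewrite /y; ring.
have e0 : 0 <= M%:R * a i * t by rewrite mulr_ge0// mulr_ge0// ltW.
congr (_%:~R); apply: floor_def; have /andP[fy yf] := floor_itv y.
rewrite (le_trans fy) ?lerDl//=; rewrite ltNge; apply/negP => h.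
apply: far; exists (Num.floor y + 1).
have -> : M%:R * a i * alpha = y by rewrite /y; ring.
by rewrite ler0_norm; lra.
Qed.

(** One decoupling step. For each [c], translating alpha by c / (M a_i) adds [c] to the digit of
    [i]. Moving the interval costs at most 2 / a_i, and the digits of [s] stay unchanged except near
    their jumps, a set whose measure is of order M a_n / a_i for each n. Averaging over [c] produces
    [avg i G]. *)
Lemma mean_digit_avg z i s G B : depends (i :: s) G ->
  (forall w, `|G w| <= B) -> 0 < a i ->
  (forall n, n \in s -> 0 < a n /\ M%:R * a n / a i <= 1) ->
  `|mean z (fun alpha => G (digit alpha)) -
    mean z (fun alpha => avg i G (digit alpha))| <=
  B * (2 / a i + \sum_(n <- s) 4 * (M%:R * a n / a i) * (1 + 4 / (M%:R * a n))).
Proof.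
move=> dG GB ai0 sep.
have B0 : 0 <= B := le_trans (normr_ge0 _) (GB (fun=> 0)).
have M0 : 0 < M%:R :> R by rewrite ltr0n ltnW.
have bG := bounded_measurable_digit dG.
have dGc c : depends (i :: s) (fun w => G (update w i (w i + c))).
  move=> w w' ww'; apply: dG => n ns; rewrite /update ww' ?inE ?eqxx//.
  by case: eqP => // _; exact: ww'.
have bGc c := bounded_measurable_digit (dGc c).
under [X in _ - mean z X]eq_fun do rewrite avg_shift.
rewrite meanZ; last exact: bounded_measurable_sum.
rewrite mean_sum//.
rewrite (_ : _ - _ = M%:R^-1 * \sum_(c : 'Z_M) (mean z (fun alpha => G (digit alpha))
   - mean z (fun alpha => G (update (digit alpha) i (digit alpha i + c)))));
  last first.
  rewrite sumrB sumr_const card_Zp mulrBr -[mean _ _ *+ M]mulr_natl mulrA mulVf ?mul1r//.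
  exact: lt0r_neq0.
rewrite normrM gtr0_norm ?invr_gt0// ler_pdivrMl//.
rewrite (le_trans (ler_norm_sum _ _ _))//.
set E := B * _; apply: (@le_trans _ _ (\sum_(c : 'Z_M) E)); last first.
  by rewrite sumr_const card_Zp mulr_natl.
apply: ler_sum => c _; rewrite {}/E.
set t := c%:R / (M%:R * a i).
have t0 : 0 <= t by rewrite divr_ge0// mulr_ge0// ltW.
have ct : t <= 1 / a i.
  rewrite /t invfM mulrA ler_pM2r ?invr_gt0// ler_pdivrMr// mul1r ler_nat.
  by have := ltn_ord c; rewrite [X in (_ < X)%N]Zp_cast// => /ltnW.
have T := mean_translate z bG t0 (fun x => GB _).
(* A shift by t <= 1 / a_i moves M * a_n * alpha by at most M * a_n / a_i, so off [Bad n] the digit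
   of n survives. *)
pose Bad n := near_int (M%:R * a n) (M%:R * a n / a i).
have bBad n : bounded_measurable (\1_(Bad n) : R -> R).
  by apply: bounded_measurable_indic; exact: measurable_near_int.
have bS : bounded_measurable (fun alpha => \sum_(n <- s) 2 * B * \1_(Bad n) alpha).
  apply: bounded_measurable_sum => n; apply: bounded_measurableM => //.
  exact: bounded_measurable_cst.
have bGt : bounded_measurable (fun alpha => G (digit (alpha + t))).
  case: bG => mG _; split; last by exists B.
  apply: (measurableT_comp mG).
  by apply: measurable_funD => //; exact: measurable_cst.
have U : `|mean z (fun alpha => G (digit (alpha + t))) -
    mean z (fun alpha => G (update (digit alpha) i (digit alpha i + c)))| <=
    \sum_(n <- s) 2 * B * mean z (\1_(Bad n)).
  rewrite -meanB//.
  have -> : \sum_(n <- s) 2 * B * mean z (\1_(Bad n)) =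
      mean z (fun alpha => \sum_(n <- s) 2 * B * \1_(Bad n) alpha).
    rewrite mean_sum => [|n]; first by apply: eq_bigr => n _; rewrite meanZ.
    apply: bounded_measurableM => //; exact: bounded_measurable_cst.
  apply: mean_norm_le => //; first exact: bounded_measurableB.
  move=> x _; have Bad0 n : 0 <= 2 * B * \1_(Bad n) x.
    by rewrite !mulr_ge0// indicE; case: (_ \in _).
  have [[n ns nBad]|nbad] := pselect (exists2 n, n \in s & Bad n x).
    rewrite (@le_trans _ _ (2 * B))//.
      rewrite (le_trans (ler_normB _ _))// mulrDl mul1r lerD//.
    rewrite (big_rem n)//= [X in _ <= _ * X + _]indicE mem_set// mulr1 lerDl.
    exact: sumr_ge0.
  rewrite (_ : G _ = G (update (digit x) i (digit x i + c))).
    by rewrite subrr normr0; exact: sumr_ge0.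
  apply: dG => n; rewrite /update inE; case: eqP => /= [-> _|_ ns].
    by rewrite digit_shift// gt_eqF.
  have [an0 _] := sep n ns.
  apply: (digit_shift_far (eta := M%:R * a n / a i)) => //.
    by apply: ler_wpM2l; [rewrite mulr_ge0// ltW|rewrite -div1r].
  by move=> bad; apply: nbad; exists n.
rewrite -(subrKA (mean z (fun alpha => G (digit (alpha + t))))).
rewrite (le_trans (ler_normD _ _))// mulrDr lerD//.
  rewrite distrC (le_trans T)//.
  have : B * t <= B * (1 / a i) by rewrite ler_wpM2l.
  by rewrite div1r; lra.
rewrite (le_trans U)// mulr_sumr !big_seq; apply: ler_sum => n ns.
have [an0 an1] := sep n ns.
have D0 : 0 < M%:R * a n by rewrite mulr_gt0.
have h := @mean_near_int z (M%:R * a n) (M%:R * a n / a i).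
have {}h : mean z (\1_(Bad n)) <=
    2 * (M%:R * a n / a i) * (1 + 4 / (M%:R * a n)).
  rewrite -{2}(gtr0_norm D0); apply: h; first by rewrite gt_eqF.
  by rewrite an1 divr_ge0 ?ltW.
have : 2 * B * mean z (\1_(Bad n)) <= 2 * B *
  (2 * (M%:R * a n / a i) * (1 + 4 / (M%:R * a n))) by rewrite ler_wpM2l// mulr_ge0.
by move=> /le_trans; apply; rewrite le_eqVlt; apply/orP; left; apply/eqP; ring.
Qed.

End Discretisation.

(** * Spread lists of indices *)

Definition apart (j x y : nat) := (x + j <= y)%N || (y + j <= x)%N.

(* Requiring [j <= x] of every index as well makes [c ^ j] a lower bound, up to
   a constant, of [a x]. *)
Definition spread (j : nat) (s : seq nat) :=
  all (leq j) s && pairwise (apart j) s.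

Lemma apartC j x y : apart j x y = apart j y x.
Proof. exact: orbC. Qed.

Lemma spread_cons j x s :
  spread j (x :: s) = [&& (j <= x)%N, all (apart j x) s & spread j s].
Proof. by rewrite /spread pairwise_cons /= -!andbA; congr andb; rewrite andbCA. Qed.

(** For 0 < j apartness includes distinctness, and it is symmetric; the condition on positions thus
    becomes one on the set of entries, which deletions and reorderings respect. *)
Lemma spreadP j s : (0 < j)%N ->
  reflect [/\ uniq s, {in s, forall x, (j <= x)%N} &
    {in s &, forall x y, x != y -> apart j x y}] (spread j s).
Proof.
move=> j0; elim: s => [|x s IH]; first by apply: ReflectT; split.
rewrite spread_cons; apply: (iffP and3P) => [[jx /allP xs /IH[us js ss]]|].
  split.
  - rewrite /= us andbT; apply/negP => /xs; rewrite /apart; lia.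
  - by move=> y; rewrite inE => /predU1P[->//|/js].
  - move=> y y'; rewrite !inE => /predU1P[->|ys] /predU1P[->|y's].
    + by rewrite eqxx.
    + by move=> _; exact: xs.
    + by move=> _; rewrite apartC; exact: xs.
    + exact: ss.
case=> /= /andP[xs us] js ss; split.
- by apply: js; rewrite mem_head.
- apply/allP => y ys; apply: ss; rewrite ?mem_head ?inE ?ys ?orbT//.
  by apply: contraNneq xs => ->.
- apply/IH; split=> // [y ys|y y' ys y's]; first by apply: js; rewrite inE ys orbT.
  by apply: ss; rewrite inE ?ys ?y's orbT.
Qed.

(** * Averages over independent uniform digits *)

Section Averages.
Context {R : realType}.
Variable M : nat.
Hypothesis M1 : (1 < M)%N.
Implicit Types (G H : (nat -> 'Z_M) -> R) (w : nat -> 'Z_M).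

Definition avgs (s : seq nat) G := foldl (fun G i => avg i G) G s.

Lemma avg_comm i j G : avg i (avg j G) = avg j (avg i G).
Proof.
have [->//|ij] := eqVneq i j; apply/funext => w; rewrite /avg.
under eq_bigr => c _ do rewrite mulr_sumr.
under [in RHS]eq_bigr => c _ do rewrite mulr_sumr.
rewrite exchange_big; congr (_ * _); apply: eq_bigr => c _.
apply: eq_bigr => d _; congr (_ * G _); apply/funext => n; rewrite /update.
by case: (eqVneq n i) => [->|//]; rewrite (negPf ij).
Qed.

(** Averages commute, so the digit to be averaged first can be chosen freely; the decoupling chooses
    that of the largest index. *)
Lemma avgs_rem i s G : i \in s -> avgs s G = avgs (rem i s) (avg i G).
Proof.
elim: s G => // k s IH G; rewrite inE /=; case: eqVneq => [->//|ik /= is'].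
by rewrite IH//= avg_comm.
Qed.

Lemma avgsZ s (r : R) G w : avgs s (fun w => r * G w) w = r * avgs s G w.
Proof.
elim: s G => //= i s IH G; rewrite -IH; congr (avgs s _ w).
apply/funext => w'; rewrite /avg -mulr_sumr mulrCA//.
Qed.

Lemma avgs_const s (r : R) w : avgs s (fun=> r) w = r.
Proof.
elim: s => //= i s IH; rewrite -[RHS]IH; congr (avgs s _ w).
by apply/funext => w'; exact: avg_const.
Qed.

Lemma avgsB s G H w :
  avgs s (fun w => G w - H w) w = avgs s G w - avgs s H w.
Proof.
elim: s G H => //= i s IH G H; rewrite -IH; congr (avgs s _ w).
by apply/funext => w'; rewrite /avg sumrB mulrBr.
Qed.

Lemma avgsMr s G H w :
  (forall i w c, i \in s -> H (update w i c) = H w) ->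
  avgs s (fun w => G w * H w) w = avgs s G w * H w.
Proof.
elim: s G => //= i s IH G Hs; rewrite -IH; last first.
  by move=> k w' c ks; apply: Hs; rewrite inE ks orbT.
congr (avgs s _ w); apply/funext => w'; rewrite /avg -mulrA mulr_suml.
by congr (_ * _); apply: eq_bigr => c _; rewrite Hs// mem_head.
Qed.

Lemma depends_eq_mem s s' G : s =i s' -> depends s G -> depends s' G.
Proof. by move=> ss' dG w w' ww'; apply: dG => n; rewrite ss'; exact: ww'. Qed.

Definition in_window (A : int) (l : nat) (d : 'Z_M) :=
  [exists i : 'I_l, d == (A + i%:Z)%:~R].

Lemma in_windowP A l d :
  reflect (exists2 e : int, A <= e < A + l%:Z & d = e%:~R) (in_window A l d).
Proof.
clear M1; apply: (iffP existsP) => [[i /eqP ->]|[e Ae ->]].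
  by exists (A + i%:Z) => //; have := ltn_ord i; lia.
have il : (`|(e - A)%R| < l)%N by lia.
exists (Ordinal il); apply/eqP; congr (_%:~R) => /=; lia.
Qed.

(** For l <= M the integers of the window stay distinct modulo M. *)
Lemma card_in_window A l : (l <= M)%N ->
  #|[pred d | in_window A l d]| = l.
Proof.
move=> lM; pose f (i : 'I_l) : 'Z_M := (A + i%:Z)%:~R.
have fI : injective f.
  move=> i i'; rewrite /f !intrD => /addrI/(congr1 val); rewrite /= -!pmulrn.
  have lt k : ((k : 'I_l) < M)%N by apply: leq_trans lM.
  by rewrite !val_Zp_nat// !modn_small// => /val_inj.
transitivity #|codom f|; last by rewrite card_codom// card_ord.
apply: eq_card => d; rewrite !inE; apply/existsP/codomP => [[i /eqP ->]|[i ->]].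
  by exists i.
by exists i.
Qed.

(** Whatever the digit of [y] is, its difference from a uniform digit is uniform. *)
Lemma avg_in_window A l i y w : (l <= M)%N -> i != y ->
  avg i (fun w => (in_window A l (w i - w y))%:R : R) w = l%:R / M%:R.
Proof.
move=> lM iy; rewrite /avg mulrC; congr (_ * _).
transitivity (\sum_(c : 'Z_M) (in_window A l c)%:R : R).
  rewrite [RHS](reindex_inj (h := fun c => c - w y)); last exact: addIr.
  by apply: eq_bigr => c _; rewrite /update eqxx eq_sym (negPf iy).
rewrite -natr_sum -{2}(card_in_window A lM) -sum1_card [in RHS]big_mkcond.
by congr _%:R; apply: eq_bigr => c _; rewrite inE; case: (in_window _ _ _).
Qed.

(* [L] lists the windows (left end, length) of the successive differences. *)
Fixpoint chain (L : seq (int * nat)) (x : seq nat) w : bool :=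
  match L, x with
  | p :: L', y :: ((y' :: _) as t) =>
      in_window p.1 p.2 (w y - w y') && chain L' t w
  | _, _ => true
  end.

Lemma chain_update L x w i c : i \notin x -> chain L x (update w i c) = chain L x w.
Proof.
elim: L x => [|p L IH] [|y [|y' t]]//= ix.
move: ix; rewrite inE negb_or => /andP[iy ix].
rewrite IH//; congr (in_window _ _ _ && _); rewrite /update.
move: ix; rewrite inE negb_or => /andP[iy' _].
by rewrite eq_sym (negPf iy) eq_sym (negPf iy').
Qed.

Lemma chain_depends L x : depends x (fun w => (chain L x w)%:R : R).
Proof.
move=> w w' ww'; congr (_%:R); congr nat_of_bool.
elim: L x ww' => [|p L IH] [|y [|y' t]]//= ww'.
rewrite !ww' ?inE ?eqxx ?orbT// IH// => n nt.
by apply: ww'; rewrite inE nt orbT.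
Qed.

Definition chain_prob (L : seq (int * nat)) : R := \prod_(p <- L) (p.2%:R / M%:R).

(** The first digit enters the first window only, and averaging over it gives the density of that
    window whatever the second digit is; a shorter chain remains. *)
Lemma avgs_chain L x w : size x = (size L).+1 -> uniq x ->
  all (fun p => p.2 <= M)%N L ->
  avgs x (fun w => (chain L x w)%:R) w = chain_prob L.
Proof.
elim: L x => [|p L IH] [|y [|y' t]]//=.
  by move=> _ _ _; rewrite avg_const// /chain_prob big_nil.
move=> [st] /andP[yt ut] /andP[pM LM].
rewrite /chain_prob big_cons -/(chain_prob L) -(IH (y' :: t))//=; last by rewrite st.
rewrite -[RHS](@avgsZ (y' :: t)) /=; congr (avgs t _ w).
congr (avg y' _); apply/funext => w'.
have yy' : y != y' by apply: contraNneq yt => ->; rewrite mem_head.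
rewrite -(avg_in_window p.1 w' pM yy') /avg -mulrA mulr_suml.
congr (_ * _); apply: eq_bigr => c _.
by rewrite chain_update// -mulnb natrM.
Qed.

Lemma chain_prob_le1 L : all (fun p => p.2 <= M)%N L -> 0 <= chain_prob L <= 1.
Proof.
rewrite /chain_prob; elim: L => [|p L IH] /=; first by rewrite big_nil ler01 lexx.
move=> /andP[pM /IH /andP[h0 h1]]; rewrite big_cons mulr_ge0//=.
rewrite mulr_ile1// ler_pdivrMr ?mul1r ?ler_nat// ltr0n; exact: ltnW.
Qed.

(** The two factors involve disjoint sets of digits, and the first one averages to 0 over its
    own. *)
Lemma avgs_chain_covariance L x x' w : size x = (size L).+1 ->
  uniq (x ++ x') -> all (fun p => p.2 <= M)%N L ->
  avgs (x ++ x') (fun w => ((chain L x w)%:R - chain_prob L) *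
    ((chain L x' w)%:R - chain_prob L)) w = 0.
Proof.
move=> sx; rewrite cat_uniq => /and3P[ux dx ux'] LM.
rewrite /avgs foldl_cat -/(avgs x _) -/(avgs x' _).
rewrite -[RHS](avgs_const x' 0 w); congr (avgs x' _ w); apply/funext => w'.
rewrite avgsMr; last first.
  move=> i v c ix; congr (_%:R - _); rewrite chain_update//.
  by apply: contraNN dx => ix'; apply/hasP; exists i.
by rewrite avgsB avgs_chain// avgs_const subrr mul0r.
Qed.

End Averages.

(** * Decoupling for a lacunary sequence *)

Section Decoupling.
Context {R : realType}.
Variables (a : nat -> R) (c : R).
Hypothesis a_pos : forall n, (1 <= n)%N -> 0 < a n.
Hypothesis c1 : 1 < c.
Hypothesis a_lac : forall n, (1 <= n)%N -> c * a n <= a n.+1.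

Let c0 : 0 < c. Proof. exact: lt_trans c1. Qed.

Lemma lacunary_growth m n : (1 <= m)%N -> c ^+ n * a m <= a (m + n)%N.
Proof.
move=> m1; elim: n => [|n IH]; first by rewrite expr0 mul1r addn0.
rewrite exprS -mulrA addnS; apply: le_trans (a_lac _); last by rewrite addn_gt0 m1.
by rewrite ler_pM2l.
Qed.

(** In the error of [mean_digit_avg], 1 / a_i is at most (c / a_1) c^(-j) and a_n / a_i at most
    c^(-j). Each index of [s] then contributes at most 4 M c^(-j) + 16 (c / a_1) c^(-j), and the
    translation 2 (c / a_1) c^(-j). *)
Definition decoupling_const : R := 4 + 18 * (c / a 1).

Lemma decoupling_const_gt0 : 0 < decoupling_const.
Proof.
by rewrite /decoupling_const addr_gt0// mulr_gt0// divr_gt0// a_pos.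
Qed.

Section Fixed.
Variables (M j : nat).
Hypothesis M1 : (1 < M)%N.
Hypothesis j1 : (1 <= j)%N.
Hypothesis Mcj : M%:R * c ^- j <= 1.

Lemma decoupling_step i s : (j <= i)%N ->
  (forall n, n \in s -> (1 <= n)%N /\ (n + j <= i)%N) ->
  2 / a i + \sum_(n <- s) 4 * (M%:R * a n / a i) * (1 + 4 / (M%:R * a n)) <=
  (size s).+1%:R * (decoupling_const * M%:R * c ^- j) /\
  (forall n, n \in s -> 0 < a n /\ M%:R * a n / a i <= 1).
Proof.
move=> ji sep; have a1 := a_pos (leqnn 1).
have i1 : (1 <= i)%N := leq_trans j1 ji.
have ai0 := a_pos i1.
have M0 : 1 <= M%:R :> R by rewrite ler1n ltnW.
have cj0 : 0 < c ^- j by rewrite invr_gt0 exprn_gt0.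
have K0 : 0 < c / a 1 by rewrite divr_gt0.
(* As i >= j, growth from the index 1 on gives a_i >= c^(j-1) a_1. *)
have ai : (a i)^-1 <= c / a 1 * c ^- j.
  have := lacunary_growth i.-1 (leqnn 1); rewrite add1n prednK// => g.
  have -> : c / a 1 * c ^- j = (c ^+ j.-1 * a 1)^-1.
    by rewrite -{1}(prednK j1) exprS; field; rewrite !gt_eqF ?exprn_gt0.
  rewrite lef_pV2 ?posrE ?mulr_gt0 ?exprn_gt0//; apply: le_trans g.
  by rewrite ler_pM2r// ler_weXn2l ?ltW//; lia.
have ratio n : n \in s -> 0 < a n /\ a n / a i <= c ^- j.
  move=> /sep[n1 nji]; split; first exact: a_pos.
  rewrite ler_pdivrMr// ler_pdivlMl ?exprn_gt0//.
  have := lacunary_growth (i - n) n1; rewrite subnKC; last by lia.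
  apply: le_trans; rewrite ler_pM2r ?a_pos// ler_weXn2l ?ltW//; lia.
split; last first.
  move=> n /ratio[an0 ani]; split => //; apply: le_trans Mcj.
  by rewrite -mulrA ler_pM2l// (lt_le_trans _ M0).
rewrite -[(size s).+1%:R]natr1 [X in _ <= X]mulrDl mul1r addrC.
set u := c / a 1 in ai K0 *; set e := c ^- j in ai cj0 ratio *.
have ue0 : 0 <= u * e := mulr_ge0 (ltW K0) (ltW cj0).
have ue : u * e <= M%:R * (u * e) by rewrite ler_peMl.
have Me : 0 <= M%:R * e by rewrite mulr_ge0// ?ltW//.
have Mue : 0 <= M%:R * (u * e) by exact: mulr_ge0.
have -> : decoupling_const * M%:R * e = 4 * (M%:R * e) + 18 * (M%:R * (u * e)).
  by rewrite /decoupling_const -/u; ring.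
apply: lerD; last by lra.
set E := _ + _; apply: (@le_trans _ _ (\sum_(n <- s) E)).
  rewrite !big_seq; apply: ler_sum => n /ratio[an0 ani].
  rewrite (_ : _ * _ = 4 * (M%:R * (a n / a i)) + 16 * (a i)^-1).
    have : M%:R * (a n / a i) <= M%:R * e by rewrite ler_pM2l// (lt_le_trans _ M0).
    by rewrite /E; lra.
  by field; rewrite !gt_eqF// (lt_le_trans _ M0).
by rewrite big_const_seq count_predT iter_addr_0 mulr_natl.
Qed.

(** Induction on the number of indices, averaging out the largest one: all others lie at least [j]
    below it. The step costs [size s] error terms, and r^2 + r + 1 <= (r + 1)^2 yields the
    square. *)
Lemma mean_digit_avgs z s (G : (nat -> 'Z_M) -> R) B w : spread j s ->
  depends s G -> (forall w, `|G w| <= B) ->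
  `|mean z (fun alpha => G (digit a M alpha)) - avgs s G w| <=
  B * ((size s)%:R ^+ 2 * (decoupling_const * M%:R * c ^- j)).
Proof.
set e := decoupling_const * _ * _.
have e0 : 0 <= e.
  rewrite /e !mulr_ge0 ?invr_ge0 ?exprn_ge0 ?(ltW c0)// ltW//.
  exact: decoupling_const_gt0.
have [m] := ubnP (size s); elim: m s G w => // m IH s G w.
case: s => [_ _ dG GB|i0 s0].
  rewrite /= expr0n /= mul0r mulr0.
  rewrite (_ : (fun _ => _) = fun=> G w) ?mean_cst ?subrr ?normr0//.
  by apply/funext => x; apply: dG.
set s := i0 :: s0 => sm ss dG GB.
have B0 : 0 <= B := le_trans (normr_ge0 _) (GB w).
have [i is_ imax] : exists2 i, i \in s & forall n, n \in s -> (n <= i)%N.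
  have [i] := @arg_maxnP _ (@ord0 (size s0)) xpredT (fun k => nth 0%N s k) isT.
  move=> _ imax; exists (nth 0%N s i); first exact/mem_nth/ltn_ord.
  move=> n ns; have lt : (index n s < size s)%N by rewrite index_mem.
  by have := imax (Ordinal lt) isT; rewrite /= nth_index.
have /spreadP-/(_ j1)[us js seps] := ss.
have rs n : n \in rem i s -> n \in s /\ n != i.
  by rewrite mem_rem_uniq// !inE => /andP[].
have mem_s : s =i i :: rem i s by exact: perm_mem (perm_to_rem is_).
have ss' : spread j (rem i s).
  apply/(spreadP _ j1); split; first exact: rem_uniq.
    by move=> n /rs[/js].
  by move=> n n' /rs[ns _] /rs[n's _]; exact: seps.
have [n ns'|E1 E2] := @decoupling_step i (rem i s) (js _ is_).
  have [ns ni] := rs _ ns'; split; first exact: leq_trans j1 (js _ ns).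
  have := seps _ _ ns is_ ni; rewrite /apart => /orP[//|].
  have := imax _ ns; lia.
have dG' := depends_eq_mem mem_s dG.
have ai0 : 0 < a i by apply: a_pos; exact: leq_trans j1 (js _ is_).
have S := mean_digit_avg M1 z dG' GB ai0 E2.
have sz : size (rem i s) = size s0 by rewrite size_rem.
have T := IH (rem i s) (avg i G) w _ ss' (depends_avg dG')
  (fun w => avg_bound M1 i w GB).
rewrite sz in T E1; rewrite (avgs_rem _ is_).
rewrite -(subrKA (mean z (fun alpha => avg i G (digit a M alpha)))).
rewrite (le_trans (ler_normD _ _))//.
rewrite (le_trans (lerD S (T sm)))//.
rewrite -mulrDr ler_wpM2l// (le_trans (lerD E1 (lexx _)))//.
rewrite -/e -mulrDl ler_wpM2r//.
have r0 : 0 <= (size s0)%:R :> R by [].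
have -> : (size s)%:R = (size s0)%:R + 1 :> R by rewrite natr1.
move: (size s0)%:R r0 => r r0; nra.
Qed.

Lemma mean_chain_le z L x : spread j x -> size x = (size L).+1 ->
  all (fun p => p.2 <= M)%N L ->
  mean z (fun alpha => (chain L x (digit a M alpha))%:R : R) <=
  chain_prob M L + (size x)%:R ^+ 2 * (decoupling_const * M%:R * c ^- j).
Proof.
move=> sx szx LM; have /spreadP-/(_ j1)[ux _ _] := sx.
have G1 (w : nat -> 'Z_M) : `|(chain L x w : nat)%:R| <= 1 :> R by case: (chain L x w); rewrite ?normr1 ?normr0.
have := mean_digit_avgs z (fun=> 0) sx (@chain_depends R M L x) G1.
by rewrite avgs_chain// mul1r ler_norml => /andP[_]; lra.
Qed.

(** The functional is bounded by 1 and averages to 0 over independent digits, so only the decoupling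
    error of the joint list remains. *)
Lemma mean_chain_covariance z L x x' : spread j (x ++ x') ->
  size x = (size L).+1 -> all (fun p => p.2 <= M)%N L ->
  mean z (fun alpha => ((chain L x (digit a M alpha))%:R - chain_prob M L) *
     ((chain L x' (digit a M alpha))%:R - chain_prob M L) : R) <=
  (size (x ++ x'))%:R ^+ 2 * (decoupling_const * M%:R * c ^- j).
Proof.
move=> sx szx LM; have /spreadP-/(_ j1)[ux _ _] := sx.
set G := fun w : nat -> 'Z_M => ((chain L x w)%:R - chain_prob M L) *
  ((chain L x' w)%:R - chain_prob M L) : R.
have bd y (w : nat -> 'Z_M) : `|(chain L y w : nat)%:R - chain_prob M L| <= 1 :> R.
  have /andP[] := @chain_prob_le1 R M M1 L LM.
  by case: (chain L y w); rewrite ler_norml /=; lra.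
have G1 w : `|G w| <= 1 by rewrite normrM mulr_ile1.
have dG : depends (x ++ x') G.
  move=> w w' ww'; congr ((_ - _) * (_ - _)); apply: chain_depends => n nx;
    by apply: ww'; rewrite mem_cat nx ?orbT.
have := mean_digit_avgs z (fun=> 0) sx dG G1.
by rewrite avgs_chain_covariance// mul1r subr0 => /(le_trans (ler_norm _)).
Qed.

End Fixed.
End Decoupling.

(** * Counting tuples *)

Section Counting.
Local Open Scope nat_scope.
Variable N : nat.

Fixpoint seqs (m : nat) : seq (seq nat) :=
  if m is m'.+1 then [seq y :: s | y <- iota 1 N, s <- seqs m'] else [:: [::]].

Lemma mem_seqs m x :
  (x \in seqs m) = (size x == m) && all (mem (iota 1 N)) x.
Proof.
elim: m x => [|m IH] [|y x]//=; first by apply/negP => /allpairsP[[? ?]] [].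
apply/allpairsP/andP => /=.
  by move=> [[z s]] /= [zN]; rewrite IH => /andP[sm sN] [-> ->]; rewrite zN eqSS.
move=> [sm /andP[yN xN]]; exists (y, x); split => //=.
by rewrite IH -eqSS sm.
Qed.

Lemma uniq_seqs m : uniq (seqs m).
Proof.
elim: m => //= m IH; apply: allpairs_uniq => //; first exact: iota_uniq.
by move=> [y s] [y' s'] _ _ /= [-> ->].
Qed.

Lemma size_seqs m : size (seqs m) = N ^ m.
Proof. by elim: m => //= m IH; rewrite size_allpairs size_iota IH expnS. Qed.

Lemma sum_iota_count (P : pred nat) : \sum_(y <- iota 1 N) P y = count P (iota 1 N).
Proof. by rewrite -sum1_count [RHS]big_mkcond; apply: eq_bigr => y _; case: (P y). Qed.

Lemma big_seqsS T (idx : T) (op : Monoid.law idx) m (F : seq nat -> T) :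
  \big[op/idx]_(x <- seqs m.+1) F x =
  \big[op/idx]_(y <- iota 1 N) \big[op/idx]_(s <- seqs m) F (y :: s).
Proof. by rewrite /= big_allpairs_dep. Qed.

Section Cluster.
Variables (r : rel nat) (n0 : nat).
Hypothesis r_sym : symmetric r.
Hypothesis r_count : forall x, x \in iota 1 N -> count (r x) (iota 1 N) <= n0.

Lemma sum_all_cluster m v : v \in iota 1 N ->
  \sum_(s <- seqs m) all (r v) s <= n0 ^ m.
Proof.
move=> vN; elim: m => [|m IH]; first by rewrite big_seq1.
rewrite big_seqsS expnS; under eq_bigr => y _ do
  under eq_bigr => s _ do rewrite /= -mulnb.
under eq_bigr => y _ do rewrite -big_distrr /=.
rewrite -big_distrl /= sum_iota_count; apply: leq_mul => //; exact: r_count.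
Qed.

(** A list with [F s] is nonempty, and [y] must be one of the at most [n0] neighbours of its
    head. *)
Lemma sum_extend_cluster (F : seq nat -> bool) m :
  (forall s, F s -> s != [::]) ->
  \sum_(y <- iota 1 N) \sum_(s <- seqs m) (F s && all (r y) s) <=
  n0 * \sum_(s <- seqs m) F s.
Proof.
move=> Fn; rewrite exchange_big /= big_distrr /=.
rewrite big_seq [leqRHS]big_seq; apply: leq_sum => s.
rewrite mem_seqs => /andP[_ sN].
have [Fs|_] := boolP (F s); last by rewrite big1.
case: s Fs sN => [/Fn//|h s] _ /= /andP[hN _]; rewrite muln1.
apply: leq_trans (r_count hN); rewrite -sum_iota_count; apply: leq_sum => y _.
by rewrite /= (r_sym y h); case: (r h y) => //=; exact: leq_b1.
Qed.

(** Either the first entry satisfies [P] and the others are among its neighbours, or the tail is a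
    shorter clique with a marked entry; [m] counts the positions of the mark. *)
Lemma sum_cluster_has (P : pred nat) m :
  \sum_(x <- seqs m) (has P x && pairwise r x) <=
  m * count P (iota 1 N) * n0 ^ m.-1.
Proof.
elim: m => [|m IH]; first by rewrite big_seq1.
rewrite big_seqsS; set p := count _ _.
apply: (@leq_trans (\sum_(y <- iota 1 N) \sum_(s <- seqs m)
  (P y * all (r y) s + ((has P s && pairwise r s) && all (r y) s)))).
  apply: leq_sum => y _; apply: leq_sum => s _; rewrite pairwise_cons /=.
  by case: (P y); case: (has P s); case: (all (r y) s); case: (pairwise r s).
under eq_bigr => y _ do rewrite big_split -big_distrr /=.
rewrite big_split /= mulSn mulnDl leq_add//.
  rewrite /p -sum_iota_count big_distrl /= big_seq [leqRHS]big_seq.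
  by apply: leq_sum => y yN; rewrite leq_mul2l sum_all_cluster ?orbT.
apply: leq_trans (sum_extend_cluster _ _) _; first by move=> [|].
apply: leq_trans (leq_mul (leqnn _) IH) _.
by case: m {IH} => [|m]; rewrite ?mul0n ?muln0//= expnS mulnCA.
Qed.

(** A bad pair either contains the first entry, and then its partner is a marked entry of the tail,
    or lies in the tail. The power n0^m is generous, as only m - 2 entries remain free, and harmless
    since 0 < n0. *)
Lemma sum_cluster_bad (B : rel nat) m : 0 < n0 ->
  \sum_(x <- seqs m) (~~ pairwise (fun y y' => ~~ B y y') x && pairwise r x) <=
  m ^ 2 * (\sum_(y <- iota 1 N) \sum_(y' <- iota 1 N) (B y y' && r y y')) * n0 ^ m.
Proof.
move=> n00; set b := \sum_(y <- iota 1 N) _.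
elim: m => [|m IH]; first by rewrite big_seq1.
rewrite big_seqsS.
apply: (@leq_trans (\sum_(y <- iota 1 N) \sum_(s <- seqs m)
  ((has (fun y' => B y y' && r y y') s && pairwise r s) +
   ((~~ pairwise (fun y y' => ~~ B y y') s && pairwise r s) && all (r y) s)))).
  apply: leq_sum => y _; apply: leq_sum => s _; rewrite !pairwise_cons negb_and.
  case: (boolP (all (r y) s)) => /= ry; last by rewrite andbF.
  have -> : all (fun y' => ~~ B y y') s = ~~ has (fun y' => B y y' && r y y') s.
    rewrite -all_predC; apply: eq_in_all => y' /(allP ry) /= ->.
    by rewrite andbT.
  by case: (has _ s); case: (pairwise r s); case: (pairwise _ s).
under eq_bigr => y _ do rewrite big_split /=.
rewrite big_split /=.
apply: (@leq_trans (m * b * n0 ^ m + n0 * (m ^ 2 * b * n0 ^ m))).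
  apply: leq_add.
    rewrite /b big_distrr big_distrl /=; apply: leq_sum => y _.
    apply: leq_trans (sum_cluster_has _ _) _; rewrite sum_iota_count.
    by rewrite leq_mul2l leq_pexp2l ?leq_pred ?orbT.
  apply: leq_trans (sum_extend_cluster _ _) _; first by move=> [|].
  by rewrite leq_mul2l IH orbT.
rewrite [n0 ^ m.+1]expnS; set e := n0 ^ m.
have : m * b * e <= n0 * (m * b * e) by rewrite leq_pmull.
rewrite (_ : m.+1 ^ 2 = m ^ 2 + m * 2 + 1); last by lia.
move=> h; apply: leq_trans (leq_add h (leqnn _)) _.
have -> : n0 * (m * b * e) = m * (b * (n0 * e)) by lia.
have -> : n0 * (m ^ 2 * b * e) = m ^ 2 * (b * (n0 * e)) by lia.
set t := b * (n0 * e).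
have : (m + m ^ 2) * t <= (m ^ 2 + m * 2 + 1) * t by apply: leq_mul => //; lia.
rewrite /t; lia.
Qed.

End Cluster.

Lemma count_not_apart j y :
  count (fun v => ~~ apart j y v) (iota 1 N) <= 2 * j.
Proof.
rewrite -size_filter -(size_iota (y.+1 - j) (2 * j)).
apply: uniq_leq_size; first exact: filter_uniq (iota_uniq _ _).
move=> v; rewrite mem_filter !mem_iota /apart; lia.
Qed.

Lemma count_or_le T (p q : pred T) s :
  count (fun x => p x || q x) s <= count p s + count q s.
Proof. by rewrite -count_predUI leq_addr. Qed.

Lemma count_lt j : count (fun v => v < j) (iota 1 N) <= j.
Proof.
rewrite -size_filter -[leqRHS](size_iota 0).
apply: uniq_leq_size; first exact: filter_uniq (iota_uniq _ _).
move=> v; rewrite mem_filter !mem_iota; lia.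
Qed.

(** Greedy choice: each entry already chosen excludes at most 2j indices, and at most [j] indices
    are below [j]. The bound m' on the length keeps the base of the power fixed during the
    induction. *)
Lemma count_spread_ge (Y : pred nat) j m m' : m <= m' ->
  (count Y (iota 1 N) - (2 * m' + 1) * j) ^ m <=
  \sum_(s <- seqs m) (all Y s && spread j s).
Proof.
move=> mm'; set n := _ - _.
elim: m mm' => [_|m IH mm']; first by rewrite big_seq1.
rewrite big_seqsS exchange_big /=.
rewrite expnS; apply: leq_trans (leq_mul (leqnn _) (IH (ltnW mm'))) _.
rewrite big_distrr /= big_seq [leqRHS]big_seq; apply: leq_sum => s.
rewrite mem_seqs => /andP[/eqP sm _].
have [Ys|_] := boolP (all Y s); last by rewrite muln0.
have [ss|_] := boolP (spread j s); last by rewrite muln0.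
rewrite muln1 /n leq_subLR.
under eq_bigr => y _ do rewrite spread_cons ss !andbT.
rewrite sum_iota_count.
have Es : count (fun v => ~~ all (apart j v) s) (iota 1 N) <= size s * (2 * j).
  elim: {sm Ys ss} s => [|y s IHs] /=; first by rewrite count_pred0.
  rewrite mulSn; apply: leq_trans (leq_add (count_not_apart j y) IHs).
  apply: leq_trans (count_or_le _ _ _).
  by apply: sub_count => v /=; rewrite negb_and apartC.
have := count_lt j.
have : count Y (iota 1 N) <= count (fun y => [&& Y y, j <= y & all (apart j y) s])
   (iota 1 N) + (count (fun v => v < j) (iota 1 N) +
     count (fun v => ~~ all (apart j v) s) (iota 1 N)).
  rewrite -!sum_iota_count -!big_split; apply: leq_sum => y _ /=.
  by rewrite ltnNge; case: (Y y); case: (j <= y); case: (all _ s).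
rewrite sm in Es.
have : m * (2 * j) <= (2 * m') * j by nia.
lia.
Qed.

Lemma spread_cat_near j x x' : spread j x -> spread j x' ->
  ~~ spread j (x ++ x') -> has (fun y' => has (fun y => ~~ apart j y y') x) x'.
Proof.
move=> /andP[jx px] /andP[jx' px']; rewrite /spread all_cat jx jx' pairwise_cat px px'.
rewrite !andbT /= => /allPn[y yx /allPn[y' y'x' yy']].
by apply/hasP; exists y' => //; apply/hasP; exists y.
Qed.

Lemma count_has_not_apart j x :
  count (fun y' => has (fun y => ~~ apart j y y') x) (iota 1 N) <=
  size x * (2 * j).
Proof.
elim: x => [|y x IH] /=; first by rewrite count_pred0.
rewrite mulSn; apply: leq_trans (leq_add (count_not_apart j y) IH).
exact: count_or_le.
Qed.

(** The first tuple is one of at most k N n0^(k-1) cliques. The second is a clique with an entry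
    less than [j] away from one of the k entries of the first, which leaves at most k * 2j
    candidates for that entry. *)
Lemma sum_near_pairs (r : rel nat) n0 j k : 0 < k -> symmetric r ->
  (forall x, x \in iota 1 N -> count (r x) (iota 1 N) <= n0) ->
  \sum_(x <- seqs k) \sum_(x' <- seqs k)
    [&& pairwise r x, pairwise r x', spread j x, spread j x'
      & ~~ spread j (x ++ x')] <=
  (k * N * n0 ^ k.-1) * (k * (k * (2 * j)) * n0 ^ k.-1).
Proof.
move=> k0 rs rc.
apply: (@leq_trans (\sum_(x <- seqs k) pairwise r x *
    (k * (k * (2 * j)) * n0 ^ k.-1))).
  rewrite big_seq [leqRHS]big_seq; apply: leq_sum => x.
  rewrite mem_seqs => /andP[/eqP sx _].
  case: (pairwise r x) => /=; last by rewrite big1.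
  rewrite mul1n; apply: (@leq_trans (\sum_(x' <- seqs k)
    (has (fun y' => has (fun y => ~~ apart j y y') x) x' && pairwise r x'))).
    apply: leq_sum => x' _; case: (pairwise r x') => //=.
    have [sx1|//] := boolP (spread j x); have [sx2|//] := boolP (spread j x').
    have [//|/(spread_cat_near sx1 sx2) ->//] := boolP (spread j (x ++ x')).
  apply: leq_trans (sum_cluster_has rs rc _ _) _.
  by rewrite !leq_mul//; have := count_has_not_apart j x; rewrite sx.
rewrite -big_distrl leq_mul//=.
have := sum_cluster_has rs rc predT k; rewrite count_predT size_iota.
apply: leq_trans; rewrite big_seq [leqRHS]big_seq; apply: leq_sum => -[|y x]//.
by rewrite mem_seqs; case: k k0.
Qed.

End Counting.

(** * Clusters of digits *)

Section Nearby.
Variable M : nat.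
Implicit Types (w : nat -> 'Z_M).

(** Distance at most [r] on the cycle of residues modulo [M]. *)
Definition nearby (r : nat) w : rel nat :=
  fun x y => in_window (- r%:Z) (2 * r).+1 (w x - w y).

Lemma nearbyP r w x y :
  reflect (exists2 e : int, `|e| <= r%:Z & w x - w y = e%:~R) (nearby r w x y).
Proof.
rewrite /nearby; apply: (iffP (in_windowP _ _ _)) => -[e er ->]; exists e => //; lia.
Qed.

Lemma nearby_sym r w : symmetric (nearby r w).
Proof.
suff h x y : nearby r w x y -> nearby r w y x by move=> x y; apply/idP/idP; exact: h.
move=> /nearbyP[e er xy]; apply/nearbyP; exists (- e); first by rewrite normrN.
by rewrite intrN -xy opprB.
Qed.

Lemma nearby_trans r r' w x y z :
  nearby r w x y -> nearby r' w y z -> nearby (r + r') w x z.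
Proof.
move=> /nearbyP[e er xy] /nearbyP[e' er' yz]; apply/nearbyP.
exists (e + e'); first by lia.
by rewrite intrD -xy -yz addrA subrK.
Qed.

Lemma nearby_le r r' w x y : (r <= r')%N -> nearby r w x y -> nearby r' w x y.
Proof.
move=> rr' /nearbyP[e er xy]; apply/nearbyP; exists e => //; lia.
Qed.

Definition windows_in (W : nat) (L : seq (int * nat)) :=
  all (fun p => (- W%:Z <= p.1) && (p.1 + p.2%:Z <= W%:Z + 1)) L.

(** Successive entries are within [W] of each other, so any two are within the total length of the
    chain. The induction carries the comparison of the head with all later entries. *)
Lemma chain_nearby W L x w : windows_in W L -> size x = (size L).+1 -> chain L x w ->
  pairwise (nearby (size L * W) w) x.
Proof.
suff h : windows_in W L -> size x = (size L).+1 -> chain L x w ->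
    all (nearby (size L * W) w (head 0%N x)) (behead x) &&
    pairwise (nearby (size L * W) w) x.
  by move=> /h/[apply]/[apply]/andP[].
elim: L x => [|p L IH] [|y [|y' t]]//= /andP[/andP[p1 p2] LW] [st] /andP[yy' ct].
have /andP[/= /allP at' /andP[_ pt]] := IH (y' :: t) LW (congr1 S st) ct.
have {}yy' : nearby W w y y'.
  have /in_windowP[e e1 e2] := yy'; apply/nearbyP; exists e => //; lia.
have le : ((size L * W) <= (size L).+1 * W)%N by rewrite leq_mul2r leqnSn orbT.
have ayt : all (nearby ((size L).+1 * W) w y) (y' :: t).
  rewrite /= (nearby_le _ yy') ?mulSn ?leq_addr//=.
  by apply/allP => n /at'; exact: nearby_trans.
move: (ayt) => /= /andP[-> ->] /=.
rewrite (sub_all _ (introT allP at'))/=; last by move=> n; exact: nearby_le.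
by apply: sub_pairwise pt => n n'; exact: nearby_le.
Qed.

(** Keeping only the differences of successive entries turns a cluster into a chain, whose
    probability is known. *)
Definition ball_windows (r m : nat) : seq (int * nat) :=
  nseq m (- r%:Z, (2 * r).+1).

Lemma pairwise_nearby_chain r w x :
  pairwise (nearby r w) x -> chain (ball_windows r (size x).-1) x w.
Proof.
elim: x => [|y [|y' t] IH]//=.
by move=> /andP[/andP[yy' _] /IH ->]; rewrite andbT.
Qed.

Lemma nearby_depends r N w w' : {in iota 1 N, w =1 w'} ->
  {in iota 1 N &, nearby r w =2 nearby r w'}.
Proof. by move=> ww' x y xN yN; rewrite /nearby !ww'. Qed.

Lemma pairwise_nearby_depends r N w w' x : {in iota 1 N, w =1 w'} ->
  all (mem (iota 1 N)) x -> pairwise (nearby r w) x = pairwise (nearby r w') x.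
Proof.
move=> /(@nearby_depends r) ww'; elim: x => //= y x IH /andP[yN xN].
rewrite IH//; congr (_ && _); apply: eq_in_all => n /(allP xN) nN; exact: ww'.
Qed.

Lemma chain_depends_iota L N w w' x : {in iota 1 N, w =1 w'} ->
  all (mem (iota 1 N)) x -> chain L x w = chain L x w'.
Proof.
move=> ww'; elim: L x => [|p L IH] [|y [|y' t]]//= /andP[yN tN].
rewrite IH//; have /andP[y'N _] := tN.
by rewrite !ww'.
Qed.

Section Counts.
Variables (N j m : nat) (L : seq (int * nat)) (r : nat).
Local Notation k := (size L).+1.

(** The radius is doubled because points within [r] of a common one are within 2r of each other. *)
Definition cluster_count w : nat :=
  \sum_(y <- seqs N m) (spread j y && pairwise (nearby (2 * r) w) y).

Definition unspread_pair : rel nat := fun x y =>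
  (x != y) && [|| ~~ apart j x y, (x < j)%N | (y < j)%N].

Definition unspread_count w : nat :=
  \sum_(x <- iota 1 N) \sum_(y <- iota 1 N) (unspread_pair x y && nearby r w x y).

Definition chain_count w : nat := \sum_(x <- seqs N k | uniq x) chain L x w.

Definition spread_chain_count w : nat :=
  \sum_(x <- seqs N k | spread j x) chain L x w.

Definition spread_total : nat := \sum_(x <- seqs N k) spread j x.

(** Removing the (2m + 1) j indices lost in [count_spread_ge] still leaves [j] choices for each of
    [m] entries: a point with more neighbours than this would yield j^m clusters. *)
Definition window_bound : nat := ((2 * m + 2) * j)%N.

Lemma cluster_count_small w : (cluster_count w < j ^ m)%N ->
  {in iota 1 N, forall x, (count (nearby r w x) (iota 1 N) <= window_bound)%N}.
Proof.
move=> Qj x xN; rewrite leqNgt; apply: contraTN Qj => h; rewrite -leqNgt.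
apply: (@leq_trans ((count (nearby r w x) (iota 1 N) - (2 * m + 1) * j) ^ m)).
  have [->//|m0] := posnP m.
  rewrite leq_exp2r//; move: h; rewrite /window_bound.
  have -> : ((2 * m + 2) * j = (2 * m + 1) * j + j)%N by lia.
  by move: ((2 * m + 1) * j)%N (count _ _) => u v; lia.
apply: leq_trans (count_spread_ge N (nearby r w x) j (leqnn m)) _.
apply: leq_sum => s _; case: (spread j s); rewrite ?andbF ?andbT//=.
have [/allP as_|//] := boolP (all _ s).
rewrite (_ : pairwise _ s = true)//.
elim: s as_ => //= y s IH as_; rewrite IH ?andbT; last first.
  by move=> n ns; apply: as_; rewrite inE ns orbT.
apply/allP => n ns; rewrite mul2n -addnn.
apply: (@nearby_trans _ _ _ _ x); first by rewrite nearby_sym as_ ?mem_head.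
by apply: as_; rewrite inE ns orbT.
Qed.

(** An entry below [j] is detected through any pair that contains it, so the list must have a second
    entry. *)
Lemma uniq_unspread x : (0 < j)%N -> (1 < size x)%N -> uniq x ->
  ~~ spread j x -> ~~ pairwise (fun y y' => ~~ unspread_pair y y') x.
Proof.
move=> j0 sx ux; apply: contra => px.
have [y0 [y1 [x' ex]]] : exists y0 y1 x', x = [:: y0, y1 & x'].
  by case: x sx {ux px} => [|y0 [|y1 x']]// _; exists y0, y1, x'.
have P : {in x &, forall y y', y != y' -> ~~ unspread_pair y y'}.
  move: px {sx ex}; elim: x ux => //= y x IH /andP[yx ux] /andP[/allP ax px].
  have S n n' : unspread_pair n n' = unspread_pair n' n.
    by rewrite /unspread_pair eq_sym apartC [X in _ || X]orbC.
  move=> n n'; rewrite !inE => /predU1P[->|nx] /predU1P[->|n'x].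
  - by rewrite eqxx.
  - by move=> _; exact: ax.
  - by move=> _; rewrite S; exact: ax.
  - exact: IH.
apply/(spreadP _ j0); split => //.
- move=> y yx; have [y' y'x yy'] : exists2 y', y' \in x & y != y'.
    have := ux; rewrite ex /= inE negb_or => /andP[/andP[y01 _] _].
    have [->|yy0] := eqVneq y y0; first by exists y1 => //; rewrite !inE eqxx orbT.
    by exists y0 => //; rewrite mem_head.
  have := P _ _ yx y'x yy'; rewrite /unspread_pair yy' /= !negb_or -!leqNgt.
  by case/and3P.
- move=> y y' yx y'x yy'; have := P _ _ yx y'x yy'.
  by rewrite /unspread_pair yy' /=; case: (apart j y y').
Qed.

Hypothesis j0 : (0 < j)%N.
Hypothesis L0 : (0 < size L)%N.
Variable W : nat.
Hypothesis LW : windows_in W L.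
Hypothesis rE : r = (size L * W)%N.

(** A chain tuple is a clique for [nearby r w]. If it is not spread, it contains an unspread pair,
    and [sum_cluster_bad] applies because every point has few neighbours. *)
Lemma chain_count_le w : (cluster_count w < j ^ m)%N ->
  (chain_count w <= spread_chain_count w +
     k ^ 2 * unspread_count w * window_bound ^ k)%N.
Proof.
move=> /cluster_count_small rc.
have n00 : (0 < window_bound)%N by rewrite /window_bound muln_gt0 j0 addn2.
apply: leq_trans (leq_add (leqnn _)
  (sum_cluster_bad (nearby_sym r w) rc unspread_pair k n00)).
rewrite /chain_count /spread_chain_count (big_mkcond uniq) (big_mkcond (spread j)) -big_split.
rewrite big_seq [leqRHS]big_seq; apply: leq_sum => x.
rewrite mem_seqs => /andP[/eqP sx _].
have [ux|//] := boolP (uniq x); have [cx|] := boolP (chain L x w); last by [].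
have pn : pairwise (nearby r w) x by rewrite rE; exact: chain_nearby cx.
have [//|/(uniq_unspread j0 _ ux) -> //] := boolP (spread j x); first by rewrite pn.
by rewrite sx.
Qed.

Lemma spread_chain_count_le w : (spread_chain_count w <= chain_count w)%N.
Proof.
rewrite /chain_count /spread_chain_count (big_mkcond uniq) (big_mkcond (spread j)).
apply: leq_sum => x _.
by have [/(spreadP _ j0)[-> _ _]//|_] := boolP (spread j x).
Qed.

Lemma spread_total_bounds :
  ((N - (2 * k + 1) * j) ^ k <= spread_total <= N ^ k)%N.
Proof.
apply/andP; split.
  have := count_spread_ge N predT j (leqnn k); rewrite count_predT size_iota.
  by move/leq_trans; apply; apply: leq_sum => s _; rewrite all_predT.
rewrite -(size_seqs N k) /spread_total -[size (seqs _ _)]sum1_size; apply: leq_sum => s _.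
exact: leq_b1.
Qed.

End Counts.
End Nearby.

(** * Moment bounds *)

Lemma Zp_int_eq0 (M : nat) (e : int) : (1 < M)%N ->
  e%:~R = 0 :> 'Z_M -> exists q : int, e = q * M%:Z.
Proof.
move=> M1.
have nat_case n : n%:R = 0 :> 'Z_M -> n = (n %/ M * M)%N.
  move=> /(congr1 val); rewrite /= val_Zp_nat// => n0.
  by rewrite {1}(divn_eq n M) n0 addn0.
case: e => n /=.
  by rewrite -pmulrn => /nat_case nE; exists (n %/ M)%N%:Z; rewrite {1}nE PoszM.
rewrite NegzE intrN -pmulrn => /eqP; rewrite oppr_eq0 => /eqP/nat_case nE.
by exists (- (n.+1 %/ M)%N%:Z); rewrite {1}nE PoszM mulNr.
Qed.

Section Estimates.
Context {R : realType}.
Variables (a : nat -> R) (c z : R).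
Hypothesis a_pos : forall n, (1 <= n)%N -> 0 < a n.
Hypothesis c1 : 1 < c.
Hypothesis a_lac : forall n, (1 <= n)%N -> c * a n <= a n.+1.
Variables (M N j m r : nat).
Hypothesis M1 : (1 < M)%N.
Hypothesis j0 : (0 < j)%N.
Hypothesis m0 : (0 < m)%N.
Hypothesis Mcj : M%:R * c ^- j <= 1.
Hypothesis rM : (4 * r + 1 <= M)%N.

Local Notation X := (digit a M).
Local Notation err := (decoupling_const a c * M%:R * c ^- j).
Let gap : R := (c - 1) * a 1.

Let gap_gt0 : 0 < gap.
Proof. by rewrite /gap mulr_gt0 ?a_pos// subr_gt0. Qed.

Let err_ge0 : 0 <= err.
Proof.
rewrite !mulr_ge0 ?invr_ge0 ?exprn_ge0 ?(ltW (lt_trans ltr01 c1))// ltW//.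
exact: decoupling_const_gt0.
Qed.

(** The sequence increases, so the difference is at least a_(x+1) - a_x >= (c - 1) a_x. *)
Lemma lacunary_gap x y : (1 <= x)%N -> (x < y)%N -> gap <= a y - a x.
Proof.
move=> x1 xy; have g := lacunary_growth c1 a_lac (y - x.+1) (ltn0Sn x).
rewrite subnKC// in g; have h := a_lac x1.
have g1 := lacunary_growth c1 a_lac x.-1 (leqnn 1).
rewrite add1n prednK// in g1.
have c_ge1 : 1 <= c := ltW c1.
have e1 n : 1 <= c ^+ n by exact: exprn_ege1.
have ax : a 1 <= a x.
  by apply: le_trans g1; rewrite ler_peMl ?e1// ltW// a_pos.
have : a x.+1 <= a y by apply: le_trans g; rewrite ler_peMl ?e1// ltW// a_pos.
have : (c - 1) * a 1 <= (c - 1) * a x by rewrite ler_wpM2l// subr_ge0.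
rewrite /gap; lra.
Qed.

Lemma lacunary_gap_norm x y : (1 <= x)%N -> (1 <= y)%N -> x != y ->
  gap <= `|a x - a y|.
Proof.
move=> x1 y1; rewrite neq_ltn => /orP[xy|yx].
  by rewrite distrC (le_trans (lacunary_gap x1 xy))// ler_norm.
by rewrite (le_trans (lacunary_gap y1 yx))// ler_norm.
Qed.

(** The fractional parts lost in the two floors differ by less than 1, which is added to the
    radius. *)
Lemma nearby_digit_near_int alpha x y : nearby r (X alpha) x y ->
  near_int (a x - a y) ((r%:R + 1) / M%:R) alpha.
Proof.
move=> /nearbyP[e er]; rewrite /digit => /eqP.
set fx := Num.floor _; set fy := Num.floor _.
rewrite -subr_eq0 -!intrB => /eqP/(Zp_int_eq0 M1)[q fq].
exists q; have M0 : 0 < M%:R :> R by rewrite ltr0n ltnW.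
have /andP[x1 x2] := floor_itv (M%:R * (alpha * a x)).
have /andP[y1 y2] := floor_itv (M%:R * (alpha * a y)).
rewrite -/fx intrD in x1 x2; rewrite -/fy intrD in y1 y2.
have {}fq : fx%:~R - fy%:~R - e%:~R = q%:~R * M%:R :> R.
  by rewrite -!intrB fq intrM.
have {}er : `|e%:~R| <= r%:R :> R by rewrite -intr_norm [r%:R]pmulrn ler_int.
rewrite -(ler_pM2l M0) mulrCA divff ?mulr1 ?gt_eqF//.
rewrite -[X in X * `|_|](gtr0_norm M0) -normrM ler_norml.
move: er; rewrite ler_norml => /andP[e1 e2].
by apply/andP; split; lra.
Qed.

Definition pair_bound : R := 2 * ((r%:R + 1) / M%:R) * (1 + 4 / gap).

(** This holds for any two distinct indices, however close: (a_x - a_y) alpha is near an integer and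
    the factor of alpha is at least [gap] in absolute value. *)
Lemma mean_nearby x y : (1 <= x)%N -> (1 <= y)%N -> x != y ->
  mean z (fun alpha => (nearby r (X alpha) x y)%:R : R) <= pair_bound.
Proof.
move=> x1 y1 xy; have M0 : 0 < M%:R :> R by rewrite ltr0n ltnW.
have g := lacunary_gap_norm x1 y1 xy.
have n0 : 0 < `|a x - a y| := lt_le_trans gap_gt0 g.
apply: (@le_trans _ _ (mean z (\1_(near_int (a x - a y) ((r%:R + 1) / M%:R))))).
  apply: le_mean.
  - apply: (@bounded_measurable_digit R a M [:: x; y]
      (fun w => (nearby r w x y)%:R)).
    by move=> w w' ww'; rewrite /nearby !ww' ?inE ?eqxx ?orbT.
  - by apply: bounded_measurable_indic; exact: measurable_near_int.
  - move=> alpha _; rewrite indicE.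
    have [/nearby_digit_near_int h|] := boolP (nearby _ _ _ _); last by [].
    by rewrite mem_set.
apply: le_trans (mean_near_int _ _ _) _.
- by rewrite -normr_gt0.
- rewrite divr_ge0 ?addr_ge0//= ler_pdivrMr// mul1r natr1 ler_nat.
  by move: rM; lia.
- rewrite /pair_bound ler_wpM2l//.
  by rewrite lerD2l ler_wpM2l// lef_pV2 ?posrE.
Qed.

Lemma bounded_measurable_iota (F : (nat -> 'Z_M) -> R) :
  (forall w w', {in iota 1 N, w =1 w'} -> F w = F w') ->
  bounded_measurable (fun alpha => F (X alpha)).
Proof. exact: (@bounded_measurable_digit R a M (iota 1 N) F). Qed.

Lemma bounded_measurable_chain L' y :
  bounded_measurable (fun alpha => (chain L' y (X alpha))%:R : R).
Proof.
exact: (@bounded_measurable_digit R a M y (fun w => (chain L' y w)%:R)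
  (@chain_depends R M L' y)).
Qed.

Lemma bounded_measurable_cluster :
  bounded_measurable (fun alpha => (cluster_count N j m r (X alpha))%:R : R).
Proof.
apply: (@bounded_measurable_iota (fun w => (cluster_count N j m r w)%:R)).
move=> w w' ww'; congr (_%:R); apply: eq_big_seq => x.
rewrite mem_seqs => /andP[_ xN]; congr (nat_of_bool (_ && _)).
exact: pairwise_nearby_depends xN.
Qed.

(** A spread cluster satisfies a chain of m - 1 windows of length 4r + 1, so each of the N^m tuples
    contributes at most the decoupled probability plus the decoupling error. *)
Lemma mean_cluster_count :
  mean z (fun alpha => (cluster_count N j m r (X alpha))%:R : R) <=
  N%:R ^+ m * (((4 * r + 1)%:R / M%:R) ^+ m.-1 + m%:R ^+ 2 * err).
Proof.
rewrite /cluster_count; under eq_fun do rewrite natr_sum.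
set E := _ + _.
pose F y := fun alpha => (spread j y && pairwise (nearby (2 * r) (X alpha)) y)%:R : R.
have bP y : bounded_measurable
    (fun alpha => (pairwise (nearby (2 * r) (X alpha)) y)%:R : R).
  apply: (@bounded_measurable_digit R a M y
    (fun w => (pairwise (nearby (2 * r) w) y)%:R)) => w w' ww'.
  congr (_%:R); congr nat_of_bool.
  elim: y ww' => //= x y IH ww'; rewrite IH; last first.
    by move=> n ny; apply: ww'; rewrite inE ny orbT.
  congr (_ && _); apply: eq_in_all => n ny.
  by rewrite /nearby !ww' ?inE ?eqxx ?ny ?orbT.
have bF y : bounded_measurable (F y).
  rewrite /F; case: (spread j y) => //=; exact: bounded_measurable_cst.
rewrite (mean_sum _ _ _ bF).
apply: (@le_trans _ _ (\sum_(y <- seqs N m) E)); last first.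
  by rewrite big_const_seq count_predT iter_addr_0 size_seqs -natrX mulr_natl.
rewrite !big_seq; apply: ler_sum => y; rewrite mem_seqs => /andP[/eqP sy _].
have E0 : 0 <= E.
  rewrite /E; apply: addr_ge0; first by apply: exprn_ge0; exact: divr_ge0.
  by apply: mulr_ge0 => //; exact: exprn_ge0.
rewrite /F; have [sp|nsp] := boolP (spread j y); last by rewrite mean_cst.
have sz : size y = (size (ball_windows (2 * r) m.-1)).+1.
  by rewrite size_nseq prednK.
have aM : all (fun p => p.2 <= M)%N (ball_windows (2 * r) m.-1).
  by apply/allP => p /nseqP[-> _] /=; move: rM; lia.
have := mean_chain_le a_pos c1 a_lac M1 j0 Mcj z sp sz aM.
rewrite /chain_prob big_nseq /= iter_mulr_1 sy -/err.
rewrite (_ : (2 * (2 * r)).+1 = (4 * r + 1)%N); last by lia.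
apply: le_trans; apply: le_mean => //.
  exact: bounded_measurable_chain.
move=> alpha _ /=; rewrite ler_nat.
have [pn|//] := boolP (pairwise _ y).
by rewrite -sy pairwise_nearby_chain.
Qed.

(** An index x has at most 2j partners that are not apart from it and [j] partners below [j], and up
    to N partners when x < j; summing over x gives 4jN pairs. *)
Lemma mean_unspread_count :
  mean z (fun alpha => (unspread_count N j r (X alpha))%:R : R) <=
  4 * j%:R * N%:R * pair_bound.
Proof.
have pb0 : 0 <= pair_bound.
  rewrite /pair_bound !mulr_ge0 ?divr_ge0 ?addr_ge0 ?(ltW gap_gt0)//.
  by rewrite divr_ge0 ?(ltW gap_gt0).
rewrite /unspread_count; under eq_fun do rewrite natr_sum.
under eq_fun do under eq_bigr do rewrite natr_sum.
have bF x y : bounded_measurable (fun alpha =>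
    (unspread_pair j x y && nearby r (X alpha) x y)%:R : R).
  apply: (@bounded_measurable_digit R a M [:: x; y]
    (fun w => (unspread_pair j x y && nearby r w x y)%:R)).
  by move=> w w' ww'; rewrite /nearby !ww' ?inE ?eqxx ?orbT.
rewrite mean_sum; last by move=> x; exact: bounded_measurable_sum.
under eq_bigr do rewrite mean_sum//.
apply: (@le_trans _ _ (\sum_(x <- iota 1 N) \sum_(y <- iota 1 N)
    (unspread_pair j x y)%:R * pair_bound)).
  rewrite !big_seq; apply: ler_sum => x; rewrite mem_iota => /andP[x1 _].
  rewrite !big_seq; apply: ler_sum => y; rewrite mem_iota => /andP[y1 _].
  have [up|_] := boolP (unspread_pair j x y); last by rewrite mean_cst mul0r.
  by rewrite mul1r mean_nearby//; case/andP: up.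
under eq_bigr do rewrite -mulr_suml -natr_sum.
rewrite -mulr_suml -natr_sum ler_wpM2r// -!natrM ler_nat.
apply: (@leq_trans (\sum_(x <- iota 1 N) (3 * j + N * (x < j)))).
  rewrite big_seq [leqRHS]big_seq; apply: leq_sum => x xN.
  apply: (@leq_trans (\sum_(y <- iota 1 N)
      ((~~ apart j x y) + (y < j) + (x < j)))).
    apply: leq_sum => y _; rewrite /unspread_pair.
    by case: (x != y); case: (apart _ _ _); case: (_ < _)%N; case: (_ < _)%N.
  rewrite !big_split /= !sum_iota_count.
  have h1 := count_not_apart N j x; have h2 := count_lt N j.
  have -> : count (fun=> (x < j)%N) (iota 1 N) = (N * (x < j))%N.
    by case: (x < j)%N; rewrite ?count_pred0 ?muln0// count_predT size_iota muln1.
  by rewrite leq_add2r; lia.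
rewrite big_split /= big_const_seq count_predT size_iota iter_addn_0.
rewrite -big_distrr /= sum_iota_count.
have := count_lt N j; nia.
Qed.

Variables (L : seq (int * nat)) (W : nat).
Hypothesis LW : windows_in W L.
Hypothesis rE : r = (size L * W)%N.
Hypothesis LM : all (fun p => p.2 <= M)%N L.
Local Notation k := (size L).+1.
Local Notation mu := (@chain_prob R M L).

Definition centred alpha : R :=
  (spread_chain_count N j L (X alpha))%:R - mu * (spread_total N j L)%:R.

Definition regular alpha : bool := (cluster_count N j m r (X alpha) < j ^ m)%N.

Lemma mu_itv : 0 <= mu <= 1. Proof. exact: chain_prob_le1. Qed.

Lemma bounded_measurable_regular :
  bounded_measurable (fun alpha => (regular alpha)%:R * centred alpha ^+ 2).
Proof.
apply: (@bounded_measurable_iota (fun w => (cluster_count N j m r w < j ^ m)%N%:R *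
  ((spread_chain_count N j L w)%:R - mu * (spread_total N j L)%:R) ^+ 2)).
move=> w w' ww'; congr ((_ < _)%N%:R * (_%:R - _) ^+ 2).
  apply: eq_big_seq => x; rewrite mem_seqs => /andP[_ xN].
  congr (nat_of_bool (_ && _)); exact: pairwise_nearby_depends xN.
rewrite /spread_chain_count big_seq_cond [RHS]big_seq_cond; apply: eq_bigr => x.
by rewrite mem_seqs => /andP[/andP[_ xN] _]; congr nat_of_bool; exact: chain_depends_iota xN.
Qed.

Let dev alpha x : R := (chain L x (X alpha))%:R - mu.

Lemma centredE alpha : centred alpha = \sum_(x <- seqs N k) (spread j x)%:R * dev alpha x.
Proof.
rewrite /centred /spread_chain_count /spread_total !natr_sum mulr_sumr.
rewrite big_mkcond -sumrB; apply: eq_bigr => x _ /=; rewrite /dev mulrBr.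
by congr (_ - _); rewrite 1?mulrC//; case: (spread j x); rewrite ?mul0r ?mul1r ?mulr0 ?mulr1.
Qed.

(** The part of the second moment carried by jointly spread pairs of tuples. It is kept for all
    alpha, since the covariance bound concerns means over the whole interval. *)
Let Z alpha : R := \sum_(x <- seqs N k) \sum_(x' <- seqs N k)
  (spread j (x ++ x'))%:R * (dev alpha x * dev alpha x').

Let near_bound (n : nat) : R :=
  ((k * N * n ^ k.-1) * (k * (k * (2 * j)) * n ^ k.-1))%N%:R.

Lemma dev_le1 alpha x : `|dev alpha x| <= 1.
Proof.
have /andP[] := mu_itv; rewrite /dev.
by case: (chain L x _); rewrite ler_norml /=; lra.
Qed.

Lemma spread_cat x x' : spread j (x ++ x') -> spread j x /\ spread j x'.
Proof.
rewrite /spread all_cat pairwise_cat.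
by move=> /andP[/andP[-> ->] /and3P[_ -> ->]].
Qed.

(** For u, v in {0, 1}, (u - mu) (v - mu) <= u v + mu^2. On pairs that are not jointly spread, the
    terms u v count pairs of clusters, with neighbours bounded by regularity; the constant terms
    count all such pairs, under the full relation with N neighbours. *)
Lemma centred_sq_le alpha : regular alpha ->
  centred alpha ^+ 2 <= Z alpha +
    (near_bound (window_bound j m) + mu ^+ 2 * near_bound N).
Proof.
move=> reg; have /andP[mu0 _] := mu_itv.
pose nr x x' := [&& spread j x, spread j x' & ~~ spread j (x ++ x')].
have -> : centred alpha ^+ 2 = Z alpha + \sum_(x <- seqs N k) \sum_(x' <- seqs N k)
    (nr x x')%:R * (dev alpha x * dev alpha x').
  rewrite centredE expr2 mulr_suml /Z -big_split; apply: eq_bigr => x _ /=.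
  rewrite mulr_sumr -big_split; apply: eq_bigr => x' _ /=.
  rewrite -mulrDl mulrACA; congr (_ * _); rewrite /nr.
  have := @spread_cat x x'.
  case: (spread j (x ++ x')) => [/(_ isT)[-> ->]|_] /=; first by rewrite mulr1 addr0.
  by rewrite andbT -natrM mulnb add0r.
rewrite lerD2l.
apply: (@le_trans _ _ (\sum_(x <- seqs N k) \sum_(x' <- seqs N k)
  ([&& pairwise (nearby r (X alpha)) x, pairwise (nearby r (X alpha)) x',
    spread j x, spread j x' & ~~ spread j (x ++ x')]%:R +
   mu ^+ 2 * [&& pairwise (fun _ _ => true) x, pairwise (fun _ _ => true) x',
    spread j x, spread j x' & ~~ spread j (x ++ x')]%:R))).
  rewrite !big_seq; apply: ler_sum => x; rewrite mem_seqs => /andP[/eqP sx _].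
  rewrite !big_seq; apply: ler_sum => x'; rewrite mem_seqs => /andP[/eqP sx' _].
  have pT y : pairwise (fun _ _ : nat => true) y = true.
    by elim: y => //= ? y ->; rewrite andbT all_predT.
  rewrite !pT /= -/(nr x x'); case: (nr x x'); last first.
    by rewrite !andbF mul0r mulr0 addr0.
  rewrite !andbT mul1r mulr1.
  have cn y : size y = k -> chain L y (X alpha) ->
      pairwise (nearby r (X alpha)) y.
    by move=> sy; rewrite rE; exact: chain_nearby.
  rewrite /dev; have := cn _ sx; have := cn _ sx'.
  set p := pairwise _ x; set p' := pairwise _ x'.
  have : 0 <= (p && p')%:R :> R by [].
  case: (chain L x' _) (chain L x _) => -[] p0 h h';
    rewrite ?(h isT) ?(h' isT) /= in p0 *; nra.
under eq_bigr do rewrite big_split -mulr_sumr -!natr_sum /=.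
rewrite big_split -mulr_sumr -!natr_sum /=; apply: lerD.
  rewrite ler_nat; apply: (@sum_near_pairs N _ (window_bound j m) j k) => //.
    exact: nearby_sym.
  exact: cluster_count_small reg.
rewrite ler_wpM2l ?exprn_ge0// ler_nat.
apply: (@sum_near_pairs N (fun _ _ => true) N j k) => // x _.
by rewrite (leq_trans (count_size _ _))// size_iota.
Qed.

(** At irregular alpha [Z] may be negative, but |Z| <= N^(2k) and [cluster_count] is at least j^m
    there; the middle term compensates. No indicator of regularity thus enters the covariances. *)
Lemma mean_regular_sq :
  mean z (fun alpha => (regular alpha)%:R * centred alpha ^+ 2) <=
  N%:R ^+ (k + k) * ((k + k)%:R ^+ 2 * err) +
  N%:R ^+ (k + k) / j%:R ^+ m *
    mean z (fun alpha => (cluster_count N j m r (X alpha))%:R : R) +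
  (near_bound (window_bound j m) + mu ^+ 2 * near_bound N).
Proof.
set Bd := _ + mu ^+ 2 * _.
have jm0 : 0 < j%:R ^+ m :> R by rewrite exprn_gt0// ltr0n.
have Bd0 : 0 <= Bd by rewrite /Bd addr_ge0// mulr_ge0// exprn_ge0//; case/andP: mu_itv.
have bZ2 x x' : bounded_measurable (fun alpha =>
    (spread j (x ++ x'))%:R * (dev alpha x * dev alpha x')).
  apply: bounded_measurableM; first exact: bounded_measurable_cst.
  apply: bounded_measurableM; (apply: bounded_measurableB;
    [exact: bounded_measurable_chain|exact: bounded_measurable_cst]).
have bZ : bounded_measurable Z.
  by apply: bounded_measurable_sum => x; exact: bounded_measurable_sum.
have ZB alpha : `|Z alpha| <= N%:R ^+ (k + k).
  rewrite /Z (le_trans (ler_norm_sum _ _ _))//.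
  apply: (@le_trans _ _ (\sum_(x <- seqs N k) \sum_(x' <- seqs N k) 1)).
    apply: ler_sum => x _; rewrite (le_trans (ler_norm_sum _ _ _))//.
    apply: ler_sum => x' _; rewrite !normrM.
    rewrite mulr_ile1 ?mulr_ge0 ?mulr_ile1 ?dev_le1//.
    by case: (spread _ _); rewrite ?normr1 ?normr0.
  rewrite !big_const_seq !count_predT !iter_addr_0 !size_seqs.
  by rewrite -mulrnA -expnD natrX.
have EZ : mean z Z <= N%:R ^+ (k + k) * ((k + k)%:R ^+ 2 * err).
  rewrite /Z mean_sum; last by move=> x; exact: bounded_measurable_sum.
  under eq_bigr do rewrite mean_sum//.
  set E := _ * err.
  have E0 : 0 <= E by rewrite mulr_ge0// exprn_ge0.
  apply: (@le_trans _ _ (\sum_(x <- seqs N k) \sum_(x' <- seqs N k) E)); last first.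
    rewrite !big_const_seq !count_predT !iter_addr_0 !size_seqs -mulrnA -expnD.
    by rewrite -natrX mulr_natl.
  rewrite !big_seq; apply: ler_sum => x; rewrite mem_seqs => /andP[/eqP sx _].
  rewrite !big_seq; apply: ler_sum => x'; rewrite mem_seqs => /andP[/eqP sx' _].
  have [sp|_] := boolP (spread j (x ++ x')); last first.
    by under eq_fun do rewrite mul0r; rewrite mean_cst.
  under eq_fun do rewrite mul1r.
  have := mean_chain_covariance a_pos c1 a_lac M1 j0 Mcj z sp sx LM.
  by rewrite size_cat sx sx'.
have bQ := bounded_measurable_cluster.
have bZQ : bounded_measurable (fun alpha => N%:R ^+ (k + k) / j%:R ^+ m *
    (cluster_count N j m r (X alpha))%:R : R).
  by apply: bounded_measurableM => //; exact: bounded_measurable_cst.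
have bBd := bounded_measurable_cst (R := R) Bd.
apply: (@le_trans _ _ (mean z (fun alpha => Z alpha + N%:R ^+ (k + k) / j%:R ^+ m *
    (cluster_count N j m r (X alpha))%:R + Bd))).
  apply: le_mean; first exact: bounded_measurable_regular.
    by do 2 apply: bounded_measurableD => //.
  move=> alpha _; have [reg|nreg] := boolP (regular alpha).
    rewrite mul1r (le_trans (centred_sq_le reg))// -/Bd lerD2r lerDl.
    by rewrite !mulr_ge0// ?invr_ge0 ?exprn_ge0.
  rewrite mul0r addr_ge0// -[X in _ + X]mulrA.
  have Q1 : 1 <= (j%:R ^+ m)^-1 * (cluster_count N j m r (X alpha))%:R :> R.
    rewrite ler_pdivlMl// mulr1 -natrX ler_nat.
    by move: nreg; rewrite /regular -leqNgt.
  have := ZB alpha; rewrite ler_norml => /andP[Z1 _].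
  have : N%:R ^+ (k + k) <= N%:R ^+ (k + k) *
    ((j%:R ^+ m)^-1 * (cluster_count N j m r (X alpha))%:R) :> R.
    by rewrite ler_peMr// exprn_ge0.
  lra.
rewrite meanD//; last exact: bounded_measurableD.
rewrite meanD// meanZ// mean_cst lerD2r lerD2r//.
Qed.

End Estimates.

(** * Convergence almost everywhere *)

Section BorelCantelli.
Context {R : realType}.
Notation mu := (@lebesgue_measure R).

(** Telescoping, from (x + 1)^(-2) <= 1 / x - 1 / (x + 1). *)
Lemma sum_inv_sqr_le n : \sum_(i < n) (i.+1%:R ^- 2 : R) <= 2 - n%:R^-1.
Proof.
elim: n => [|n IH]; first by rewrite big_ord0 invr0; lra.
rewrite big_ord_recr /=; case: n IH => [_|n IH].
  by rewrite big_ord0 add0r expr1n invr1; lra.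
apply: le_trans (lerD IH (lexx _)) _.
set x : R := n.+1%:R; have x0 : 0 < x by rewrite ltr0n.
have -> : n.+2%:R = x + 1 by rewrite natr1.
suff h : (x + 1) ^- 2 <= x^-1 - (x + 1)^-1.
  by move: h; move: ((x + 1) ^- 2) x^-1 (x + 1)^-1 => u v w; lra.
have -> : x^-1 - (x + 1)^-1 = (x * (x + 1))^-1.
  by field; rewrite !gt_eqF// addr_gt0.
rewrite lef_pV2 ?posrE ?exprn_gt0 ?mulr_gt0 ?addr_gt0// expr2.
by rewrite ler_pM2r ?addr_gt0// lerDl.
Qed.

(** The means are summable, so the sum of the nonnegative functions is integrable, hence finite
    almost everywhere, and its terms tend to 0. *)
Lemma ae_cvg0_mean z (h : nat -> R -> R) (C : R) (j0 : nat) : (0 < j0)%N ->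
  (forall j, bounded_measurable (h j)) ->
  (forall j alpha, 0 <= h j alpha) ->
  (forall j, (j0 <= j)%N -> mean z (h j) <= C / j%:R ^+ 2) ->
  {ae mu, forall alpha, z <= alpha < z + 1 -> h j alpha @[j --> \oo] --> (0 : R)}.
Proof.
move=> j00 bh h0 hC.
have C0 : 0 <= C.
  have := hC _ (leqnn j0); rewrite ler_pdivlMr ?exprn_gt0 ?ltr0n//.
  by apply: le_trans; rewrite mulr_ge0 ?exprn_ge0// Rintegral_ge0.
pose g i := h (i + j0)%N.
pose I : set R := `[z, z + 1[%classic.
have mI : measurable I by exact: measurable_itv.
have mg i : measurable_fun I (fun x => (g i x)%:E).
  by apply/measurable_EFinP/measurable_funTS; exact: (bh _).1.
have g0 i x : I x -> (0 <= (g i x)%:E)%E by rewrite lee_fin h0.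
have meanE i : (\int[mu]_(x in I) (g i x)%:E)%E = (mean z (g i))%:E.
  rewrite /mean /Rintegral fineK//.
  by apply: integrable_fin_num => //; exact: mean_integrable (bh _).
have Fint : (\int[mu]_(x in I) \sum_(i <oo) (g i x)%:E <= (C * 2)%:E)%E.
  rewrite integral_nneseries//; under eq_eseriesr do rewrite meanE.
  apply: lime_le.
    by apply: is_cvg_nneseries => i _ _; rewrite lee_fin Rintegral_ge0// => x _; exact: h0.
  apply: nearW => n; rewrite sumEFin lee_fin big_mkord.
  apply: (@le_trans _ _ (\sum_(i < n) C * i.+1%:R ^- 2)).
    apply: ler_sum => i _; apply: le_trans (hC _ _) _; first exact: leq_addl.
    rewrite ler_wpM2l// lef_pV2 ?posrE ?exprn_gt0 ?ltr0n ?addn_gt0 ?j00 ?orbT//.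
    by rewrite lerXn2r ?nnegrE// ler_nat -addn1 leq_add2l.
  rewrite -mulr_sumr ler_wpM2l// (le_trans (sum_inv_sqr_le n))//.
  by rewrite gerBl invr_ge0.
have intF : mu.-integrable I (fun x => \sum_(i <oo) (g i x)%:E)%E.
  apply/integrableP; split.
    apply: (ge0_emeasurable_sum (P := xpredT)) => [i x Ix _|i _].
      exact: g0.
    exact: mg.
  apply: le_lt_trans (ltry (C * 2)); apply: le_trans Fint.
  rewrite le_eqVlt; apply/orP; left; apply/eqP; apply: eq_integral => x xI.
  rewrite gee0_abs//; apply: nneseries_ge0 => i _ _; apply: g0; exact/set_mem.
have := @integrable_ae _ (measurableTypeR R) R mu I mI _ intF.
apply: filterS => x Fx xI.
have {}Fx : (\sum_(i <oo) (g i x)%:E < +oo)%E.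
  have {}xI : I x by rewrite /I /= in_itv.
  have {}Fx := Fx xI; rewrite -ge0_fin_numE//.
  by apply: nneseries_ge0 => i _ _; exact: g0.
rewrite -(cvg_shiftn j0).
suff : (g n x)%:E @[n --> \oo] --> 0%:E by move/fine_cvg.
apply: (@squeeze_cvge _ _ _ _ (fun=> 0%E) _ (fun n => \sum_(n <= i <oo) (g i x)%:E)%E).
- apply: nearW => n; rewrite lee_fin h0 /=.
  apply: le_trans (@nneseries_lim_ge R _ xpredT n n.+1 _); last first.
    by move=> i _ _; rewrite lee_fin h0.
  by rewrite big_nat1.
- exact: cvg_cst.
- by apply: nneseries_tail_cvg => // i _; rewrite lee_fin h0.
Qed.

End BorelCantelli.

Lemma bernoulli_ge {R : realFieldType} (d : R) n : 0 <= d -> 1 + n%:R * d <= (1 + d) ^+ n.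
Proof.
move=> d0; elim: n => [|n IH]; first by rewrite mul0r addr0 expr0.
rewrite exprS; apply: le_trans (ler_wpM2l _ IH); last by lra.
have : 0 <= n%:R :> R by []. rewrite -natr1; nra.
Qed.

Lemma bernoulli_le {R : realFieldType} (x : R) n : 0 <= x <= 1 ->
  1 - n%:R * x <= (1 - x) ^+ n.
Proof.
move=> /andP[x0 x1]; elim: n => [|n IH]; first by rewrite mul0r subr0 expr0.
rewrite exprS; apply: le_trans (ler_wpM2l _ IH); last by lra.
have : 0 <= n%:R :> R by []. rewrite -natr1; nra.
Qed.

(** Induction on [q] with c = d * d: one factor d^j dominates j by Bernoulli's inequality, the other
    dominates j^q. *)
Lemma poly_le_geometric {R : realType} (c : R) q : 1 < c ->
  exists B : R, forall j, j%:R ^+ q <= B * c ^+ j.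
Proof.
elim: q c => [|q IH] c c1.
  by exists 1 => j; rewrite expr0 mul1r exprn_ege1// ltW.
set d := Num.sqrt c.
have d1 : 1 < d by rewrite -[1]sqrtr1 ltr_sqrt// (lt_trans ltr01).
have dc : c = d * d by rewrite -expr2 sqr_sqrtr// ltW// (lt_trans ltr01).
have [B HB] := IH d d1.
have dj j : j%:R <= (d - 1)^-1 * d ^+ j.
  rewrite ler_pdivlMl ?subr_gt0//.
  have := @bernoulli_ge R (d - 1) j; rewrite subr_ge0 (ltW d1) => /(_ isT).
  rewrite (_ : 1 + (d - 1) = d); last by ring.
  by move: (d ^+ j) => u; lra.
exists ((d - 1)^-1 * B) => j; rewrite exprS dc exprMn mulrACA.
by apply: ler_pM => //; exact: exprn_ge0.
Qed.

Lemma poly_geometric_small {R : realType} (c C : R) q : 1 < c ->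
  exists j1, forall j, (j1 <= j)%N -> C * j%:R ^+ q * c ^- j <= 1.
Proof.
move=> c1; have [B HB] := poly_le_geometric q.+1 c1.
have c0 : 0 < c by exact: lt_trans c1.
exists (Num.truncn (`|C| * B)).+1 => j jB.
have j0 : (0 < j)%N by exact: leq_trans jB.
have s0 : 0 < j%:R :> R by rewrite ltr0n.
rewrite ler_pdivrMr ?exprn_gt0// mul1r.
apply: (@le_trans _ _ (`|C| * j%:R ^+ q)).
  by rewrite ler_wpM2r ?exprn_ge0// ler_norm.
rewrite -(ler_pM2l s0) mulrCA -exprS.
apply: le_trans (ler_wpM2l _ (HB j)) _ => //.
rewrite mulrA ler_wpM2r ?exprn_ge0 ?(ltW c0)//.
apply: ltW; apply: lt_le_trans (truncnS_gt _) _; by rewrite ler_nat.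
Qed.

(** * Scaled bounds along the powers of j *)

Section AlongPowers.
Context {R : realType}.
Variables (a : nat -> R) (c z : R).
Hypothesis a_pos : forall n, (1 <= n)%N -> 0 < a n.
Hypothesis c1 : 1 < c.
Hypothesis a_lac : forall n, (1 <= n)%N -> c * a n <= a n.+1.
Variables (K C1 : nat).
Hypothesis K0 : (0 < K)%N.
Hypothesis C10 : (0 < C1)%N.

Local Notation k := K.+1.
(** Close pairs contribute a term of order j^(2K+1) / N, which is O(j^(-2)) at this scale; see
    [stn]. *)
Definition scale_exp := (2 * K + 4)%N.
Definition scale (j : nat) := (j ^ scale_exp)%N.
(* Large enough for [s ^+ m] to beat the trivial bound on the number of pairs of
   tuples times the mean number of clusters. *)
Definition moment_order := (scale_exp * (2 * k + 1) + 2)%N.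
Local Notation m := moment_order.

Section Fixed.
Variables (j : nat) (L : seq (int * nat)).
Hypothesis LK : size L = K.
Local Notation N := (scale j).
Local Notation M := (N ^ 2)%N.
Local Notation r := (K * (C1 * N))%N.
Hypothesis LW : windows_in (C1 * N) L.
Hypothesis j0 : (0 < j)%N.
Local Notation D := (5 * K * C1)%N.
Hypothesis DN : (D <= N)%N.
Local Notation err := (decoupling_const a c * (N ^ 2)%:R * c ^- j).
Hypothesis errN : N%:R ^+ (k + k + m) * ((k + k)%:R ^+ 2 + m%:R ^+ 2) * err <= 1.
Hypothesis Mcj : (N ^ 2)%:R * c ^- j <= 1.
Local Notation X := (digit a M).
Local Notation mu := (@chain_prob R M L).
Local Notation n0 := (window_bound j m).
Local Notation s := (j%:R : R).
Local Notation n := (N%:R : R).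

Let nE : n = s ^+ K ^+ 2 * s ^+ 4.
Proof. by rewrite /scale /scale_exp natrX mulnC exprD exprM. Qed.

Let s1 : 1 <= s. Proof. by rewrite ler1n. Qed.
Let s_gt0 : 0 < s. Proof. exact: lt_le_trans s1. Qed.
Let t1 : 1 <= s ^+ K. Proof. exact: exprn_ege1. Qed.
Let n1 : 1 <= n. Proof. by rewrite /scale natrX exprn_ege1. Qed.
Let n_gt0 : 0 < n. Proof. exact: lt_le_trans n1. Qed.
Let N5 : (5 <= N)%N.
Proof. by apply: leq_trans DN; rewrite -mulnA leq_pmulr// muln_gt0 K0. Qed.
Let M1 : (1 < M)%N. Proof. by have := N5; nia. Qed.
Let m0 : (0 < m)%N. Proof. by rewrite /moment_order addn2. Qed.
Let rM : (4 * r + 1 <= M)%N.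
Proof.
apply: (@leq_trans (D * N)); last by rewrite -mulnn leq_mul2r DN orbT.
have : (0 < K * C1 * N)%N by rewrite !muln_gt0 K0 C10; exact: leq_trans N5.
lia.
Qed.
Let L0 : (0 < size L)%N. Proof. by rewrite LK. Qed.
Let rE : r = (size L * (C1 * N))%N. Proof. by rewrite LK. Qed.
(** A window inside [-W, W] has at most 2W + 1 elements, hence at most 3W for W = C1 * N > 0. *)
Let len_le p : p \in L -> (p.2 <= 3 * C1 * N)%N.
Proof.
move=> /(allP LW) /andP[].
have : (0 < C1 * N)%N by rewrite muln_gt0 C10; exact: leq_trans N5.
by rewrite -mulnA; move: (C1 * N)%N p.2 p.1 => u v w; lia.
Qed.
Let LM : all (fun p => p.2 <= M)%N L.
Proof.
apply/allP => p /len_le /leq_trans; apply.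
rewrite -mulnn leq_mul2r; apply/orP; right; apply: leq_trans DN.
by have := leq_pmull C1 K0; lia.
Qed.

Let gap : R := (c - 1) * a 1.
Let gap_gt0 : 0 < gap.
Proof. by rewrite /gap mulr_gt0 ?a_pos// subr_gt0. Qed.
Let err_ge0 : 0 <= err.
Proof.
rewrite !mulr_ge0 ?invr_ge0 ?exprn_ge0 ?(ltW (lt_trans ltr01 c1))// ltW//.
exact: decoupling_const_gt0.
Qed.

Let radius_ratio : (4 * r + 1)%:R / M%:R <= D%:R / n :> R.
Proof.
rewrite natrX ler_pdivrMr ?exprn_gt0// expr2 mulrA divfK ?gt_eqF//.
rewrite -natrM ler_nat.
have : (0 < K * C1 * N)%N by rewrite !muln_gt0 K0 C10; exact: leq_trans N5.
lia.
Qed.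

(** N^m (D / N)^(m-1) = D^(m-1) N, and the summand 1 pays for the decoupling error. *)
Definition cluster_const : R := D%:R ^+ m.-1 + 1.

Local Notation EQ := (mean z (fun alpha => (cluster_count N j m r (X alpha))%:R : R)).

Let cluster_err_le1 : n ^+ m * (m%:R ^+ 2 * err) <= 1.
Proof.
apply: le_trans errN; rewrite -[leRHS]mulrA.
apply: ler_pM; first exact: exprn_ge0.
- by apply: mulr_ge0 => //; exact: exprn_ge0.
- by rewrite ler_weXn2l// leq_addl.
- by rewrite ler_wpM2r// lerDr exprn_ge0.
Qed.

Let pair_err_le1 : n ^+ (k + k) * ((k + k)%:R ^+ 2 * err) <= 1.
Proof.
apply: le_trans errN; rewrite -[leRHS]mulrA.
apply: ler_pM; first exact: exprn_ge0.
- by apply: mulr_ge0 => //; exact: exprn_ge0.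
- by rewrite ler_weXn2l// leq_addr.
- by rewrite ler_wpM2r// lerDl exprn_ge0.
Qed.

Lemma mean_cluster_scaled : EQ <= cluster_const * n.
Proof.
apply: le_trans (mean_cluster_count z a_pos c1 a_lac N M1 j0 m0 Mcj rM) _.
rewrite mulrDr /cluster_const [leRHS]mulrDl mul1r; apply: lerD; last exact: le_trans n1.
have -> : n ^+ m = n * n ^+ m.-1 by rewrite -exprS prednK.
rewrite -mulrA -exprMn [leRHS]mulrC; apply: ler_wpM2l; first exact: ltW.
have D0 : 0 <= D%:R :> R by [].
apply: lerXn2r; rewrite ?nnegrE//.
apply: le_trans (ler_wpM2l (ltW n_gt0) radius_ratio) _.
by rewrite mulrCA divff ?mulr1 ?gt_eqF.
Qed.

(** One factor n cancels the mean number of clusters, n^(k+k) the trivial bound on [Z], and s^2 is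
    left as a summable rate. *)
Let smE : s ^+ m = n ^+ (k + k) * n * s ^+ 2.
Proof.
have E : s ^+ scale_exp = n by rewrite /scale natrX.
have e2 : (2 * k + 1 = (k + k).+1)%N by rewrite addn1 mul2n -addnn.
by rewrite /moment_order exprD exprM E e2 exprSr.
Qed.

Local Notation t := (s ^+ K).

Let stn : s * t ^+ 2 / n <= s ^- 2.
Proof.
rewrite ler_pdivrMr// nE ler_pdivlMl ?exprn_gt0//.
have : 0 < t ^+ 2 by rewrite exprn_gt0// (lt_le_trans _ t1).
have := s1; move: (t ^+ 2) => u s1' u0.
rewrite (_ : s ^+ 2 * (s * u) = u * s ^+ 3); last by ring.
by rewrite ler_pM2l// ler_weXn2l.
Qed.

(** The summands answer to the terms of [mean_regular_sq] divided by N^2: decoupling error,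
    irregular alpha, close pairs of clusters, and close pairs of tuples weighted by mu^2. *)
Definition variance_const : R :=
  1 + cluster_const + (2 * k ^ 3 * (2 * m + 2) ^ (2 * K))%:R +
  (2 * k ^ 3)%:R * (3 * C1)%:R ^+ (2 * K).

Lemma chain_prob_scaled : 0 <= mu <= ((3 * C1)%:R / n) ^+ K.
Proof.
have /andP[-> _] := @chain_prob_le1 R M M1 L LM.
rewrite /chain_prob -LK /=; elim: L len_le => [|p L' IH] le.
  by rewrite big_nil expr0.
rewrite big_cons exprS; apply: ler_pM.
- exact: divr_ge0.
- by apply: prodr_ge0 => i _; exact: divr_ge0.
- rewrite natrX ler_pdivrMr ?exprn_gt0// expr2 mulrA divfK ?gt_eqF//.
  by rewrite -natrM ler_nat le ?mem_head.
- by apply: IH => p' p'L; apply: le; rewrite inE p'L orbT.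
Qed.

Let invn2 : n ^- 2 <= s ^- 2.
Proof.
rewrite lef_pV2 ?posrE ?exprn_gt0// lerXn2r ?nnegrE ?(ltW s_gt0) ?(ltW n_gt0)//.
by rewrite /scale natrX -[leLHS]expr1 ler_weXn2l// /scale_exp addn4.
Qed.

Local Notation regular' alpha := (regular a (N ^ 2) N j m r alpha).
Local Notation centred' alpha := (centred a (N ^ 2) N j L alpha).

Lemma mean_regular_scaled :
  n ^- 2 * mean z (fun alpha => (regular' alpha)%:R * centred' alpha ^+ 2) <=
  variance_const / s ^+ 2.
Proof.
have V := mean_regular_sq z a_pos c1 a_lac N m M1 j0 Mcj LW rE LM.
rewrite LK in V.
have ns0 : 0 <= n ^- 2 by rewrite invr_ge0 exprn_ge0.
apply: le_trans (ler_wpM2l ns0 V) _.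
rewrite /variance_const [leLHS]mulrDr [X in X + _]mulrDr [X in _ + X <= _]mulrDr.
rewrite [leRHS]mulrDl [X in _ <= X + _]mulrDl [X in _ <= X + _ + _]mulrDl.
have tp : 0 < s ^+ K by apply: lt_le_trans t1.
rewrite -!addrA; apply: lerD; last apply: lerD; last apply: lerD.
- rewrite mul1r; apply: le_trans invn2.
  by rewrite -[leRHS]mulr1 ler_wpM2l.
- have QE := mean_cluster_scaled.
  apply: (@le_trans _ _ (n ^- 2 * (n ^+ (k + k) / s ^+ m * (cluster_const * n)))).
    by rewrite ler_wpM2l// ler_wpM2l// mulr_ge0// ?invr_ge0 exprn_ge0// ltW.
  rewrite [leLHS](_ : _ = n ^- 2 * (cluster_const / s ^+ 2)); last first.
    by rewrite smE; field; rewrite !gt_eqF ?exprn_gt0.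
  rewrite ler_piMl ?divr_ge0 ?exprn_ge0 ?addr_ge0 ?exprn_ge0 ?(ltW s_gt0)//.
  by rewrite invf_le1 ?exprn_gt0// exprn_ege1.
- rewrite /window_bound (_ : (_ * _)%N%:R =
      (2 * k ^ 3 * (2 * m + 2) ^ (2 * K))%:R * (s * t ^+ 2) * n); last first.
    rewrite (mulnC 2%N K) expnM /= !(natrM, natrX) !exprMn; ring.
  rewrite [leLHS](_ : _ = (2 * k ^ 3 * (2 * m + 2) ^ (2 * K))%:R * (s * t ^+ 2 / n)).
    by rewrite ler_wpM2l.
  by field; rewrite gt_eqF.
- have /andP[mu0 mule] := chain_prob_scaled.
  set nb := (_ * _)%N%:R.
  have nbE : nb = (2 * k ^ 3)%:R * s * n * (n ^+ K) ^+ 2.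
    by rewrite /nb /= !(natrM, natrX); ring.
  apply: (@le_trans _ _ (n ^- 2 * ((((3 * C1)%:R / n) ^+ K) ^+ 2 * nb))).
    by rewrite ler_wpM2l// ler_wpM2r// lerXn2r ?nnegrE// (le_trans mu0).
  rewrite [leLHS](_ : _ = (2 * k ^ 3)%:R * (3 * C1)%:R ^+ (2 * K) * (s / n)).
    rewrite ler_wpM2l ?mulr_ge0 ?exprn_ge0//; apply: le_trans stn.
    rewrite ler_wpM2r ?invr_ge0 ?(ltW n_gt0)// ler_peMr ?(ltW s_gt0)//.
    exact: exprn_ege1.
  rewrite nbE exprMn exprVn (mulnC 2%N K) exprM.
  by field; rewrite !gt_eqF ?exprn_gt0.
Qed.

Definition pair_const : R :=
  (k ^ 2 * (2 * m + 2) ^ k)%:R * (4 * (2 * D%:R * (1 + 4 / gap))).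

Lemma mean_unspread_scaled :
  n^-1 * ((k ^ 2)%:R * n0%:R ^+ k *
    mean z (fun alpha => (unspread_count N j r (X alpha))%:R : R)) <=
  pair_const / s ^+ 2.
Proof.
have U := mean_unspread_count z a_pos c1 a_lac N M1 j0 m0 Mcj rM.
have pb : pair_bound a c M r <= 2 * (D%:R / n) * (1 + 4 / gap).
  rewrite /pair_bound -/gap ler_wpM2r ?addr_ge0 ?divr_ge0 ?(ltW gap_gt0)//.
  rewrite ler_wpM2l//; apply: le_trans radius_ratio.
  by rewrite ler_wpM2r ?invr_ge0// natr1 ler_nat addn1 ltnS leq_pmull.
have c0' : 0 <= n^-1 * ((k ^ 2)%:R * n0%:R ^+ k) :> R.
  by rewrite !mulr_ge0 ?invr_ge0 ?exprn_ge0 ?(ltW n_gt0).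
rewrite mulrA; apply: le_trans (ler_wpM2l c0' U) _.
apply: le_trans (ler_wpM2l c0' (ler_wpM2l _ pb)) _.
  by rewrite !mulr_ge0 ?(ltW n_gt0).
rewrite [leLHS](_ : _ = pair_const * (s ^+ k * s / n)).
  rewrite ler_wpM2l//.
    by rewrite /pair_const !mulr_ge0 ?addr_ge0 ?divr_ge0 ?(ltW gap_gt0).
  (* As K is positive, k <= 2K, so s^k is at most t^2. *)
  apply: le_trans stn; rewrite ler_wpM2r ?invr_ge0 ?(ltW n_gt0)//.
  rewrite [leRHS]mulrC ler_wpM2r ?(ltW s_gt0)//.
  by rewrite -exprM ler_weXn2l// muln2 -addnn -addn1 leq_add2l.
rewrite /pair_const /window_bound [in RHS]natrM !natrX natrM exprMn.
by field; rewrite !gt_eqF ?exprn_gt0.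
Qed.

Lemma mean_cluster_scaled2 : EQ / s ^+ m <= cluster_const / s ^+ 2.
Proof.
have cc0 : 0 <= cluster_const by rewrite addr_ge0 ?exprn_ge0.
rewrite ler_pdivrMr ?exprn_gt0//; apply: le_trans mean_cluster_scaled _.
rewrite smE -[leRHS]mulrA ler_wpM2l// [leRHS](_ : _ = n ^+ (k + k) * n).
  by rewrite ler_peMl ?(ltW n_gt0)// exprn_ege1.
by field; rewrite gt_eqF.
Qed.

(** A single quantity of mean O(j^(-2)) that controls the variance, the unspread tuples and the
    crowding; its last summand is at least 1 at irregular alpha. *)
Definition deviation alpha : R :=
  n ^- 2 * ((regular' alpha)%:R * centred' alpha ^+ 2) +
  n^-1 * (k ^ 2)%:R * n0%:R ^+ k * (unspread_count N j r (X alpha))%:R +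
  (s ^+ m)^-1 * (cluster_count N j m r (X alpha))%:R.

Lemma deviation_ge0 alpha : 0 <= deviation alpha.
Proof.
have n0 : 0 <= n by []. have s0 : 0 <= s by [].
apply: addr_ge0; [apply: addr_ge0|].
- apply: mulr_ge0; first by rewrite invr_ge0 exprn_ge0.
  by apply: mulr_ge0 => //; exact: sqr_ge0.
- by rewrite !mulr_ge0 ?invr_ge0 ?exprn_ge0.
- by rewrite mulr_ge0 ?invr_ge0 ?exprn_ge0.
Qed.

Lemma bounded_measurable_deviation : bounded_measurable deviation.
Proof.
have bc (r : R) := @bounded_measurable_cst R r.
apply: bounded_measurableD; first apply: bounded_measurableD.
- apply: bounded_measurableM => //; exact: bounded_measurable_regular.
- apply: bounded_measurableM => //.
  apply: (@bounded_measurable_iota R a M N (fun w => (unspread_count N j r w)%:R)).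
  move=> w w' ww'; congr (_%:R); apply: eq_big_seq => x xN.
  by apply: eq_big_seq => y yN; rewrite /nearby !ww'.
- apply: bounded_measurableM => //; exact: bounded_measurable_cluster.
Qed.

Lemma mean_deviation :
  mean z deviation <= (variance_const + pair_const + cluster_const) / s ^+ 2.
Proof.
have bc (r : R) := @bounded_measurable_cst R r.
have b1 := bounded_measurable_regular a M N j m r L.
have b3 := bounded_measurable_cluster a M N j m r.
have b2 : bounded_measurable (fun alpha => (unspread_count N j r (X alpha))%:R : R).
  apply: (@bounded_measurable_iota R a M N (fun w => (unspread_count N j r w)%:R)).
  move=> w w' ww'; congr (_%:R); apply: eq_big_seq => x xN.
  by apply: eq_big_seq => y yN; rewrite /nearby !ww'.
rewrite /deviation meanD; last 2 first.
- by apply: bounded_measurableD; apply: bounded_measurableM.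
- exact: bounded_measurableM.
rewrite meanD; last 2 first.
- exact: bounded_measurableM.
- exact: bounded_measurableM.
rewrite !meanZ// [leRHS]mulrDl [X in _ <= X + _]mulrDl.
apply: lerD; first apply: lerD.
- exact: mean_regular_scaled.
- by have := mean_unspread_scaled; rewrite !mulrA.
- by rewrite mulrC; exact: mean_cluster_scaled2.
Qed.

(** A value below 1 forces regularity. The three errors arise in passing from distinct tuples to
    spread ones, from their count to its decoupled expectation, and from [spread_total] to N^k, the
    last by Bernoulli's inequality. *)
Lemma chain_count_deviation alpha : deviation alpha < 1 ->
  ((2 * k + 1) * j <= N)%N ->
  `|(chain_count N L (X alpha))%:R / n - \prod_(p <- L) (p.2%:R / n)| <=
  Num.sqrt (deviation alpha) + deviation alpha +
  (3 * C1)%:R ^+ K * (k%:R * (((2 * k + 1) * j)%:R / n)).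
Proof.
set d := ((2 * k + 1) * j)%N => dev1 dN.
have nz : n != 0 by rewrite gt_eqF.
have n0' : 0 <= n := ltW n_gt0; have s0 : 0 <= s := ltW s_gt0.
have P1 : 0 <= n ^- 2 * ((regular' alpha)%:R * centred' alpha ^+ 2).
  apply: mulr_ge0; first by rewrite invr_ge0 exprn_ge0.
  by apply: mulr_ge0 => //; exact: sqr_ge0.
have P2 : 0 <= n^-1 * (k ^ 2)%:R * n0%:R ^+ k * (unspread_count N j r (X alpha))%:R.
  by rewrite !mulr_ge0 ?invr_ge0 ?exprn_ge0.
have P3 : 0 <= (s ^+ m)^-1 * (cluster_count N j m r (X alpha))%:R.
  by rewrite mulr_ge0 ?invr_ge0 ?exprn_ge0.
have reg : regular' alpha.
  rewrite /regular -(ltr_nat R) natrX -[ltRHS]mulr1 -ltr_pdivrMl ?exprn_gt0//.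
  by apply: le_lt_trans dev1; rewrite /deviation; lra.
have /andP[mu0 mule] := chain_prob_scaled.
have hE := chain_count_le j0 L0 LW rE reg; have hS := spread_chain_count_le N L j0 (X alpha).
have /andP[T1 T2] := spread_total_bounds N j L.
rewrite LK in hE T1 T2; rewrite -/d in T1.
have -> : \prod_(p <- L) (p.2%:R / n) = mu * n ^+ K.
  rewrite /chain_prob -LK; elim: L => [|p L' IH]; first by rewrite !big_nil mul1r.
  by rewrite !big_cons IH /= exprS natrX; field; rewrite nz.
set E := (chain_count N L (X alpha))%:R.
set S := (spread_chain_count N j L (X alpha))%:R : R.
set T := (spread_total N j L)%:R : R.
have ES : 0 <= E / n - S / n <= deviation alpha.
  rewrite -mulrBl divr_ge0//=; last by rewrite subr_ge0 ler_nat.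
  have : E - S <= (k ^ 2)%:R * n0%:R ^+ k * (unspread_count N j r (X alpha))%:R.
    rewrite lerBlDl -natrX -!natrM -natrD ler_nat; apply: leq_trans hE _.
    by rewrite leq_add2l mulnAC.
  move=> h; have {}h : (E - S) / n <=
    n^-1 * (k ^ 2)%:R * n0%:R ^+ k * (unspread_count N j r (X alpha))%:R.
    by rewrite mulrC -!mulrA ler_wpM2l ?invr_ge0// mulrA.
  by apply: le_trans h _; rewrite /deviation; lra.
have ST : `|S / n - mu * T / n| <= Num.sqrt (deviation alpha).
  rewrite -mulrBl -sqrtr_sqr ler_wsqrtr//.
  rewrite exprMn exprVn mulrC; move: P1; rewrite reg mul1r => P1.
  by rewrite /deviation reg mul1r /centred -/S -/T; lra.
have TN : 0 <= mu * n ^+ K - mu * T / n <=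
    (3 * C1)%:R ^+ K * (k%:R * (d%:R / n)).
  have nk : mu * n ^+ K = mu * n ^+ k / n.
    by rewrite exprS; field; rewrite nz.
  rewrite nk -mulrBl -mulrBr; apply/andP; split.
    by rewrite divr_ge0// mulr_ge0// subr_ge0 -natrX ler_nat.
  have dn : 0 <= d%:R / n <= 1.
    by rewrite divr_ge0//= ler_pdivrMr// mul1r ler_nat.
  have Tn : n ^+ k - T <= n ^+ k * (k%:R * (d%:R / n)).
    have : (n - d%:R) ^+ k <= T by rewrite -natrB// -natrX ler_nat.
    have := bernoulli_le k dn.
    have -> : n - d%:R = n * (1 - d%:R / n) by field.
    rewrite exprMn; have : 0 <= n ^+ k by exact: exprn_ge0.
    move: (n ^+ k) (_ ^+ k) (k%:R * _) => u v w; nra.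
  apply: (@le_trans _ _ (((3 * C1)%:R / n) ^+ K * (n ^+ k * (k%:R * (d%:R / n))) / n)).
    rewrite ler_wpM2r ?invr_ge0// ler_pM//.
    by rewrite subr_ge0 -natrX ler_nat.
  rewrite le_eqVlt; apply/orP; left; apply/eqP.
  by rewrite exprMn exprVn exprS; field; rewrite nz expf_neq0.
rewrite (_ : _ - _ = (E / n - S / n) + (S / n - mu * T / n) - (mu * n ^+ K - mu * T / n));
  last by ring.
move: ES ST TN; rewrite ler_norml => /andP[? ?] /andP[? ?] /andP[? ?].
have := sqrtr_ge0 (deviation alpha).
by rewrite ler_norml => ?; apply/andP; split; lra.
Qed.

End Fixed.
End AlongPowers.

Lemma cvg_epsP {R : realType} (u : nat -> R) (l : R) :
  u j @[j --> \oo] --> l <->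
  forall e : R, 0 < e -> exists n, forall j, (n <= j)%N -> `|u j - l| <= e.
Proof.
split=> [/cvgrPdist_le ul e /ul [n _ H]|H].
  by exists n => j nj; rewrite distrC; exact: H.
apply/cvgrPdist_le => e /H[n Hn]; exists n => // j nj.
by rewrite distrC; exact: Hn.
Qed.

Lemma ae_mono {R : realType} (P Q : R -> Prop) : (forall x, P x -> Q x) ->
  {ae @lebesgue_measure R, forall x, P x} ->
  {ae @lebesgue_measure R, forall x, Q x}.
Proof.
move=> PQ [A [mA A0 PA]]; exists A; split=> // x /= nQ.
by apply: PA => /= Px; apply: nQ; exact: PQ.
Qed.

Section ChainCountConvergence.
Context {R : realType}.
Variables (a : nat -> R) (c z : R).
Hypothesis a_pos : forall n, (1 <= n)%N -> 0 < a n.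
Hypothesis c1 : 1 < c.
Hypothesis a_lac : forall n, (1 <= n)%N -> c * a n <= a n.+1.
Variables (K C1 : nat) (L : nat -> seq (int * nat)).
Hypothesis K0 : (0 < K)%N.
Hypothesis C10 : (0 < C1)%N.
Hypothesis LK : forall j, size (L j) = K.
Hypothesis LW : forall j, windows_in (C1 * scale K j) (L j).
Local Notation N j := (scale K j).

Lemma chain_count_cvg :
  {ae @lebesgue_measure R, forall alpha, z <= alpha < z + 1 ->
    (chain_count (N j) (L j) (digit a (N j ^ 2) alpha))%:R / (N j)%:R -
      \prod_(p <- L j) (p.2%:R / (N j)%:R) @[j --> \oo] --> (0 : R)}.
Proof.
pose k := K.+1; pose m := moment_order K; pose p := scale_exp K.
pose A : R := ((k + k)%:R ^+ 2 + m%:R ^+ 2) * decoupling_const a c.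
(* The exponent is that of N^(k+k+m) * N^2, written as a power of j. *)
have [j1 H1] := poly_geometric_small A (p * (k + k + m) + p * 2) c1.
have [j2 H2] := poly_geometric_small 1 (p * 2) c1.
have jN j : (0 < j)%N -> (j * j <= N j)%N.
  by move=> j0; rewrite /scale /scale_exp mulnn leq_pexp2l// addnC.
have jN1 j : (0 < j)%N -> (j <= N j)%N.
  by move=> j0; apply: leq_trans (jN j j0); rewrite leq_pmulr.
pose j3 := (j1 + j2 + 5 * K * C1 + (2 * k + 1) + 1)%N.
have j3P j : (j3 <= j)%N -> [/\ (0 < j)%N, (5 * K * C1 <= N j)%N,
    (N j)%:R ^+ (k + k + m) * ((k + k)%:R ^+ 2 + m%:R ^+ 2) *
      (decoupling_const a c * (N j ^ 2)%:R * c ^- j) <= 1,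
    (N j ^ 2)%:R * c ^- j <= 1 & ((2 * k + 1) * j <= N j)%N].
  rewrite /j3 => j3j; have j0 : (0 < j)%N by lia.
  split => //.
  - by apply: leq_trans (jN1 _ j0); lia.
  - have := H1 j; rewrite (_ : (j1 <= j)%N); last by lia.
    move=> /(_ isT); apply: le_trans; rewrite le_eqVlt; apply/orP; left; apply/eqP.
    by rewrite /A /scale !natrX -!exprM -/p exprD; ring.
  - have := H2 j; rewrite (_ : (j2 <= j)%N); last by lia.
    by move=> /(_ isT); rewrite mul1r /scale natrX natrX -exprM.
  - by apply: leq_trans (jN _ j0); rewrite leq_mul2r; apply/orP; right; lia.
pose h j alpha : R := deviation a K C1 j (L j) alpha.
have hcvg : {ae @lebesgue_measure R, forall alpha, z <= alpha < z + 1 ->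
    h j alpha @[j --> \oo] --> (0 : R)}.
  apply: (@ae_cvg0_mean R z h (variance_const K C1 + pair_const a c K C1
    + cluster_const K C1) j3) => //.
  - by rewrite /j3 addn1.
  - by move=> j; exact: bounded_measurable_deviation.
  - by move=> j alpha; exact: deviation_ge0.
  - move=> j /j3P[j0 DN errN Mcj _]; apply: mean_deviation => //; exact: LW.
apply: (ae_mono _ hcvg) => alpha halpha az.
have {}halpha := halpha az.
pose B : R := (3 * C1)%:R ^+ K * (k%:R * (2 * k + 1)%:R).
have B0 : 0 <= B by rewrite /B !mulr_ge0 ?exprn_ge0.
apply/cvg_epsP => e e0; have e3 : 0 < e / 3 by lra.
have /cvg_epsP Hh := halpha.
have [n1 Hn1] := Hh _ e3.
have [n2 Hn2] := Hh _ (exprn_gt0 2 e3).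
have [n3 Hn3] := Hh (1 / 2) ltac:(lra).
exists (n1 + n2 + n3 + j3 + (Num.truncn (B / (e / 3))).+1)%N => j nj.
have /j3P[j0 DN errN Mcj dN] : (j3 <= j)%N by lia.
have := Hn1 j ltac:(lia); have := Hn2 j ltac:(lia); have := Hn3 j ltac:(lia).
have h0 : 0 <= h j alpha by exact: deviation_ge0.
rewrite !subr0 ger0_norm// => h3 h2 h1.
have h1' : h j alpha < 1 by lra.
have dev := chain_count_deviation c1 K0 C10 (LK j) (LW j) j0 DN errN Mcj h1' dN.
apply: le_trans dev _; rewrite -/(h j alpha).
have hs : Num.sqrt (h j alpha) <= e / 3.
  by rewrite -[leRHS]ger0_norm ?(ltW e3)// -sqrtr_sqr ler_wsqrtr.
have Bj : B / j%:R <= e / 3.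
  have j0' : 0 < j%:R :> R by rewrite ltr0n.
  rewrite ler_pdivrMr// mulrC -ler_pdivrMr//.
  apply/ltW/(lt_le_trans (truncnS_gt _)); rewrite ler_nat.
  exact: leq_trans (leq_addl _ _) nj.
(* j^2 <= N turns j / N into at most 1 / j. *)
have jj : ((2 * k + 1) * j)%:R / (N j)%:R <= (2 * k + 1)%:R / j%:R :> R.
  have j0' : 0 < j%:R :> R by rewrite ltr0n.
  have N0 : 0 < (N j)%:R :> R by rewrite ltr0n (leq_trans j0)// jN1.
  rewrite ler_pdivrMr// mulrAC ler_pdivlMr// -!natrM ler_nat -mulnA.
  by rewrite leq_mul2l jN ?orbT.
have : (3 * C1)%:R ^+ K * (k%:R * (((2 * k + 1) * j)%:R / (N j)%:R)) <= B / j%:R :> R.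
  by rewrite /B -!mulrA ler_wpM2l ?exprn_ge0// ler_wpM2l.
move=> /le_trans/(_ Bj) X3; apply: le_trans (lerD (lerD hs h1) X3) _; lra.
Qed.

End ChainCountConvergence.

(** * Box counts *)

Section Boxes.
Context {R : realType}.
Implicit Types (b : nat -> R) (lu : seq (rat * rat)).

(** The representative of t modulo 1 in [-1/2, 1/2): for large N, no other integer translate can
    reach the support of the test function. *)
Definition centred_frac (t : R) : R := t - (Num.floor (t + 2^-1))%:~R.

Lemma centred_frac_unique t (q : int) : `|t - q%:~R| < 2^-1 ->
  centred_frac t = t - q%:~R.
Proof.
rewrite ltr_norml => /andP[h1 h2]; congr (_ - _%:~R); apply: floor_def.
by rewrite intrD; apply/andP; split; lra.
Qed.

Fixpoint box_chain (n : R) lu (x : seq nat) b : bool :=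
  match lu, x with
  | p :: lu', y :: ((y' :: _) as t) =>
      (ratr p.1 <= n * centred_frac (b y - b y') < ratr p.2) &&
      box_chain n lu' t b
  | _, _ => true
  end.

Definition box_count (N : nat) lu b : nat :=
  count (fun x => uniq x && box_chain N%:R lu x b) (seqs N (size lu).+1).

Definition box_volume lu : R := \prod_(p <- lu) (ratr p.2 - ratr p.1).

(* Rounding to digits moves a difference by less than one unit, so the windows
   are widened, resp. shrunk, by that amount. *)
Definition outer_windows (N : nat) lu : seq (int * nat) :=
  [seq (Num.floor (N%:R * ratr p.1 : R),
        `|(Num.floor (N%:R * ratr p.2 : R) - Num.floor (N%:R * ratr p.1 : R) + 2)%R|%N)
  | p <- lu].

Definition inner_windows (N : nat) lu : seq (int * nat) :=
  [seq (Num.floor (N%:R * ratr p.1 : R) + 2,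
        `|(Num.floor (N%:R * ratr p.2 : R) - Num.floor (N%:R * ratr p.1 : R) - 2)%R|%N)
  | p <- lu].

Section Sandwich.
Variables (a : nat -> R) (alpha : R) (N : nat).
Hypothesis N1 : (1 < N)%N.
Local Notation M := (N ^ 2)%N.
Local Notation X := (digit a M alpha).
Local Notation b := (fun n => alpha * a n).

Let M1 : (1 < M)%N. Proof. by rewrite -[1%N]/(1 ^ 2)%N ltn_exp2r. Qed.
Let N0 : 0 < N%:R :> R. Proof. by rewrite ltr0n ltnW. Qed.

(** A second factor N passes to units of digits, where integer translates become multiples of M. *)
Let scaled_diff x y (q : int) :
  N%:R * (N%:R * ((b x - b y) - q%:~R)) =
  M%:R * b x - M%:R * b y - q%:~R * M%:R.
Proof. by rewrite natrX; ring. Qed.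

(** The witness fx - fy - q * M differs by less than 1 from M times the reduced difference, since
    the two rounding errors lie in [0, 1). *)
Lemma box_chain_outer lu x : all (fun p => p.1 < p.2) lu ->
  box_chain N%:R lu x b -> chain (outer_windows N lu) x X.
Proof.
elim: lu x => [|p lu IH] [|y [|y' t]]//= /andP[plt lult] /andP[bx /(IH _ lult) ->].
rewrite andbT; apply/in_windowP.
set q := Num.floor (b y - b y' + 2^-1).
set fl := Num.floor (N%:R * ratr p.1 : R); set fu := Num.floor (N%:R * ratr p.2 : R).
set fx := Num.floor (M%:R * b y); set fy := Num.floor (M%:R * b y').
exists (fx - fy - q * M%:Z); last first.
  by rewrite /digit !intrB intrM -[M%:Z%:~R]pmulrn pchar_Zp// mulr0 subr0.
move: bx; rewrite /centred_frac -/q -(ler_pM2l N0) -[X in _ && X](ltr_pM2l N0).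
rewrite scaled_diff => /andP[bl bu].
have /andP[x1 x2] := floor_itv (M%:R * b y); rewrite -/fx intrD in x1 x2.
have /andP[y1 y2] := floor_itv (M%:R * b y'); rewrite -/fy intrD in y1 y2.
have /andP[l1 l2] := floor_itv (N%:R * ratr p.1 : R); rewrite -/fl intrD in l1 l2.
have /andP[u1 u2] := floor_itv (N%:R * ratr p.2 : R); rewrite -/fu intrD in u1 u2.
have flu : fl <= fu by rewrite /fl /fu le_floor// ler_pM2l// ler_rat ltW.
have eE : (fx - fy - q * M%:Z)%:~R = fx%:~R - fy%:~R - q%:~R * M%:R :> R.
  by rewrite !intrB intrM.
have e1 : fl - 1 < fx - fy - q * M%:Z by rewrite -(ltr_int R) eE intrB; lra.
have e2 : fx - fy - q * M%:Z < fu + 2 by rewrite -(ltr_int R) eE intrD; lra.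
by clear -flu e1 e2; lia.
Qed.

(** The bounds by N / 2 make [q] the nearest integer to the difference, so that [centred_frac]
    subtracts exactly [q]. *)
Lemma inner_box_chain lu x :
  all (fun p => [&& `|ratr p.1| <= N%:R / 2 :> R, `|ratr p.2| <= N%:R / 2 :> R &
    Num.floor (N%:R * ratr p.1 : R) + 2 <= Num.floor (N%:R * ratr p.2 : R)]) lu ->
  chain (inner_windows N lu) x X -> box_chain N%:R lu x b.
Proof.
elim: lu x => [|p lu IH] [|y [|y' t]]//= /andP[/and3P[bl bu flu] lult].
move=> /andP[/in_windowP[e e12 xe] /(IH _ lult) ->]; rewrite andbT.
move: flu e12; set fl := Num.floor (N%:R * ratr p.1 : R).
set fu := Num.floor (N%:R * ratr p.2 : R) => flu e12.
have {e12}[e1 e2] : fl + 2 <= e /\ e + 1 <= fu by clear -flu e12; lia.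
move: xe; rewrite /digit => /eqP; rewrite -subr_eq0 -!intrB => /eqP/(Zp_int_eq0 M1)[q].
set fx := Num.floor (M%:R * b y); set fy := Num.floor (M%:R * b y') => fq.
have /andP[x1 x2] := floor_itv (M%:R * b y); rewrite -/fx intrD in x1 x2.
have /andP[y1 y2] := floor_itv (M%:R * b y'); rewrite -/fy intrD in y1 y2.
have /andP[l1 l2] := floor_itv (N%:R * ratr p.1 : R); rewrite -/fl intrD in l1 l2.
have /andP[u1 u2] := floor_itv (N%:R * ratr p.2 : R); rewrite -/fu intrD in u1 u2.
have eE : fx%:~R - fy%:~R - e%:~R = q%:~R * M%:R :> R by rewrite -!intrB fq intrM.
have {}e1 : fl%:~R + 2 <= e%:~R :> R by move: e1; rewrite -(ler_int R) intrD.
have {}e2 : e%:~R + 1 <= fu%:~R :> R by move: e2; rewrite -(ler_int R) intrD.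
have vl : ratr p.1 < N%:R * ((b y - b y') - q%:~R).
  by rewrite -(ltr_pM2l N0) scaled_diff; lra.
have vu : N%:R * ((b y - b y') - q%:~R) < ratr p.2.
  by rewrite -(ltr_pM2l N0) scaled_diff; lra.
rewrite (@centred_frac_unique _ q) ?(ltW vl)//.
rewrite -(ltr_pM2l N0) -[X in X * `|_|](gtr0_norm N0) -normrM ltr_norml.
by move: bl bu; rewrite !ler_norml => /andP[? ?] /andP[? ?]; apply/andP; split; lra.
Qed.

End Sandwich.

Lemma prod_cvg (T : eqType) (s : seq T) (v : T -> nat -> R) (V : T -> R) :
  (forall p, p \in s -> v p j @[j --> \oo] --> V p) ->
  \prod_(p <- s) v p j @[j --> \oo] --> \prod_(p <- s) V p.
Proof.
elim: s => [|p s IH] vV.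
  by under eq_fun do rewrite big_nil; rewrite big_nil; exact: cvg_cst.
under eq_fun do rewrite big_cons; rewrite big_cons; apply: cvgM.
  by apply: vV; rewrite mem_head.
by apply: IH => q qs; apply: vV; rewrite inE qs orbT.
Qed.

Lemma scale_ge K j : (j <= scale K j)%N.
Proof.
case: j => // j; rewrite /scale /scale_exp -{1}(expn1 j.+1) leq_pexp2l//.
by rewrite addn4.
Qed.

(** The numerator is N (u - l) up to a bounded error, and the absolute value has no effect once N is
    large. *)
Lemma floor_diff_cvg (l u : R) (e : int) K : l < u ->
  `|(Num.floor ((scale K j)%:R * u) - Num.floor ((scale K j)%:R * l) + e)%R|%N%:R
    / (scale K j)%:R @[j --> \oo] --> u - l.
Proof.
move=> lu; apply/cvg_epsP => d d0.
pose E : R := `|e|%N%:R.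
exists ((Num.truncn ((E + 1) / d)).+1 + (Num.truncn ((E + 1) / (u - l))).+1)%N => j nj.
set N := scale K j.
have jR : j%:R <= N%:R :> R by rewrite ler_nat scale_ge.
have j1 : (E + 1) / d < N%:R.
  apply: lt_le_trans jR; apply: lt_le_trans (truncnS_gt _) _.
  by rewrite ler_nat; exact: leq_trans (leq_addr _ _) nj.
have j2 : (E + 1) / (u - l) < N%:R.
  apply: lt_le_trans jR; apply: lt_le_trans (truncnS_gt _) _.
  by rewrite ler_nat; exact: leq_trans (leq_addl _ _) nj.
have E0 : 0 <= E by [].
have N0 : 0 < N%:R :> R by apply: le_lt_trans j1; rewrite divr_ge0 ?addr_ge0// ltW.
rewrite ltr_pdivrMr// in j1; rewrite ltr_pdivrMr ?subr_gt0// in j2.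
have eE : `|e%:~R| = E :> R by rewrite -intr_norm /E -abszE.
have := ler_norm (e%:~R : R); have := ler_norm (- e%:~R : R).
rewrite normrN eE => e1 e2.
have /andP[l1 l2] := floor_itv (N%:R * l); rewrite intrD in l2.
have /andP[u1 u2] := floor_itv (N%:R * u); rewrite intrD in u2.
set w := Num.floor (N%:R * u) - _ + e.
have wE : w%:~R = (Num.floor (N%:R * u))%:~R - (Num.floor (N%:R * l))%:~R + e%:~R :> R.
  by rewrite /w intrD intrB.
have w0 : 0 <= w.
  rewrite -ltzD1 -(ltr_int R) intrD wE /=.
  by move: j2; rewrite mulrBr; lra.
have -> : `|w|%N%:R = w%:~R :> R.
  by rewrite pmulrn -[in RHS](gez0_abs w0).
rewrite wE -(ler_pM2l N0) -[X in X * `|_|](gtr0_norm N0) -normrM.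
rewrite mulrBr mulrCA divff ?gt_eqF// mulr1 ler_norml mulrBr.
by apply/andP; split; lra.
Qed.

Lemma windows_in_default W K : windows_in W (nseq K (0, 0%N)).
Proof. by apply/allP => p /nseqP[-> _] /=; lia. Qed.

Lemma box_bound lu : exists B : nat,
  all (fun p => (`|ratr p.1| <= B%:R :> R) && (`|ratr p.2| <= B%:R :> R)) lu.
Proof.
elim: lu => [|p lu [B HB]]; first by exists 0%N.
exists (B + (Num.truncn `|ratr p.1 : R|).+1 + (Num.truncn `|ratr p.2 : R|).+1)%N => /=.
rewrite (ltW (lt_le_trans (truncnS_gt _) _)) ?ler_nat ?(leq_trans (leq_addl _ _) (leq_addr _ _))//=.
rewrite (ltW (lt_le_trans (truncnS_gt _) _)) ?ler_nat ?leq_addl//=.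
apply: sub_all HB => q /andP[q1 q2]; apply/andP; split.
  by apply: le_trans q1 _; rewrite ler_nat -addnA leq_addr.
by apply: le_trans q2 _; rewrite ler_nat -addnA leq_addr.
Qed.

Lemma floor_norm_le (N B : nat) (x : R) : `|x| <= B%:R ->
  - (N * B)%:Z - 1 <= Num.floor (N%:R * x) <= (N * B)%:Z.
Proof.
rewrite ler_norml => /andP[x1 x2]; have /andP[f1 f2] := floor_itv (N%:R * x).
have N0 : 0 <= N%:R :> R by [].
have h1 : N%:R * - B%:R <= N%:R * x by exact: ler_wpM2l.
have h2 : N%:R * x <= N%:R * B%:R by exact: ler_wpM2l.
apply/andP; split; last first.
  by rewrite -(ler_int R) -pmulrn natrM; lra.
rewrite lerBlDr -(ler_int R) intrN -pmulrn natrM; lra.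
Qed.

(** The surplus 5 * N absorbs the floors and the widening by 2; in the inner case also the absolute
    value of a negative length. *)
Lemma windows_in_outer N B lu : (0 < N)%N -> all (fun p => p.1 < p.2) lu ->
  all (fun p => (`|ratr p.1| <= B%:R :> R) && (`|ratr p.2| <= B%:R :> R)) lu ->
  windows_in ((B + 5) * N) (outer_windows N lu).
Proof.
move=> N0 /allP lt /allP bd; rewrite /windows_in all_map; apply/allP => p plu /=.
have /andP[/(floor_norm_le N)/andP[l1 l2] /(floor_norm_le N)/andP[u1 u2]] := bd p plu.
have : Num.floor (N%:R * ratr p.1 : R) <= Num.floor (N%:R * ratr p.2 : R).
  by apply: le_floor; rewrite ler_pM2l ?ltr0n// ler_rat ltW// lt.
rewrite mulnDl (mulnC B N).
move: (Num.floor _) (Num.floor _) (N * B)%N l1 l2 u1 u2 => f g n; lia.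
Qed.

Lemma windows_in_inner N B lu : (0 < N)%N -> all (fun p => p.1 < p.2) lu ->
  all (fun p => (`|ratr p.1| <= B%:R :> R) && (`|ratr p.2| <= B%:R :> R)) lu ->
  windows_in ((B + 5) * N) (inner_windows N lu).
Proof.
move=> N0 /allP lt /allP bd; rewrite /windows_in all_map; apply/allP => p plu /=.
have /andP[/(floor_norm_le N)/andP[l1 l2] /(floor_norm_le N)/andP[u1 u2]] := bd p plu.
have : Num.floor (N%:R * ratr p.1 : R) <= Num.floor (N%:R * ratr p.2 : R).
  by apply: le_floor; rewrite ler_pM2l ?ltr0n// ler_rat ltW// lt.
rewrite mulnDl (mulnC B N).
move: (Num.floor _) (Num.floor _) (N * B)%N l1 l2 u1 u2 => f g n; lia.
Qed.

Lemma count_sum (T : Type) (P : pred T) s : count P s = (\sum_(x <- s) P x)%N.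
Proof. by rewrite -sum1_count big_mkcond; apply: eq_bigr => y _; case: (P y). Qed.

Lemma box_countE N lu b : box_count N lu b =
  (\sum_(x <- seqs N (size lu).+1 | uniq x) box_chain N%:R lu x b)%N.
Proof.
by rewrite /box_count count_sum [RHS]big_mkcond; apply: eq_bigr => x _; case: (uniq x).
Qed.

(** Once N (u - l) exceeds 3, the two floors leave room for the shift by 2 of the inner windows. *)
Lemma floor_gap lu : all (fun p => p.1 < p.2) lu ->
  exists n, forall N, (n <= N)%N -> all (fun p =>
    Num.floor (N%:R * ratr p.1 : R) + 2 <= Num.floor (N%:R * ratr p.2 : R)) lu.
Proof.
elim: lu => [|p lu IH] /=; first by exists 0%N.
move=> /andP[plt /IH[n Hn]].
exists (n + (Num.truncn (3 / (ratr p.2 - ratr p.1 : R))).+1)%N => N nN.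
apply/andP; split; last by apply: Hn; apply: leq_trans nN; exact: leq_addr.
have : 3 / (ratr p.2 - ratr p.1) < N%:R :> R.
  apply: lt_le_trans (truncnS_gt _) _; rewrite ler_nat.
  by apply: leq_trans nN; exact: leq_addl.
rewrite ltr_pdivrMr ?subr_gt0 ?ltr_rat// mulrBr => h.
have /andP[l1 l2] := floor_itv (N%:R * ratr p.1 : R); rewrite intrD in l2.
have /andP[u1 u2] := floor_itv (N%:R * ratr p.2 : R); rewrite intrD in u2.
rewrite -ltzD1 -(ltr_int R) !intrD /=; lra.
Qed.

Variables (a : nat -> R) (c z : R).
Hypothesis a_pos : forall n, (1 <= n)%N -> 0 < a n.
Hypothesis c1 : 1 < c.
Hypothesis a_lac : forall n, (1 <= n)%N -> c * a n <= a n.+1.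

(** Squeeze between the chain counts of the inner and of the outer windows, whose normalised volumes
    have the same limit. *)
Lemma box_count_scale_cvg lu : lu != [::] -> all (fun p => p.1 < p.2) lu ->
  {ae @lebesgue_measure R, forall alpha, z <= alpha < z + 1 ->
    (box_count (scale (size lu) j) lu (fun n => alpha * a n))%:R /
      (scale (size lu) j)%:R @[j --> \oo] --> box_volume lu}.
Proof.
move=> lu0 lult; have K0 : (0 < size lu)%N by case: lu lu0 {lult}.
set K := size lu in K0 *; have [B bd] := box_bound lu.
(* At j = 0 the scale is 0 and [windows_in] fails for the true windows; windows of length 0 stand
   in. *)
pose Lo j := if (0 < j)%N then outer_windows (scale K j) lu else nseq K (0, 0%N).
pose Li j := if (0 < j)%N then inner_windows (scale K j) lu else nseq K (0, 0%N).
have sLo j : size (Lo j) = K by rewrite /Lo; case: ifP; rewrite ?size_map ?size_nseq.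
have sLi j : size (Li j) = K by rewrite /Li; case: ifP; rewrite ?size_map ?size_nseq.
have N0 j : (0 < j)%N -> (0 < scale K j)%N by move=> j0; rewrite expn_gt0 j0.
have wLo j : windows_in ((B + 5) * scale K j) (Lo j).
  rewrite /Lo; case: ifP => [j0|_]; last exact: windows_in_default.
  by apply: windows_in_outer => //; exact: N0.
have wLi j : windows_in ((B + 5) * scale K j) (Li j).
  rewrite /Li; case: ifP => [j0|_]; last exact: windows_in_default.
  by apply: windows_in_inner => //; exact: N0.
have B5 : (0 < B + 5)%N by rewrite addn_gt0 orbT.
have Ho := chain_count_cvg z a_pos c1 a_lac K0 B5 sLo wLo.
have Hi := chain_count_cvg z a_pos c1 a_lac K0 B5 sLi wLi.
have vol (L : nat -> seq (int * nat)) (f : nat -> rat * rat -> int) (e : int) :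
    (forall j, (0 < j)%N -> L j = [seq (f j p,
      `|(Num.floor ((scale K j)%:R * ratr p.2 : R) -
         Num.floor ((scale K j)%:R * ratr p.1 : R) + e)%R|%N) | p <- lu]) ->
    \prod_(p <- L j) (p.2%:R / (scale K j)%:R) @[j --> \oo] --> box_volume lu.
  move=> LE; rewrite -(cvg_shiftn 1) /=.
  under eq_fun do rewrite LE ?addn1// big_map /=.
  apply: (@prod_cvg _ lu (fun p n => `|(Num.floor ((scale K n.+1)%:R * ratr p.2 : R) -
         Num.floor ((scale K n.+1)%:R * ratr p.1 : R) + e)%R|%N%:R / (scale K n.+1)%:R)
    (fun p => ratr p.2 - ratr p.1)) => p plu.
  have := @floor_diff_cvg (ratr p.1) (ratr p.2) e K.
  rewrite ltr_rat (allP lult)// => /(_ isT); rewrite -(cvg_shiftn 1) /=.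
  by under eq_fun do rewrite addn1.
have volo : \prod_(p <- Lo j) (p.2%:R / (scale K j)%:R) @[j --> \oo] --> box_volume lu.
  by apply: (vol _ (fun j p => Num.floor ((scale K j)%:R * ratr p.1 : R)) 2) => j j0; rewrite /Lo j0 /outer_windows.
have voli : \prod_(p <- Li j) (p.2%:R / (scale K j)%:R) @[j --> \oo] --> box_volume lu.
  by apply: (vol _ (fun j p => Num.floor ((scale K j)%:R * ratr p.1 : R) + 2) (- 2)) => j j0; rewrite /Li j0 /inner_windows.
have HH : {ae @lebesgue_measure R, forall alpha, z <= alpha < z + 1 ->
    ((chain_count (scale K j) (Lo j) (digit a (scale K j ^ 2) alpha))%:R / (scale K j)%:R -
      \prod_(p <- Lo j) (p.2%:R / (scale K j)%:R) @[j --> \oo] --> (0 : R)) /\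
    ((chain_count (scale K j) (Li j) (digit a (scale K j ^ 2) alpha))%:R / (scale K j)%:R -
      \prod_(p <- Li j) (p.2%:R / (scale K j)%:R) @[j --> \oo] --> (0 : R))}.
  move: Ho Hi => [A [mA A0 PA]] [A' [mA' A'0 PA']].
  exists (A `|` A'); split; first exact: measurableU.
    by apply: null_set_setU.
  move=> x /= nx; apply: contrapT => /not_orP[Ax A'x]; apply: nx => xz.
  split; [apply: contrapT => h; apply: Ax; apply: PA|
          apply: contrapT => h; apply: A'x; apply: PA'] => /= H; apply: h; exact: H.
apply: (ae_mono _ HH) => alpha H az; have {H HH Ho Hi}[Ho Hi] := H az.
have {}Ho := cvgD Ho volo; have {}Hi := cvgD Hi voli.
rewrite add0r in Ho; rewrite add0r in Hi.
have [n1 gap] := floor_gap lult.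
apply: squeeze_cvgr; [|exact: Hi|exact: Ho]; exists (n1 + 2 * B + 2)%N => // j /= nj.
have jN := scale_ge K j.
have j0 : (0 < j)%N by clear -nj; lia.
have N2 : (1 < scale K j)%N by clear -nj jN; lia.
rewrite !subrK; apply/andP; split.
  rewrite ler_wpM2r// ler_nat box_countE /chain_count sLi; apply: leq_sum => x ux.
  rewrite /Li j0; have [ch|//] := boolP (chain _ x _).
  rewrite (inner_box_chain N2 _ ch)//; apply/allP => p plu.
  have /andP[b1 b2] := allP bd p plu.
  have BN : B%:R <= (scale K j)%:R / 2 :> R.
    by rewrite ler_pdivlMr// -natrM ler_nat; clear -nj jN; lia.
  rewrite (le_trans b1)// (le_trans b2)//=; apply: (allP (gap _ _)) => //; clear -nj jN; lia.
rewrite ler_wpM2r// ler_nat box_countE /chain_count sLo; apply: leq_sum => x ux.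
rewrite /Lo j0; have [ch|//] := boolP (box_chain _ lu x _).
by rewrite (box_chain_outer N2 lult ch).
Qed.

End Boxes.

(** * From the powers to all N *)

Section Interpolation.
Context {R : realType}.
Implicit Types (b : nat -> R) (lu : seq (rat * rat)).

Definition fatten (eta : rat) lu := [seq (p.1 - eta, p.2 + eta) | p <- lu].

Lemma fattenK eta lu : fatten eta (fatten (- eta) lu) = lu.
Proof.
rewrite /fatten -map_comp -[RHS]map_id; apply: eq_map => -[l u] /=.
by rewrite opprK addrK subrK.
Qed.

Definition bounded_by (B : nat) lu :=
  all (fun p => (`|ratr p.1| <= B%:R :> R) && (`|ratr p.2| <= B%:R :> R)) lu.

(** Coordinates in the box are at most [B] in absolute value, so replacing n by rho * n moves them
    by at most |rho - 1| * B. *)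
Lemma box_chain_rescale (n rho : R) (B : nat) (eta : rat) lu x b :
  bounded_by B lu -> 0 < eta -> `|rho - 1| * B%:R <= ratr eta ->
  box_chain n lu x b -> box_chain (rho * n) (fatten eta lu) x b.
Proof.
move=> + eta0 rB; elim: lu x => [|p lu IH] [|y [|y' t]]//=.
move=> /andP[/andP[p1 p2] luB] /andP[/andP[bl bu] /IH -> //]; rewrite andbT.
rewrite -mulrA; move: bl bu; set v := n * _ => bl bu.
have vB : `|v| <= B%:R.
  by move: p1 p2; rewrite !ler_norml => /andP[? ?] /andP[? ?]; apply/andP; split; lra.
have : `|(rho - 1) * v| <= ratr eta.
  by rewrite normrM (le_trans _ rB)// ler_wpM2l.
rewrite ler_norml rmorphB rmorphD /= => /andP[? ?]; apply/andP; split; lra.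
Qed.

Lemma seqs_subset N N' m : (N <= N')%N -> {subset seqs N m <= seqs N' m}.
Proof.
move=> NN' x; rewrite !mem_seqs => /andP[-> /allP xN]; apply/allP => y /xN.
by rewrite /= !mem_iota; lia.
Qed.

Lemma box_count_rescale (N N' B : nat) (eta : rat) lu b :
  (0 < N)%N -> (N <= N')%N -> bounded_by B lu -> 0 < eta ->
  (N'%:R / N%:R - 1) * B%:R <= ratr eta :> R ->
  (box_count N lu b <= box_count N' (fatten eta lu) b)%N.
Proof.
move=> N0 NN' luB eta0 rB; rewrite /box_count size_map -!size_filter.
apply: uniq_leq_size; first by rewrite filter_uniq// uniq_seqs.
have N0' : 0 < N%:R :> R by rewrite ltr0n.
move=> x; rewrite !mem_filter => /andP[/andP[-> bx] /(seqs_subset NN') ->].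
rewrite /= andbT -[N'%:R](divfK (lt0r_neq0 N0')).
apply: (box_chain_rescale luB eta0 _ bx); rewrite ger0_norm//.
by rewrite subr_ge0 ler_pdivlMr// mul1r ler_nat.
Qed.

Lemma scale_le K i j : (i <= j)%N -> (scale K i <= scale K j)%N.
Proof. by move=> ij; rewrite leq_exp2r// /scale_exp addn4. Qed.

Lemma scale_between K N : (0 < N)%N ->
  exists j, [/\ (0 < j)%N, (scale K j <= N)%N & (N < scale K j.+1)%N].
Proof.
move=> N0.
have ex1 : exists j, (scale K j <= N)%N by exists 1%N; rewrite /scale exp1n.
have bd j : (scale K j <= N)%N -> (j <= N)%N by apply: leq_trans; exact: scale_ge.
case: (ex_maxnP ex1 bd) => j jN jmax; exists j; split => //.
  by apply: jmax; rewrite /scale exp1n.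
by rewrite ltnNge; apply/negP => /jmax; rewrite ltnn.
Qed.

Lemma scale_ratio_cvg K :
  (scale K j.+2)%:R / (scale K j.+1)%:R @[j --> \oo] --> (1 : R).
Proof.
rewrite (_ : (fun _ => _) = fun j => (1 + j.+1%:R^-1) ^+ scale_exp K); last first.
  apply/funext => j; rewrite /scale !natrX -exprVn -exprMn -[j.+2%:R]natr1; congr (_ ^+ _).
  by rewrite mulrDl mul1r divff// pnatr_eq0.
have h : (1 + j.+1%:R^-1 : R) @[j --> \oo] --> (1 + 0 : R).
  by apply: cvgD; [exact: cvg_cst|exact: cvg_harmonic].
have := cvg_comp _ _ h (@exprn_continuous R (scale_exp K) (1 + 0)).
by rewrite addr0 expr1n.
Qed.

(** The sign treats fattening and shrinking together. *)
Lemma fatten_volume_cvg (s : bool) lu :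
  @box_volume R (fatten ((-1) ^+ s * i.+1%:R^-1) lu) @[i --> \oo] --> @box_volume R lu.
Proof.
rewrite /box_volume; under eq_fun do rewrite big_map /=.
apply: (@prod_cvg R _ lu (fun p i => ratr (p.2 + (-1) ^+ s * i.+1%:R^-1)
   - ratr (p.1 - (-1) ^+ s * i.+1%:R^-1)) (fun p => ratr p.2 - ratr p.1)) => p _.
rewrite (_ : (fun _ => _) = fun i =>
  (ratr p.2 - ratr p.1) + 2 * (-1) ^+ s * (i.+1%:R : R)^-1); last first.
  apply/funext => i; rewrite rmorphB rmorphD rmorphM fmorphV rmorph_nat /=.
  by rewrite rmorphXn rmorphN1 /=; ring.
have h : (ratr p.2 - ratr p.1) + 2 * (-1) ^+ s * (i.+1%:R : R)^-1 @[i --> \oo] -->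
    ((ratr p.2 - ratr p.1) + 2 * (-1) ^+ s * 0 : R).
  apply: cvgD; first exact: cvg_cst.
  by apply: cvgM; [exact: cvg_cst|exact: cvg_harmonic].
by rewrite mulr0 addr0 in h.
Qed.

Lemma shrink_lt lu : all (fun p => p.1 < p.2) lu ->
  exists n, forall i, (n <= i)%N -> all (fun p => p.1 < p.2) (fatten (- i.+1%:R^-1) lu).
Proof.
elim: lu => [|p lu IH] /=; first by exists 0%N.
move=> /andP[plt /IH[n Hn]].
exists (n + (Num.truncn (2 / (p.2 - p.1))).+1)%N => i ni.
apply/andP; split; last by apply: Hn; apply: leq_trans ni; exact: leq_addr.
have : 2 / (p.2 - p.1) < i.+1%:R.
  apply: lt_le_trans (truncnS_gt _) _; rewrite ler_nat ltnS.
  by apply: leq_trans (leq_trans (leq_addl n _) ni).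
have i0 : 0 < i.+1%:R :> rat by rewrite ltr0n.
rewrite ltr_pdivrMr ?subr_gt0// mulrC -ltr_pdivrMr// opprK.
by move: (i.+1%:R^-1) p.1 p.2 => v x y; lra.
Qed.

(** For consecutive scales A <= N < C the count lies between that of a shrunk box at A and that of a
    fattened box at C; C / A tends to 1 and both volumes are close to V. *)
Lemma box_count_cvg_of_scale b lu : lu != [::] -> all (fun p => p.1 < p.2) lu ->
  (forall lu', lu' != [::] -> all (fun p => p.1 < p.2) lu' ->
    (box_count (scale (size lu') j) lu' b)%:R / (scale (size lu') j)%:R
      @[j --> \oo] --> @box_volume R lu') ->
  (box_count N lu b)%:R / N%:R @[N --> \oo] --> @box_volume R lu.
Proof.
move=> lu0 lult H; apply/cvg_epsP => e e0; set V : R := box_volume lu.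
have e4 : 0 < e / 4 by lra.
have V0 : 0 <= V.
  rewrite /V /box_volume big_seq; apply: prodr_ge0 => p plu.
  by rewrite subr_ge0 ler_rat ltW// (allP lult).
have [i1 Hi1] := (cvg_epsP _ _).1 (@fatten_volume_cvg false lu) _ e4.
have [i2 Hi2] := (cvg_epsP _ _).1 (@fatten_volume_cvg true lu) _ e4.
have [i3 Hi3] := shrink_lt lult.
pose i := (i1 + i2 + i3)%N; pose eta : rat := i.+1%:R^-1.
have eta0 : 0 < eta by rewrite invr_gt0 ltr0n.
have {Hi1}V1 : `|box_volume (fatten eta lu) - V| <= e / 4.
  by have := Hi1 i; rewrite expr0 mul1r; apply; rewrite /i -addnA leq_addr.
have {Hi2}V2 : `|box_volume (fatten (- eta) lu) - V| <= e / 4.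
  by have := Hi2 i; rewrite expr1 mulN1r; apply; rewrite /i addnAC leq_addl.
have lt2 : all (fun p => p.1 < p.2) (fatten (- eta) lu) by apply: Hi3; exact: leq_addl.
have lt1 : all (fun p => p.1 < p.2) (fatten eta lu).
  rewrite all_map; apply: sub_all lult => p /= plt; lra.
have nn eta' : fatten eta' lu != [::] by case: (lu) lu0.
have [n1 Hn1] := (cvg_epsP _ _).1 (H _ (nn eta) lt1) _ e4.
have [n2 Hn2] := (cvg_epsP _ _).1 (H _ (nn (- eta)) lt2) _ e4.
rewrite !size_map in Hn1 Hn2; set K := size lu in Hn1 Hn2.
have [B1 HB1] := @box_bound R lu.
have [B2 HB2] := @box_bound R (fatten (- eta) lu).
(* The first bound keeps the rescaling within [eta] for both boxes; the second gives (C / A - 1) *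
   (V + e) <= e / 2. *)
pose d : R := Num.min (ratr eta / (B1 + B2 + 1)%:R) (e / 2 / (V + e)).
have d0 : 0 < d.
  rewrite lt_min; apply/andP; split; last by apply: divr_gt0; lra.
  by rewrite divr_gt0 ?ltr0q// ltr0n addn1.
have [n3 Hn3] := (cvg_epsP _ _).1 (@scale_ratio_cvg K) _ d0.
exists (scale K (n1 + n2 + n3 + 1))%N => N nN.
have N0 : (0 < N)%N by apply: leq_trans nN; rewrite expn_gt0 addn1.
have [[|j] [// _ jN Nj]] := scale_between K N0.
have jn : (n1 + n2 + n3 <= j)%N.
  rewrite leqNgt; apply/negP => h; have : (N < N)%N; last by rewrite ltnn.
  apply: leq_trans Nj _; apply: leq_trans (scale_le K _) nN.
  by rewrite addn1 ltnS.
set A := scale K j.+1 in jN; set C := scale K j.+2 in Nj.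
have A0 : (0 < A)%N by rewrite expn_gt0.
have /(_ j)/(_ (leq_trans (leq_addl _ _) jn)) := Hn3; rewrite -/A -/C.
have RA : 0 < A%:R :> R by rewrite ltr0n.
have RN : 0 < N%:R :> R by rewrite ltr0n.
have RC : 0 < C%:R :> R by rewrite ltr0n expn_gt0.
have AN : A%:R <= N%:R :> R by rewrite ler_nat.
have NC : N%:R <= C%:R :> R by rewrite ler_nat ltnW.
rewrite ler_norml => /andP[_]; rewrite le_min => /andP[dB dV].
have ratio1 : N%:R / A%:R <= C%:R / A%:R :> R by rewrite ler_wpM2r// invr_ge0 ltW.
have ratio2 : C%:R / N%:R <= C%:R / A%:R :> R.
  by rewrite ler_wpM2l ?lef_pV2 ?posrE// ltW.
have CA1 : 1 <= C%:R / A%:R :> R by rewrite ler_pdivlMr// mul1r (le_trans AN).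
have dB' (B : nat) (rho : R) : (B <= B1 + B2 + 1)%N -> rho <= C%:R / A%:R ->
    (rho - 1) * B%:R <= ratr eta.
  move=> BB rhoC; apply: (@le_trans _ _ ((C%:R / A%:R - 1) * (B1 + B2 + 1)%:R)).
    apply: (@le_trans _ _ ((C%:R / A%:R - 1) * B%:R)).
      by rewrite ler_wpM2r// lerD2r.
    by rewrite ler_wpM2l ?subr_ge0// ler_nat.
  by rewrite -ler_pdivlMr// ltr0n addn1.
have up : (box_count N lu b <= box_count C (fatten eta lu) b)%N.
  apply: (@box_count_rescale _ _ _ _ _ b N0 (ltnW Nj) HB1 eta0); apply: dB' => //.
  by rewrite -addnA leq_addr.
have lo : (box_count A (fatten (- eta) lu) b <= box_count N lu b)%N.
  rewrite -[in X in (_ <= X)%N](fattenK eta lu).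
  apply: (@box_count_rescale _ _ _ _ _ b A0 jN HB2 eta0); apply: dB' => //.
  by rewrite addnAC leq_addl.
have jn1 : (n1 <= j.+2)%N by clear -jn; lia.
have jn2 : (n2 <= j.+1)%N by clear -jn; lia.
have h1 := Hn1 _ jn1; have h2 := Hn2 _ jn2.
rewrite -/A in h2; rewrite -/C in h1.
move: h1 h2 V1 V2; rewrite !ler_norml => /andP[_ h1] /andP[h2 _] /andP[_ V1] /andP[V2 _].
set q : R := C%:R / A%:R in CA1 dV ratio1 ratio2.
have qV : (q - 1) * (V + e) <= e / 2 by rewrite -ler_pdivlMr//; lra.
have up' : (box_count N lu b)%:R / N%:R <= q * (V + e / 2).
  apply: (@le_trans _ _ ((C%:R / N%:R) * ((box_count C (fatten eta lu) b)%:R / C%:R))).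
    rewrite [leRHS](_ : _ = (box_count C (fatten eta lu) b)%:R / N%:R).
      by rewrite ler_wpM2r ?invr_ge0 ?(ltW RN)// ler_nat.
    by field; rewrite !gt_eqF.
  by apply: ler_pM => //; lra.
have lo' : V - e / 2 <= q * ((box_count N lu b)%:R / N%:R).
  apply: (@le_trans _ _ ((box_count A (fatten (- eta) lu) b)%:R / A%:R)); first lra.
  apply: (@le_trans _ _ ((N%:R / A%:R) * ((box_count N lu b)%:R / N%:R))).
    rewrite [leRHS](_ : _ = (box_count N lu b)%:R / A%:R).
      by rewrite ler_wpM2r ?invr_ge0 ?(ltW RA)// ler_nat.
    by field; rewrite !gt_eqF.
  by rewrite ler_wpM2r// divr_ge0.
have x0 : 0 <= (box_count N lu b)%:R / N%:R :> R by rewrite divr_ge0.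
move: x0 up' lo'; set w := _ / N%:R => x0 up' lo'.
clear -CA1 qV up' lo' V0 x0 e0.
by apply/andP; split; nra.
Qed.

End Interpolation.

(** * From boxes to test functions *)

Section CompactSupport.
Context {R : realType}.
Variables (n : nat) (f : 'rV[R]_n -> R).
Hypothesis f_cont : continuous f.
Hypothesis f_supp : compactly_supported f.

Let A : set 'rV[R]_n := closure [set x | f x != 0].

Lemma rV_ballP (x y : 'rV[R]_n) e : 0 < e ->
  ball x e y <-> forall i, `|x 0 i - y 0 i| < e.
Proof.
move=> e0; split=> [[_ h] i|h]; first exact: h.
by split=> // i j; rewrite (ord1 i); exact: h.
Qed.

Lemma compact_support_bound :
  exists C : nat, forall u, f u != 0 -> forall i, `|u 0 i| < C%:R.
Proof.
have /compact_near_coveringP cov := f_supp.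
have : \forall C \near \oo, A `<=` (fun u : 'rV[R]_n => forall i, `|u 0 i| < (C : nat)%:R).
  apply: (cov nat \oo (fun (C : nat) (u : 'rV[R]_n) => forall i, `|u 0 i| < C%:R)) => x Ax.
  pose S := \sum_i `|x 0 i| : R.
  exists (ball x 1, [set C : nat | S + 1 <= C%:R]).
    split => /=; first exact: nbhsx_ballx.
    exists (Num.truncn (S + 1)).+1 => // C /= SC.
    by apply: le_trans (ltW (truncnS_gt _)) _; rewrite ler_nat.
  move=> [y C] /= [/rV_ballP-/(_ ltr01) xy SC] i.
  apply: lt_le_trans SC; apply: (@le_lt_trans _ _ (`|x 0 i| + `|x 0 i - y 0 i|)).
    by rewrite -{1}[y 0 i](subKr (x 0 i)) ler_normB.
  apply: ler_ltD; last exact: xy.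
  by rewrite /S (bigD1 i)//= lerDl sumr_ge0.
move=> [C _ HC]; exists C => u fu; apply: (HC C) => //=.
exact: subset_closure.
Qed.

(** Compactness makes [d] uniform over the support; by symmetry one of the two points may be taken
    there, since off the support [f] vanishes at both. *)
Lemma compact_support_unif (e : R) : 0 < e -> exists2 d : R, 0 < d &
  forall u v : 'rV[R]_n, (forall i, `|u 0 i - v 0 i| < d) -> `|f u - f v| <= e.
Proof.
move=> e0; have /compact_near_coveringP cov := f_supp.
have : \forall d \near 0^'+, A `<=` (fun u : 'rV[R]_n =>
    forall v : 'rV[R]_n, (forall i, `|u 0 i - v 0 i| < d) -> `|f u - f v| <= e).
  apply: (cov R (0^'+) (fun (d : R) (u : 'rV[R]_n) =>
    forall v : 'rV[R]_n, (forall i, `|u 0 i - v 0 i| < d) -> `|f u - f v| <= e)) => x Ax.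
  have e2 : 0 < e / 2 by lra.
  have /nbhs_ballP[r /= r0 xr] : \forall y \near x, `|f x - f y| < e / 2.
    by have /cvgrPdist_lt := @f_cont x; apply.
  have r2 : 0 < r / 2 by lra.
  exists (ball x (r / 2), [set d : R | d < r / 2]).
    split => /=; first exact: nbhsx_ballx.
    by apply: nbhs_right_lt.
  move=> [y d] /= [/(rV_ballP _ _ r2) xy dr] v yv.
  have h1 : `|f x - f y| < e / 2.
    by apply: xr; apply/rV_ballP => // i; apply: lt_trans (xy i) _; lra.
  have h2 : `|f x - f v| < e / 2.
    apply: xr; apply/rV_ballP => // i.
    rewrite -(subrKA (y 0 i)) (le_lt_trans (ler_normD _ _))//.
    by have := xy i; have := yv i; lra.
  rewrite -(subrKA (f x)) (le_trans (ler_normD _ _))// distrC; lra.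
move=> /(filterI (nbhs_right_gt (0 : R))) /filter_ex [d [d0 Hd]].
exists d => // u v uv.
have [Au|nAu] := pselect (A u); first exact: Hd.
have [Av|nAv] := pselect (A v).
  by rewrite distrC; apply: Hd => // i; rewrite distrC; exact: uv.
have f0 w : ~ A w -> f w = 0.
  by move=> nAw; apply/eqP; apply: contrapT => /negP fw; apply: nAw; exact: subset_closure.
by rewrite !f0// subrr normr0 ltW.
Qed.

End CompactSupport.

Section CorrelationSum.
Context {R : realType}.
Variables (K : nat) (f : 'rV[R]_K.+1 -> R) (C : nat).
Hypothesis fC : forall u, f u != 0 -> forall i, `|u 0 i| < C%:R.

Definition scaled_gaps (N : nat) (b : nat -> R) (x : seq nat) : 'rV[R]_K.+1 :=
  \row_i (N%:R * centred_frac (b (nth 0%N x i) - b (nth 0%N x i.+1))).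

Lemma sum_tuples_seqs N (F : seq nat -> R) :
  \sum_(x : K.+2.-tuple 'I_N | uniq x) F [seq (j : 'I_N).+1 | j <- x] =
  \sum_(x <- seqs N K.+2 | uniq x) F x.
Proof.
pose g (x : K.+2.-tuple 'I_N) := [seq (j : 'I_N).+1 | j <- x].
have gI : injective g.
  move=> x y /inj_map xy; apply/val_inj/xy => i i' [] ii'; exact: val_inj.
have E : perm_eq [seq g x | x <- enum {: K.+2.-tuple 'I_N}] (seqs N K.+2).
  apply: uniq_perm; [by rewrite map_inj_uniq ?enum_uniq|exact: uniq_seqs|].
  move=> s; rewrite mem_seqs; apply/mapP/andP.
    move=> [x _ ->]; rewrite size_map size_tuple eqxx; split=> //.
    by apply/allP => y /mapP[i _ ->]; rewrite /= mem_iota /= add1n ltnS; exact: ltn_ord.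
  move=> [/eqP ss /allP sN].
  have lt i : i \in s -> (i.-1 < N)%N by move=> /sN; rewrite /= mem_iota; lia.
  have N0 : (0 < N)%N by case: s ss sN lt => // y s _ _ /(_ y (mem_head _ _)); lia.
  pose h i : 'I_N := insubd (Ordinal N0) i.-1.
  have sz : size [seq h i | i <- s] == K.+2 by rewrite size_map ss.
  exists (Tuple sz); first by rewrite mem_enum.
  rewrite /g /= -map_comp -[LHS]map_id; apply/eq_in_map => i si /=.
  rewrite /h val_insubd lt// prednK//.
  by have := sN _ si; rewrite /= mem_iota => /andP[].
rewrite -(perm_big _ E) big_map big_enum_cond /=.
apply: eq_bigl => x; rewrite /g map_inj_uniq// => i i' [] ii'; exact: val_inj.
Qed.

(** For 2C < N a nonzero term forces each entry of the difference to be within 1/2 of that of [m].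
    So each tuple meets at most one translate, by the nearest integers, and its gaps are
    [scaled_gaps]. *)
Lemma correlation_sumE (N : nat) (b : nat -> R) : (2 * C < N)%N ->
  correlation_sum K.+2 f b N =
  N%:R^-1 * \sum_(x <- seqs N K.+2 | uniq x) f (scaled_gaps N b x).
Proof.
move=> CN; rewrite /correlation_sum; congr (_ * _).
have N0 : 0 < N%:R :> R by rewrite ltr0n; lia.
pose near (x : seq nat) : 'rV[int]_K.+1 :=
  \row_i Num.floor (b (nth 0%N x i) - b (nth 0%N x i.+1) + 2^-1).
pose S (x : K.+2.-tuple 'I_N) := [seq (j : 'I_N).+1 | j <- x].
have nearE x m : f (N%:R *: (Delta K.+2 b x - map_mx intr m)) != 0 -> m = near x.
  move=> /fC h; apply/rowP => i; rewrite !mxE; apply/esym/floor_def.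
  have := h i; rewrite !mxE normrM gtr0_norm// -ltr_pdivlMl// => h'.
  have : N%:R^-1 * C%:R < 2^-1 :> R.
    rewrite ltr_pdivrMl// ltr_pdivlMr// -natrM ltr_nat; lia.
  move=> /(lt_trans h'); rewrite ltr_norml => /andP[h1 h2].
  by rewrite intrD; apply/andP; split; lra.
have scaledE x : f (scaled_gaps N b x) =
    f (N%:R *: (Delta K.+2 b x - map_mx intr (near x))).
  by congr f; apply/rowP => i; rewrite !mxE.
(* A finite set of translates outside which the inner sum vanishes. *)
pose r := undup [seq near (S x) | x <- enum {: K.+2.-tuple 'I_N}].
rewrite (_ : [set: 'rV[int]_K.+1] = [set` predT]); last first.
  by apply/seteqP; split => // m _; rewrite /= .
rewrite -(@bigfs _ _ _ _ r predT)//; last 2 first.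
- exact: undup_uniq.
- move=> m _ mr; apply: big1 => x _; apply/eqP; apply: contraNT mr => /nearE ->.
  by rewrite mem_undup; apply/mapP; exists x => //; rewrite mem_enum.
rewrite exchange_big /= -(sum_tuples_seqs N (fun x => f (scaled_gaps N b x))).
apply: eq_bigr => x _; rewrite (bigD1_seq (near (S x))) ?undup_uniq//=; last first.
  by rewrite mem_undup; apply/mapP; exists x => //; rewrite mem_enum.
rewrite scaledE big1 ?addr0// => m mx; apply/eqP; apply: contraNT mx => /nearE.
by move=> ->.
Qed.

End CorrelationSum.

(** * Step functions on a rational mesh *)

Section Steps.
Context {R : realType}.
Implicit Types lu : seq (rat * rat).

Definition in_box n lu (u : 'rV[R]_n) : bool :=
  [forall i : 'I_n, ratr (nth (0, 0) lu i).1 <= u 0 i < ratr (nth (0, 0) lu i).2].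

Lemma box_chain_nth (m : R) lu x b : size x = (size lu).+1 ->
  reflect (forall i, (i < size lu)%N -> ratr (nth (0, 0) lu i).1 <=
      m * centred_frac (b (nth 0%N x i) - b (nth 0%N x i.+1)) <
      ratr (nth (0, 0) lu i).2) (box_chain m lu x b).
Proof.
elim: lu x => [|p lu IH] [|y [|y' t]]//=; try by move=> _; constructor.
move=> [st]; apply: (iffP andP) => [[h /IH-/(_ (congr1 S st)) H] [|i]//= /H //|H].
by split; [exact: (H 0%N)|apply/IH => /=; [rewrite st|move=> i; exact: (H i.+1)]].
Qed.

Lemma box_chain_in_box K N lu b x : size lu = K.+1 -> size x = K.+2 ->
  box_chain N%:R lu x b = in_box lu (scaled_gaps (R := R) K N b x).
Proof.
move=> slu sx; apply/box_chain_nth/forallP; rewrite ?slu//.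
  by move=> H i; rewrite mxE; exact: H (ltn_ord i).
by move=> H i iK; have := H (Ordinal iK); rewrite mxE.
Qed.

Section Mesh.
Variables (n C q : nat).
Hypothesis q0 : (0 < q)%N.
Local Notation T := (2 * C * q)%N.

(** The cube [-C, C)^n is cut into cells of side 1 / q with rational corners, to which the box
    counts apply. *)
Definition cell_left (i : nat) : rat := i%:R / q%:R - C%:R.

Definition cell_box (v : {ffun 'I_n -> 'I_T}) : seq (rat * rat) :=
  [seq (cell_left (v i), cell_left (v i).+1) | i <- enum 'I_n].

Definition cell_corner (v : {ffun 'I_n -> 'I_T}) : 'rV[R]_n :=
  \row_i ratr (cell_left (v i)).

Definition full_box : seq (rat * rat) := nseq n (- C%:R, C%:R).

Let q0' : 0 < q%:R :> R. Proof. by rewrite ltr0n. Qed.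

Lemma ratr_cell_left i : ratr (cell_left i) = i%:R / q%:R - C%:R :> R.
Proof. by rewrite /cell_left rmorphB fmorph_div !rmorph_nat. Qed.

Lemma nth_cell_box v (i : 'I_n) :
  nth (0, 0) (cell_box v) i = (cell_left (v i), cell_left (v i).+1).
Proof. by rewrite (nth_map i) ?size_enum_ord ?ltn_ord// nth_ord_enum. Qed.

Lemma nth_full_box (i : 'I_n) : nth (0, 0) full_box i = (- C%:R, C%:R).
Proof. by rewrite nth_nseq ltn_ord. Qed.

Lemma size_cell_box v : size (cell_box v) = n.
Proof. by rewrite size_map size_enum_ord. Qed.

Lemma cell_itv (i : nat) (t : R) :
  (ratr (cell_left i) <= t < ratr (cell_left i.+1)) =
  (i%:R <= (t + C%:R) * q%:R < i.+1%:R).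
Proof.
by rewrite !ratr_cell_left lerBlDr ltrBrDr ler_pdivrMr// ltr_pdivlMr.
Qed.

Lemma cell_box_lt v : all (fun p => p.1 < p.2) (cell_box v).
Proof.
apply/allP => p /mapP[i _ ->] /=; rewrite /cell_left ltrD2r.
by rewrite ltr_pM2r ?invr_gt0 ?ltr0n// ltr_nat.
Qed.

Lemma full_box_lt : (0 < C)%N -> all (fun p => p.1 < p.2) full_box.
Proof.
move=> C0; apply/allP => p /nseqP[-> _] /=.
by rewrite -subr_gt0 opprK addr_gt0// ltr0n.
Qed.

Lemma cell_box_volume v : box_volume (cell_box v) = q%:R ^- n :> R.
Proof.
rewrite /box_volume big_map (eq_bigr (fun=> q%:R^-1)); last first.
  by move=> i _ /=; rewrite !ratr_cell_left -natr1; field; rewrite gt_eqF.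
by rewrite big_const_seq count_predT size_enum_ord iter_mulr_1 exprVn.
Qed.

Variable f : 'rV[R]_n -> R.
Hypothesis fC : forall u, f u != 0 -> forall i, `|u 0 i| < C%:R.

Definition step (u : 'rV[R]_n) : R :=
  \sum_v f (cell_corner v) * (in_box (cell_box v) u)%:R.

(** A point of the cube lies in exactly one cell and is closer than 1 / q to its corner in every
    coordinate; outside the cube both functions vanish. *)
Lemma step_approx (e : R) (u : 'rV[R]_n) : 0 <= e ->
  (forall u v : 'rV[R]_n, (forall i, `|u 0 i - v 0 i| < q%:R^-1) -> `|f u - f v| <= e) ->
  `|f u - step u| <= e * (in_box full_box u)%:R.
Proof.
move=> e0 unif; have [inb|nb] := boolP (in_box full_box u); last first.
  have -> : f u = 0.
    apply/eqP; apply: contraNT nb => /fC uC; apply/forallP => i.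
    rewrite nth_full_box rmorphN !rmorph_nat /=.
    by have := uC i; rewrite ltr_norml => /andP[/ltW -> ->].
  rewrite /step big1 ?subrr ?normr0 ?mulr0// => v _.
  rewrite (_ : in_box _ u = false) ?mulr0//; apply/negbTE; apply: contraNN nb.
  move=> /forallP H; apply/forallP => i; have := H i.
  rewrite nth_cell_box nth_full_box cell_itv rmorphN !rmorph_nat /=.
  move=> /andP[h1 h2]; apply/andP; split.
    rewrite -subr_ge0 opprK -(pmulr_lge0 _ q0'); exact: le_trans h1.
  have : (v i).+1%:R <= (2 * C * q)%:R :> R by rewrite ler_nat.
  move/(lt_le_trans h2); rewrite natrM ltr_pM2r// natrM; lra.
have uC i : - C%:R <= u 0 i < C%:R.
  by have /forallP/(_ i) := inb; rewrite nth_full_box rmorphN !rmorph_nat.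
have pos (i : 'I_n) : 0 <= (u 0 i + C%:R) * q%:R.
  by have /andP[h _] := uC i; rewrite mulr_ge0//; lra.
have ltT (i : 'I_n) : (Num.truncn ((u 0 i + C%:R) * q%:R)%R < T)%N.
  rewrite truncn_lt_nat// natrM ltr_pM2r// natrM.
  by have /andP[_ h] := uC i; lra.
pose v0 : {ffun 'I_n -> 'I_T} := [ffun i => Ordinal (ltT i)].
have inv v : in_box (cell_box v) u = (v == v0).
  apply/forallP/eqP => [H|-> i].
    apply/ffunP => i; apply/val_inj; rewrite ffunE /=; have := H i.
    by rewrite nth_cell_box cell_itv -truncn_eq// => /eqP.
  by rewrite nth_cell_box cell_itv ffunE /= -truncn_eq.
rewrite /step (bigD1 v0)//= inv eqxx mulr1 big1 ?addr0 ?mulr1; last first.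
  by move=> v /negbTE vv; rewrite inv vv mulr0.
apply: unif => i; rewrite mxE ffunE ratr_cell_left /=.
have /andP[] := truncn_itv (pos i); set m := Num.truncn _ => h1 h2.
have h1' : m%:R / q%:R <= u 0 i + C%:R by rewrite ler_pdivrMr.
have h2' : u 0 i + C%:R < (m%:R + 1) / q%:R by rewrite ltr_pdivlMr// natr1.
rewrite mulrDl mul1r in h2'; rewrite ltr_norml.
have qi : 0 < q%:R^-1 :> R by rewrite invr_gt0.
by apply/andP; split; lra.
Qed.

End Mesh.
End Steps.

(** * Integrals of step functions over tuples *)

Section TupleIntegral.
Context {R : realType}.
Implicit Types lu : seq (rat * rat).

Definition row_of_tuple n (t : n.-tuple R) : 'rV[R]_n := \row_i tnth t i.

Definition tuple_box (n : nat) lu : set (n.-tuple (measurableTypeR R)) :=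
  [set t | in_box lu (row_of_tuple t)].

Arguments tuple_box : clear implicits.

Lemma measurable_tuple_box n lu : measurable (tuple_box n lu).
Proof.
rewrite (_ : tuple_box n lu = ~` \bigcup_(i : 'I_n)
  ~` ((fun t : n.-tuple (measurableTypeR R) => tnth t i) @^-1`
      `[ratr (nth (0, 0) lu i).1, ratr (nth (0, 0) lu i).2[)).
  apply: measurableC; apply: countable_bigcupT_measurable; first exact: countableP.
  move=> i; apply: measurableC; rewrite -[X in measurable X]setTI.
  exact: measurable_tnth.
rewrite setC_bigcup; apply/seteqP; split => t.
  by move=> /forallP H i _; rewrite setCK /= in_itv/=; have := H i; rewrite mxE.
move=> H; apply/forallP => i; have := H i I; rewrite setCK /= in_itv/=.
by rewrite mxE.
Qed.

Lemma in_boxE n lu :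
  (fun t : n.-tuple (measurableTypeR R) => (in_box lu (row_of_tuple t))%:R) = \1_(tuple_box n lu) :> (n.-tuple (measurableTypeR R) -> R).
Proof.
apply/funext => t; rewrite indicE; congr (nat_of_bool _)%:R.
by apply/idP/idP; rewrite inE.
Qed.

Lemma lebesgue_tuple_box n lu : size lu = n -> all (fun p => p.1 < p.2) lu ->
  lebesgue_tuple R n (tuple_box n lu) = (@box_volume R lu)%:E.
Proof.
elim: n lu => [|n IH] [|p lu]//=.
  move=> _ _; rewrite /box_volume big_nil diracE mem_set//.
  by apply/forallP => -[].
move=> [slu] /andP[plt lult].
rewrite /cons_measure /pushforward.
have -> : @cons_pair _ (measurableTypeR R) n @^-1` tuple_box n.+1 (p :: lu) =
    `[ratr p.1, ratr p.2[%classic `*` tuple_box n lu.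
  apply/seteqP; split => -[x t] /=; rewrite in_itv /=.
    move=> /forallP H; split; first by have := H ord0; rewrite mxE tnth0.
    by apply/forallP => i; have := H (lift ord0 i); rewrite !mxE tnthS.
  move=> [xp /forallP H]; apply/forallP => i; rewrite mxE.
  by case: (unliftP ord0 i) => [j ->|->] /=; rewrite ?tnth0// tnthS; have := H j; rewrite mxE.
rewrite product_measure1E//; last exact: measurable_tuple_box.
rewrite IH// [X in (X * _)%E](lebesgue_measure_itv `[ratr p.1 : R, ratr p.2[) /= lte_fin ltr_rat plt -EFinB -EFinM.
by rewrite /box_volume big_cons.
Qed.

Section Integral.
Variables (n C : nat) (f : 'rV[R]_n -> R).
Hypothesis C0 : (0 < C)%N.
Hypothesis fC : forall u, f u != 0 -> forall i, `|u 0 i| < C%:R.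
Hypothesis f_unif : forall e : R, 0 < e -> exists2 d : R, 0 < d &
  forall u v : 'rV[R]_n, (forall i, `|u 0 i - v 0 i| < d) -> `|f u - f v| <= e.

Local Notation mun := (lebesgue_tuple R n).
Local Notation Tn := (n.-tuple (measurableTypeR R)).

Lemma step_approx_mesh (e : R) : 0 < e -> exists q0 : nat, forall q u, (q0 <= q)%N ->
  (0 < q)%N /\ `|f u - step C q f u| <= e * (in_box (full_box n C) u)%:R.
Proof.
move=> e0; have [d d0 Hd] := f_unif e0.
exists (Num.truncn d^-1).+1 => q u qd; have q0 : (0 < q)%N by exact: leq_trans qd.
split => //; apply: step_approx => //; first exact: ltW.
move=> x y xy; apply: Hd => i; apply: lt_trans (xy i) _.
rewrite invf_plt ?posrE ?ltr0n//; apply: lt_le_trans (truncnS_gt _) _.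
by rewrite ler_nat.
Qed.

Lemma measurable_step q : measurable_fun setT (fun t : Tn => step C q f (row_of_tuple t)).
Proof.
apply: measurable_sum => v; apply: measurable_funM; first exact: measurable_cst.
rewrite in_boxE; apply: measurable_indic; exact: measurable_tuple_box.
Qed.

(** The regularity of [f] concerns row vectors and measurability concerns tuples; a pointwise limit
    of step functions bridges the two. *)
Lemma measurable_row_of_tuple : measurable_fun setT (fun t : Tn => f (row_of_tuple t)).
Proof.
apply: (measurable_fun_cvg (fun q => @measurable_step q)) => t _.
apply/cvg_epsP => e e0; have [q0 H] := step_approx_mesh e0; exists q0 => q qq0.
have [_] := H q (row_of_tuple t) qq0; rewrite distrC => /le_trans; apply.
by case: in_box; rewrite ?mulr1// mulr0 ltW.
Qed.

Lemma integrable_in_box lu (r : R) : size lu = n -> all (fun p => p.1 < p.2) lu ->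
  mun.-integrable setT (EFin \o (fun t : Tn => r * (in_box lu (row_of_tuple t))%:R)).
Proof.
move=> slu lult.
have mB := @measurable_tuple_box n lu.
rewrite (_ : _ \o _ = (fun t => r%:E * (\1_(tuple_box n lu) t)%:E)%E); last first.
  by apply/funext => t; rewrite -in_boxE /= EFinM.
apply: integrableZl => //; apply/integrableP; split.
  by apply/measurable_EFinP; exact: measurable_indic.
under eq_integral => t _ do rewrite gee0_abs ?lee_fin//.
rewrite integral_indic// setIT.
by rewrite [X in (X < _)%E](lebesgue_tuple_box slu lult) ltry.
Qed.

Lemma integral_in_box lu (r : R) : size lu = n -> all (fun p => p.1 < p.2) lu ->
  (\int[mun]_t (r * (in_box lu (row_of_tuple t))%:R))%R = r * box_volume lu.
Proof.
move=> slu lult; rewrite RintegralZl//; last first.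
  have := integrable_in_box 1 slu lult; congr (integrable _ _ _).
  by apply/funext => t /=; rewrite mul1r.
congr (_ * _); rewrite in_boxE /Rintegral integral_indic//; last first.
  exact: measurable_tuple_box.
by rewrite setIT [X in fine X](lebesgue_tuple_box slu lult).
Qed.

Lemma integrable_step q : (0 < q)%N ->
  mun.-integrable setT (EFin \o (fun t : Tn => step C q f (row_of_tuple t))).
Proof.
move=> q0.
rewrite (_ : _ \o _ = fun t => (\sum_(v : {ffun 'I_n -> 'I_(2 * C * q)}) (f (cell_corner v) *
    (in_box (cell_box v) (row_of_tuple t))%:R)%:E)%E); last first.
  by apply/funext => t; rewrite /= sumEFin.
apply: integrable_sum => // v _; apply: integrable_in_box.
  exact: size_cell_box.
exact: cell_box_lt.
Qed.

Lemma integral_step q : (0 < q)%N ->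
  (\int[mun]_t step C q f (row_of_tuple t))%R =
  \sum_(v : {ffun 'I_n -> 'I_(2 * C * q)}) f (cell_corner v) * q%:R ^- n.
Proof.
move=> q0; rewrite /Rintegral.
under eq_integral => t _ do rewrite /step -sumEFin.
rewrite integral_sum//; last first.
  by move=> v; apply: integrable_in_box; [exact: size_cell_box|exact: cell_box_lt].
rewrite -sum_fine//; last first.
  move=> v _; apply: integrable_fin_num => //.
  by apply: integrable_in_box; [exact: size_cell_box|exact: cell_box_lt].
apply: eq_bigr => v _; rewrite -(cell_box_volume q0 v).
by apply: integral_in_box; [exact: size_cell_box|exact: cell_box_lt].
Qed.

Lemma integral_step_near (e : R) q : (0 < q)%N ->
  (forall u, `|f u - step C q f u| <= e * (in_box (full_box n C) u)%:R) ->
  `|Rn_integral f - \sum_(v : {ffun 'I_n -> 'I_(2 * C * q)})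
      f (cell_corner v) * q%:R ^- n| <= e * box_volume (full_box n C).
Proof.
move=> q0 fe; rewrite -integral_step//.
have iS := integrable_step q0.
have sF : size (full_box n C) = n by rewrite size_nseq.
have iB := integrable_in_box e sF (full_box_lt n C0).
(* The difference is dominated by a multiple of the indicator of the cube; adding the step function
   back makes [f] integrable. *)
have iD : mun.-integrable setT
    (EFin \o (fun t : Tn => f (row_of_tuple t) - step C q f (row_of_tuple t))).
  apply: le_integrable iB => //.
    apply/measurable_EFinP; apply: measurable_funB.
      exact: measurable_row_of_tuple.
    exact: measurable_step.
  by move=> t _; rewrite /= lee_fin (le_trans (fe _))// ler_norm.
have iF : mun.-integrable setT (EFin \o (fun t : Tn => f (row_of_tuple t))).
  have := integrableD measurableT iD iS; congr (integrable _ _ _).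
  by apply/funext => t /=; rewrite -EFinD subrK.
rewrite -(RintegralB measurableT iF iS).
apply: (le_trans (le_normr_Rintegral measurableT iD)).
rewrite -(integral_in_box e sF (full_box_lt n C0)); apply: le_Rintegral => //.
by have := integrable_abse iD; congr (integrable _ _ _).
Qed.

End Integral.
End TupleIntegral.

Section TestFunctions.
Context {R : realType}.
Variables (K : nat) (b : nat -> R) (f : 'rV[R]_K.+1 -> R).
Local Notation n := K.+1.
Hypothesis boxes : forall lu, lu != [::] -> all (fun p => p.1 < p.2) lu ->
  (box_count N lu b)%:R / N%:R @[N --> \oo] --> @box_volume R lu.

Let avg_gaps (N : nat) (g : 'rV[R]_n -> R) : R :=
  N%:R^-1 * \sum_(x <- seqs N K.+2 | uniq x) g (scaled_gaps K N b x).

Lemma box_count_average N lu : size lu = n ->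
  avg_gaps N (fun u => (in_box lu u)%:R) = (box_count N lu b)%:R / N%:R.
Proof.
move=> slu; rewrite /avg_gaps mulrC; congr (_ / _).
rewrite /box_count slu -sum1_count natr_sum [RHS]big_mkcondr.
rewrite big_seq_cond [RHS]big_seq_cond; apply: eq_bigr => x /andP[xs _].
have /eqP sx : size x == K.+2 by move: xs; rewrite mem_seqs => /andP[].
by rewrite (box_chain_in_box N b slu sx); case: in_box.
Qed.

Lemma average_step N C q : avg_gaps N (step C q f) =
  \sum_(v : {ffun 'I_n -> 'I_(2 * C * q)}) f (cell_corner v) *
    ((box_count N (cell_box v) b)%:R / N%:R).
Proof.
rewrite {1}/avg_gaps /step exchange_big mulr_sumr; apply: eq_bigr => v _.
rewrite -box_count_average ?size_cell_box// /avg_gaps -mulr_sumr.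
by rewrite mulrCA.
Qed.

Lemma average_near N C q (e : R) :
  (forall u, `|f u - step C q f u| <= e * (in_box (full_box n C) u)%:R) ->
  `|avg_gaps N f - avg_gaps N (step C q f)| <=
    e * ((box_count N (full_box n C) b)%:R / N%:R).
Proof.
move=> fe; rewrite -box_count_average ?size_nseq// /avg_gaps.
rewrite -mulrBr -sumrB normrM normfV normr_nat mulrCA ler_wpM2l ?invr_ge0//.
rewrite mulr_sumr; apply: le_trans (ler_norm_sum _ _ _) _; exact: ler_sum.
Qed.

Hypothesis f_cont : continuous f.
Hypothesis f_supp : compactly_supported f.

(** The averages and the integral are each within e / 3 of those of one step function, whose
    averages converge as finite combinations of box counts. *)
Lemma average_cvg : avg_gaps N f @[N --> \oo] --> Rn_integral f.
Proof.
have [C0 fC0] := compact_support_bound f_supp; pose C := C0.+1.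
have fC u : f u != 0 -> forall i, `|u 0 i| < C%:R.
  by move=> fu i; apply: lt_le_trans (fC0 u fu i) _; rewrite ler_nat.
have C_gt0 : (0 < C)%N by [].
have f_unif := compact_support_unif f_cont f_supp.
apply/cvg_epsP => e e0; set V : R := box_volume (full_box n C).
have boxV : (box_count N (full_box n C) b)%:R / N%:R @[N --> \oo] --> V.
  by apply: boxes => //; exact: full_box_lt.
have V0 : 0 <= V.
  rewrite /V /box_volume big_seq; apply: prodr_ge0 => p /nseqP[-> _] /=.
  by rewrite rmorphN rmorph_nat; have := ler0n R C; lra.
have V1 : 0 < 3 * (V + 1) by lra.
(* The normalised count of the cube is eventually at most V + 1, so this tolerance costs e / 3
   overall. *)
have e1 : 0 < e / (3 * (V + 1)) by rewrite divr_gt0.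
have [q Hq'] := step_approx_mesh fC f_unif e1.
have Hq u := Hq' q u (leqnn q).
have q0 : (0 < q)%N by have [] := Hq 0.
have fe u := (Hq u).2.
have Int := integral_step_near C_gt0 fC f_unif q0 fe.
have e3 : 0 < e / 3 by lra.
have sumcvg : \sum_(v : {ffun 'I_n -> 'I_(2 * C * q)}) f (cell_corner v) *
    ((box_count N (cell_box v) b)%:R / N%:R) @[N --> \oo] -->
    \sum_(v : {ffun 'I_n -> 'I_(2 * C * q)}) f (cell_corner v) * q%:R ^- n.
  apply: cvg_big => [|v _]; first exact: add_continuous.
  apply: cvgMl_tmp; rewrite -(cell_box_volume q0 v).
  apply: boxes; last exact: cell_box_lt.
  by rewrite -size_eq0 size_cell_box.
have [m1 H1] := (cvg_epsP _ _).1 sumcvg _ e3.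
have [m2 H2] := (cvg_epsP _ _).1 (boxV) _ ltr01.
exists (maxn m1 m2) => N; rewrite geq_max => /andP[/H1 h1 /H2 h2].
have h3 := average_near N fe; rewrite average_step in h3.
have h4 : e / (3 * (V + 1)) * ((box_count N (full_box n C) b)%:R / N%:R) <= e / 3.
  have -> : e / 3 = e / (3 * (V + 1)) * (V + 1) by field; lra.
  apply: ler_wpM2l; first exact: ltW.
  by move: h2; rewrite ler_norml -/V => /andP[_]; lra.
have h5 : e / (3 * (V + 1)) * V <= e / 3.
  have -> : e / 3 = e / (3 * (V + 1)) * (V + 1) by field; lra.
  by apply: ler_wpM2l; [exact: ltW|lra].
rewrite distrC in Int.
move: (le_trans h3 h4) h1 (le_trans Int h5).
set x := avg_gaps N f; set y := \sum_v _; set s := \sum_v _; set i := Rn_integral f.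
rewrite !ler_norml => /andP[? ?] /andP[? ?] /andP[? ?]; apply/andP; split; lra.
Qed.

Lemma correlation_sum_cvg :
  correlation_sum K.+2 f b N @[N --> \oo] --> Rn_integral f.
Proof.
have [C fC] := compact_support_bound f_supp.
apply: cvg_trans average_cvg; apply: near_eq_cvg.
by exists (2 * C).+1 => // N /= CN; rewrite (correlation_sumE fC).
Qed.

End TestFunctions.

(** * Correlations of all orders *)

Lemma poissonian_of_box_counts (R : realType) (b : nat -> R) :
  (forall lu, lu != [::] -> all (fun p => p.1 < p.2) lu ->
    (box_count N lu b)%:R / N%:R @[N --> \oo] --> @box_volume R lu) ->
  forall k, (2 <= k)%N -> poissonian_correlation k b.
Proof.
move=> boxes [|[|K]]// _ f f_smooth f_supp.
by apply: correlation_sum_cvg => //; exact: f_smooth 0%N.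
Qed.

(** Numbers that code no index are given the true proposition, which reduces the claim to
    sequences. *)
Lemma ae_forall_count (R : realType) (I : countType) (P : I -> R -> Prop) :
  (forall i, {ae @lebesgue_measure R, forall x, P i x}) ->
  {ae @lebesgue_measure R, forall x, forall i, P i x}.
Proof.
move=> aeP; pose Q m x := if @unpickle I m is Some i then P i x else True.
have /ae_foralln : forall m, {ae @lebesgue_measure R, forall x, Q m x}.
  move=> m; rewrite /Q; case: unpickle => [i|]; first exact: aeP.
  by apply: aeW.
by apply: ae_mono => x H i; have := H (pickle i); rewrite /Q pickleK.
Qed.

Theorem theorem1p1 (R : realType) (a : nat -> R)
    (a_pos : forall n : nat, (1 <= n)%N -> 0 < a n)
    (a_lac : lacunary a) :
  {ae @lebesgue_measure R, forall alpha : R,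
    forall k : nat, (2 <= k)%N ->
      poissonian_correlation k (fun n => alpha * a n)}.
Proof.
case: a_lac => c c1 lac.
(* The parameters are countable: the left end of a unit interval and a rational box of any
   dimension. One null set then serves every k and every test function. *)
pose P (p : int * seq (rat * rat)) (alpha : R) :=
  p.2 != [::] -> all (fun p => p.1 < p.2) p.2 -> p.1%:~R <= alpha < p.1%:~R + 1 ->
  (box_count (scale (size p.2) j) p.2 (fun n => alpha * a n))%:R /
    (scale (size p.2) j)%:R @[j --> \oo] --> @box_volume R p.2.
have /ae_forall_count : forall p, {ae @lebesgue_measure R, forall x, P p x}.
  move=> [z lu]; rewrite /P /=.
  have [->|lu0] := eqVneq lu [::].
    by apply: aeW.
  have [lult|_] := boolP (all _ lu); last first.
    by apply: aeW.
  apply: ae_mono (box_count_scale_cvg z%:~R a_pos c1 lac lu0 lult).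
  by move=> x H _ _ /H.
apply: ae_mono => alpha H; apply: poissonian_of_box_counts => lu lu0 lult.
apply: box_count_cvg_of_scale => // lu' lu'0 lult'.
by apply: (H (Num.floor alpha, lu')) => //=; rewrite -[1]/(1%:~R) -intrD; exact: floor_itv.
Qed.
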